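(* Let $\Gamma$ be a fixed sentence of the two-variable fragment of first-order logic, and let $$\Upsilon=(|R_{i_1}|\bowtie_1 k_1)\wedge\dots\wedge(|R_{i_m}|\bowtie_m k_m)\wedge(\forall x\,\exists_{=1}y:S_1(x,y))\wedge\dots\wedge(\forall x\,\exists_{=1}y:S_{m'}(x,y))$$ be a conjunction of cardinality constraints (with $\bowtie_j\in\{=,\le,\ge,<,>\}$ and fixed natural numbers $k_j$) and functionality constraints on binary predicates $S_1,\dots,S_{m'}$. Then computing the WFOMC of $\Gamma\wedge\Upsilon$ is domain-liftable: there is an algorithm which, given a finite domain $\Delta$ and rational weight functions $w,\overline{w}$ on the predicates, computes $\mathrm{WFOMC}(\Gamma\wedge\Upsilon,w,\overline{w},\Delta)$ in time polynomial in $|\Delta|$ and in the number of bits needed to encode the weights.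
   Context: Fix a function-free first-order language with a finite set $\mathcal{R}$ of predicates. A domain $\Delta$ is a finite set. A possible world $\omega$ on $\Delta$ is a set of ground atoms over $\mathcal{R}$ and $\Delta$; $\Omega_\Delta$ is the set of all of them. $N(R,\omega)$ is the number of ground atoms of $R$ true in $\omega$. $\mathrm{WFOMC}(\Gamma,w,\overline{w},\Delta)=\sum_{\omega\in\Omega_\Delta,\,\omega\models\Gamma}\prod_{R\in\mathcal{R}} w(R)^{N(R,\omega)}\overline{w}(R)^{|\Delta|^{\mathrm{arity}(R)}-N(R,\omega)}$. A cardinality constraint $|R|\bowtie k$ holds in $\omega$ iff $N(R,\omega)\bowtie k$. $\forall x\,\exists_{=1}y: S(x,y)$ holds iff for every $x\in\Delta$ there is exactly one $y\in\Delta$ with $S(x,y)$ true. *)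

(* Defs.v *)
From HB Require Import structures.
From mathcomp Require Import all_boot all_order all_algebra.
Set Implicit Arguments. Unset Strict Implicit. Unset Printing Implicit Defensive.
Import Order.TTheory GRing.Theory Num.Theory.

(* Syntax of the two-variable fragment FO^2 (function-free, relational, *)
(* with equality).  The signature is a finite set of predicates 'I_p,   *)
(* predicate R having arity ar R.  The two variables are x := false and *)
(* y := true.                                                          *)
Inductive fo2form (p : nat) (ar : 'I_p -> nat) : Type :=
| FAtom (R : 'I_p) (args : 'I_(ar R) -> bool)
| FEq (u v : bool)
| FNot (f : fo2form ar)
| FAnd (f g : fo2form ar)
| FEx (v : bool) (f : fo2form ar).
Arguments FAtom {p ar}.
Arguments FEq {p ar}.
Arguments FNot {p ar}.
Arguments FAnd {p ar}.
Arguments FEx {p ar}.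

Fixpoint fv p (ar : 'I_p -> nat) (f : fo2form ar) : seq bool :=
  match f with
  | FAtom R args => [seq args i | i <- enum 'I_(ar R)]
  | FEq u v => [:: u; v]
  | FNot g => fv g
  | FAnd g h => fv g ++ fv h
  | FEx v g => [seq u <- fv g | u != v]
  end.
Definition is_sentence p (ar : 'I_p -> nat) (f : fo2form ar) : bool := nilp (fv f).

Definition gatom p (ar : 'I_p -> nat) (n : nat) : finType :=
  {R : 'I_p & {ffun 'I_(ar R) -> 'I_n}}.
Definition world p (ar : 'I_p -> nat) (n : nat) : finType := {set gatom ar n}.

Definition mkatom p (ar : 'I_p -> nat) (n : nat) (R : 'I_p)
  (t : {ffun 'I_(ar R) -> 'I_n}) : gatom ar n :=
  @Tagged 'I_p R (fun R => {ffun 'I_(ar R) -> 'I_n}) t.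

Fixpoint eval p (ar : 'I_p -> nat) (n : nat) (w : world ar n)
  (env : bool -> option 'I_n) (f : fo2form ar) : bool :=
  match f with
  | FAtom R args =>
      [exists t : {ffun 'I_(ar R) -> 'I_n},
        [forall i, env (args i) == Some (t i)] && (mkatom t \in w)]
  | FEq u v =>
      match env u, env v with Some a, Some b => a == b | _, _ => false end
  | FNot g => ~~ eval w env g
  | FAnd g h => eval w env g && eval w env h
  | FEx v g =>
      [exists d : 'I_n, eval w (fun u => if u == v then Some d else env u) g]
  end.

Definition models p (ar : 'I_p -> nat) (n : nat) (w : world ar n) (f : fo2form ar)
  : bool := eval w (fun _ => None) f.

Definition Ncount p (ar : 'I_p -> nat) (n : nat) (w : world ar n) (R : 'I_p)
  : nat := #|[set a in w | tag a == R]|.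

Inductive cmp := CEq | CLe | CGe | CLt | CGt.
Definition cmp_holds (c : cmp) (a k : nat) : bool :=
  match c with
  | CEq => a == k | CLe => a <= k | CGe => a >= k
  | CLt => a < k | CGt => a > k
  end.
Definition card_ok p (ar : 'I_p -> nat) (n : nat) (w : world ar n)
  (cc : 'I_p * cmp * nat) : bool :=
  cmp_holds cc.1.2 (Ncount w cc.1.1) cc.2.

Definition pair_tup p (ar : 'I_p -> nat) (n : nat) (S : 'I_p) (x y : 'I_n)
  : {ffun 'I_(ar S) -> 'I_n} := [ffun i => if val i == 0 then x else y].
Definition functional p (ar : 'I_p -> nat) (n : nat) (w : world ar n)
  (S : 'I_p) : bool :=
  [forall x : 'I_n, #|[set y : 'I_n | mkatom (pair_tup ar S x y) \in w]| == 1].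

Definition sat_all p (ar : 'I_p -> nat) (n : nat) (Gamma : fo2form ar)
  (cards : seq ('I_p * cmp * nat)) (funs : seq 'I_p) (w : world ar n) : bool :=
  [&& models w Gamma, all (card_ok w) cards & all (functional w) funs].

Local Open Scope ring_scope.

Definition WFOMC p (ar : 'I_p -> nat) (Gamma : fo2form ar)
  (cards : seq ('I_p * cmp * nat)) (funs : seq 'I_p)
  (wt wbar : 'I_p -> rat) (n : nat) : rat :=
  \sum_(w : world ar n | sat_all Gamma cards funs w)
    \prod_(R : 'I_p)
      (wt R ^+ Ncount w R * wbar R ^+ (n ^ ar R - Ncount w R)%N).

Local Close Scope ring_scope.

Inductive sym := Blank | Zero | One | Sep.
Definition is_blank (s : sym) : bool := if s is Blank then true else false.
Inductive dir := DL | DR.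

Record TM := {
  tm_state : finType;
  tm_start : tm_state;
  tm_halt : pred tm_state;
  tm_delta : tm_state -> sym -> tm_state * sym * dir }.

(* configuration: state, left part (reversed), scanned symbol, right part *)
Definition config (M : TM) : Type := (tm_state M * seq sym * sym * seq sym)%type.

Definition step (M : TM) (c : config M) : config M :=
  let: (q, l, a, r) := c in
  if @tm_halt M q then c else
  let: (q', b, d) := @tm_delta M q a in
  match d with
  | DL => match l with
          | [::] => (q', [::], Blank, b :: r)
          | x :: l' => (q', l', x, b :: r) end
  | DR => match r with
          | [::] => (q', b :: l, Blank, [::])
          | x :: r' => (q', b :: l, x, r') end
  end.

Definition init (M : TM) (s : seq sym) : config M :=
  match s with
  | [::] => (@tm_start M, [::], Blank, [::])
  | a :: s' => (@tm_start M, [::], a, s')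
  end.

Definition output (M : TM) (c : config M) : seq sym :=
  let: (_, _, a, r) := c in
  let s := a :: r in take (find is_blank s) s.

Definition halts_with (M : TM) (t : nat) (s o : seq sym) : Prop :=
  let c := iter t (step (M := M)) (init M s) in
  @tm_halt M c.1.1.1 /\ output c = o.

(* binary, least significant bit first, no leading zeros (0 ↦ "0") *)
Definition enc_nat (m : nat) : seq sym :=
  [seq (if odd (m %/ 2 ^ i) then One else Zero) | i <- iota 0 (trunc_log 2 m).+1].
Definition enc_int (z : int) : seq sym :=
  (if (z < 0)%R then One else Zero) :: enc_nat `|z|%N.
Definition enc_rat (q : rat) : seq sym :=
  enc_int (numq q) ++ Sep :: enc_nat `|denq q|%N.

Definition enc_input p (n : nat) (wt wbar : 'I_p -> rat) : seq sym :=
  nseq n One ++ Sep ::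
  flatten [seq enc_rat (wt R) ++ Sep :: enc_rat (wbar R) ++ [:: Sep]
          | R <- enum 'I_p].

(* Main.v *)
(* A program acts on a tape of bit stacks separated by Sep (the input already
   has this shape).  A polynomial-time function f pushes the value f v on the
   stacks holding the numbers v; this class is closed under composition, while
   loops with polynomially many polynomially bounded iterates, and hence under
   binary arithmetic and sums with polynomially many terms.

   A functionality constraint on S amounts to "forall x exists y S(x,y)" together
   with |S| = n, so it suffices to know, for every vector of cardinalities, how
   many worlds satisfying a fixed FO^2 sentence realise it.  By Kronecker
   substitution these numbers are the digits of a single integer, the weighted
   count G for the weights B^(D^Q) with B a large power of two.  To compute G, the
   truth values of the quantified subformulas at each element are guessed, and
   the guesses are checked by inclusion-exclusion.  This makes every element an
   independent choice among constantly many types, with a product of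
   contributions of pairs of types; sorting the type assignments by their
   histogram leaves a sum with polynomially many terms, whose multinomial
   coefficients are again read off as digits.  The signs of inclusion-exclusion
   disappear by computing modulo an integer larger than G. *)
From HB Require Import structures.
From mathcomp Require Import all_boot all_order all_algebra.
From mathcomp Require Import zify ring.
Require Import Defs.
Set Implicit Arguments. Unset Strict Implicit. Unset Printing Implicit Defensive.

(** * Turing machine fragments *)

(** The integer $G$ depends on the sentence and the domain size only. The rational weights enter
    afterwards: the weight of each world is written over one common denominator, and worlds are
    summed separately by sign, so the machine never leaves the natural numbers. $B$ must exceed the
    number of worlds, because the digits count worlds and must not carry; $D$ must exceed every
    cardinality, so that $\sum_Q N(Q) D^Q$ determines all of them. Guessing causes no overcounting:
    a guess that agrees with its own witnesses at every element is the true one. Inclusion-exclusion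
    is needed because the existence of a witness does not factor over pairs of elements, whereas the
    absence of witnesses does. On the machine side the obstacle is growth: a number with
    polynomially many bits may have exponential value, so exponents and iteration counts have to be
    bounded in value. The domain size may serve as such a bound because it is given in unary,
    whereas types, subformulas and predicates are fixed with the sentence and are unrolled into the
    program. *)

Definition tape := (seq sym * seq sym)%type.

(** Dropping a blank pushed onto an empty half avoids trailing blanks, so tapes can be compared as
    lists and a fragment can be specified by an equation on its final tape. *)
Definition consb (b : sym) (l : seq sym) : seq sym :=
  if is_blank b && nilp l then [::] else b :: l.

Definition mv (b : sym) (d : dir) (tp : tape) : tape :=
  match d with
  | DR => (consb b tp.1, behead tp.2)
  | DL => (behead tp.1, consb (head Blank tp.1) (consb b (behead tp.2)))
  end.

(** A machine whose exits carry a value: this is how a symbol that was read decides which fragment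
    runs next. *)
Record frag (E : Type) := Frag {
  fstate : finType;
  finit : fstate;
  fdelta : fstate -> sym -> (fstate + E) * sym * dir }.

Inductive exec E (F : frag E) : fstate F -> tape -> nat -> E -> tape -> Prop :=
| exec_exit q tp e b d : fdelta q (head Blank tp.2) = (inr e, b, d) ->
    exec q tp 1 e (mv b d tp)
| exec_next q tp q' b d t e tp' : fdelta q (head Blank tp.2) = (inl q', b, d) ->
    exec q' (mv b d tp) t e tp' -> exec q tp t.+1 e tp'.

Definition runs E (F : frag E) (tp : tape) (t : nat) (e : E) (tp' : tape) : Prop :=
  exists2 t', t' <= t & exec (finit F) tp t' e tp'.

Lemma runs_leq E (F : frag E) tp t t2 e tp' :
  runs F tp t e tp' -> t <= t2 -> runs F tp t2 e tp'.
Proof. by move=> [t' le1 H] le2; exists t' => //; apply: leq_trans le1 le2. Qed.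

Definition act E (f : sym -> E * sym * dir) : frag E :=
  @Frag E unit tt (fun _ a => let: (e, b, d) := f a in (inr e, b, d)).

Lemma runs_act E (f : sym -> E * sym * dir) tp :
  runs (act f) tp 1 (f (head Blank tp.2)).1.1
    (mv (f (head Blank tp.2)).1.2 (f (head Blank tp.2)).2 tp).
Proof.
exists 1 => //; apply: exec_exit => /=.
by case: (f _) => -[].
Qed.

(** The exit transition of [F] enters the initial state of [G a] directly, so running times simply
    add up. [A] is finite because the states of all [G a] become states of one machine. *)
Definition bind (A : finType) B (F : frag A) (G : A -> frag B) : frag B :=
  @Frag B (fstate F + {a : A & fstate (G a)})%type (inl (finit F))
    (fun q s => match q with
     | inl q1 => let: (r, b, d) := fdelta q1 s in
         (match r with
          | inl q' => inl (inl q')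
          | inr a => inl (inr (Tagged (fun a => fstate (G a)) (finit (G a))))
          end, b, d)
     | inr u => let: (r, b, d) := fdelta (tagged u) s in
         (match r with
          | inl q' => inl (inr (Tagged (fun a => fstate (G a)) q'))
          | inr e => inr e
          end, b, d)
     end).

Lemma runs_bind (A : finType) B (F : frag A) (G : A -> frag B) tp t a tp1 t' b tp2 :
  runs F tp t a tp1 -> runs (G a) tp1 t' b tp2 ->
  runs (bind F G) tp (t + t') b tp2.
Proof.
move=> [t1 le1 H1] [t2 le2 H2]; exists (t1 + t2); first exact: leq_add.
have HG q tpa u e tpb : @exec _ (G a) q tpa u e tpb ->
    @exec _ (bind F G) (inr (Tagged (fun a => fstate (G a)) q)) tpa u e tpb.
  elim=> {}q {}tpa.
  - by move=> {}e c d E; apply: exec_exit; rewrite /= E.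
  - by move=> q' c d {}u {}e {}tpb E _ IH; apply: exec_next IH; rewrite /= E.
rewrite /=; move: H2; elim: H1 HG => q {}tp.
- by move=> e c d E HG H2; apply: exec_next (HG _ _ _ _ _ H2); rewrite /= E.
- move=> q' c d {le1}t1 e tp' E _ IH HG H2.
  by apply: exec_next (IH HG H2); rewrite /= E.
Qed.

Definition floop B (F : frag (option B)) : frag B :=
  @Frag B (fstate F) (finit F)
    (fun q s => let: (r, b, d) := fdelta q s in
       (match r with
        | inl q' => inl q'
        | inr None => inl (finit F)
        | inr (Some e) => inr e
        end, b, d)).

Lemma runs_loop_exit B (F : frag (option B)) tp t b tp' :
  runs F tp t (Some b) tp' -> runs (floop F) tp t b tp'.
Proof.
move=> [t1 le1 H1]; exists t1 => //=.
move eqe: (Some b) H1 => e H1; elim: H1 eqe => q {}tp.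
- by move=> {}e c d E eqe; apply: exec_exit; rewrite /= E -eqe.
- move=> q' c d {le1}t1 {}e {}tp' E _ IH eqe.
  by apply: exec_next (IH eqe); rewrite /= E.
Qed.

Lemma runs_loop_next B (F : frag (option B)) tp t tp1 t' b tp2 :
  runs F tp t None tp1 -> runs (floop F) tp1 t' b tp2 ->
  runs (floop F) tp (t + t') b tp2.
Proof.
move=> [t1 le1 H1] [t2 le2 H2]; exists (t1 + t2); first exact: leq_add.
rewrite /=; move: H2; move eqe: None H1 => e H1; elim: H1 eqe => q {}tp.
- by move=> {}e c d E eqe H2; apply: exec_next H2; rewrite /= E -eqe.
- move=> q' c d {le1}t1 {}e tp' E _ IH eqe H2.
  by apply: exec_next (IH eqe H2); rewrite /= E.
Qed.

Lemma size_consb b l : size (consb b l) <= (size l).+1.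
Proof. by rewrite /consb; case: ifP. Qed.

(** One step adds at most two cells, the worst case being a left move at the left end. Output sizes
    are thus bounded by running times, which composing polynomial-time programs requires. *)
Lemma exec_size E (F : frag E) q tp t e tp' :
  @exec _ F q tp t e tp' -> size tp'.1 + size tp'.2 <= size tp.1 + size tp.2 + t.*2.
Proof.
have mvs b d (tq : tape) :
    size (mv b d tq).1 + size (mv b d tq).2 <= size tq.1 + size tq.2 + 2.
  case: d; case: tq => l r /=; last by have := size_consb b l; case: r => //=; lia.
  have := size_consb (head Blank l) (consb b (behead r)).
  by have := size_consb b (behead r); rewrite !size_behead; lia.
elim=> {}q {}tp.
- by move=> {}e b d _; have := mvs b d tp; lia.
- by move=> q' b d {}t {}e {}tp' _ _; have := mvs b d tp; lia.
Qed.

Lemma runs_size E (F : frag E) tp t e tp' : runs F tp t e tp' ->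
  size tp'.1 + size tp'.2 <= size tp.1 + size tp.2 + t.*2.
Proof. by case=> t' le H; have := exec_size H; lia. Qed.

(** * Simulation of fragments by Turing machines *)

Definition tm_of (F : frag unit) : TM :=
  @Build_TM (option (fstate F)) (Some (finit F)) (fun q => q == None)
    (fun q s => match q with
     | None => (None, s, DR)
     | Some q => let: (r, b, d) := fdelta q s in
         (match r with inl q' => Some q' | inr _ => None end, b, d)
     end).

(** The machine model keeps the blanks that [consb] drops, so the simulation holds only up to
    trailing blanks; the output, read up to the first blank, does not notice them. *)
Definition eqb_tape (x y : seq sym) := nth Blank x =1 nth Blank y.

Lemma nth_consb b l : nth Blank (consb b l) =1 nth Blank (b :: l).
Proof. by rewrite /consb; case: ifP => // /andP[]; case: b => // _; case: l => // _ [|[]]. Qed.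

Lemma nth_consb2 a b l : nth Blank (consb a (consb b l)) =1 nth Blank [:: a, b & l].
Proof. by case=> [|i]; rewrite nth_consb //= nth_consb. Qed.

Lemma step_mv (F : frag unit) q l a r tp q' b d :
  eqb_tape l tp.1 -> eqb_tape (a :: r) tp.2 ->
  @tm_delta (tm_of F) (Some q) a = (q', b, d) ->
  exists l' a' r', [/\ step (M := tm_of F) (Some q, l, a, r) = (q', l', a', r'),
    eqb_tape l' (mv b d tp).1 & eqb_tape (a' :: r') (mv b d tp).2].
Proof.
case: tp => tl tr /= el er E; rewrite /step E.
have er' i : nth Blank r i = nth Blank (behead tr) i by rewrite nth_behead -(er i.+1).
have el' i : nth Blank (behead l) i = nth Blank (behead tl) i by rewrite !nth_behead el.
case: d E => E.
- exists (behead l), (head Blank l), (b :: r); split => //=; first by case: (l).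
  by move=> i; rewrite nth_consb2; case: i => [|[|i]] //=; rewrite -nth0 el nth0.
- exists (b :: l), (head Blank r), (behead r); split => //=; first by case: (r).
    by case=> [|i]; rewrite nth_consb //= el.
  case=> [|i] /=; first by rewrite -nth0 er' nth0 -nth0.
  by rewrite nth_behead er'.
Qed.

Lemma exec_tm (F : frag unit) q tp t e tp' l a r :
  @exec _ F q tp t e tp' -> eqb_tape l tp.1 -> eqb_tape (a :: r) tp.2 ->
  exists l' a' r',
    iter t (step (M := tm_of F)) (Some q, l, a, r) = (None, l', a', r') /\
    eqb_tape (a' :: r') tp'.2.
Proof.
move=> H; elim: H l a r => {}q {}tp.
- move=> {}e b d E l a r el er.
  have Ea : a = head Blank tp.2 by rewrite -nth0 -er.
  have [|l' [a' [r' [H1 H2 H3]]]] := @step_mv F q l a r tp None b d el er.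
    by rewrite /= Ea E.
  by exists l', a', r'; split.
- move=> q' b d {}t {}e {}tp' E _ IH l a r el er.
  have Ea : a = head Blank tp.2 by rewrite -nth0 -er.
  have [|l' [a' [r' [H1 H2 H3]]]] := @step_mv F q l a r tp (Some q') b d el er.
    by rewrite /= Ea E.
  by rewrite iterSr H1; apply: IH.
Qed.

Lemma eqb_out s1 s2 : eqb_tape s1 s2 ->
  take (find is_blank s1) s1 = take (find is_blank s2) s2.
Proof.
elim: s1 s2 => [|a s1 IH] [|b s2] //= H.
- by have /= <- := H 0.
- by have /= -> := H 0.
- have /= <- := H 0; case: ifP => //= _; congr cons.
  by apply: IH => i; apply: (H i.+1).
Qed.

Lemma runs_halts (F : frag unit) (s : seq sym) t tp' : 
  runs F ([::], s) t tt tp' ->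
  exists2 t', t' <= t & halts_with (tm_of F) t' s
                    (take (find is_blank tp'.2) tp'.2).
Proof.
case=> t' le H; exists t' => //; rewrite /halts_with.
pose ar := if s is a :: r then (a, r) else (Blank, [::]).
have Ei : init (tm_of F) s = (Some (finit F), [::], ar.1, ar.2) by rewrite /ar; case: (s).
have H2 : eqb_tape (ar.1 :: ar.2) s by rewrite /ar; case: (s) => // -[|[]].
have [l' [a' [r' [E1 E2]]]] := exec_tm H (fun=> erefl) H2.
rewrite Ei E1 /=; split; first exact: eqxx.
by rewrite -(eqb_out E2).
Qed.

(** * Tapes holding stacks of bits *)

(** Symbols serve as the states of the shifting fragments below, so they must form a finite type. *)
Definition sym_code (a : sym) : option (option bool) :=
  match a with
  | Blank => None | Sep => Some None
  | Zero => Some (Some false) | One => Some (Some true)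
  end.
Definition sym_decode (o : option (option bool)) : sym :=
  match o with
  | None => Blank | Some None => Sep
  | Some (Some b) => if b then One else Zero
  end.
Lemma sym_codeK : cancel sym_code sym_decode. Proof. by case. Qed.
HB.instance Definition _ := Equality.copy sym (can_type sym_codeK).
HB.instance Definition _ := Choice.copy sym (can_type sym_codeK).
HB.instance Definition _ := Countable.copy sym (can_type sym_codeK).
HB.instance Definition _ := Finite.copy sym (can_type sym_codeK).

Definition sbit (b : bool) : sym := if b then One else Zero.
Definition obit (a : sym) : option bool :=
  match a with One => Some true | Zero => Some false | _ => None end.
Definition enc (m : seq (seq bool)) : seq sym :=
  flatten [seq rcons (map sbit s) Sep | s <- m].
Arguments enc : simpl never.
Definition stacks (m : seq (seq bool)) : tape := ([::], enc m).

Definition nonblank (a : sym) := ~~ is_blank a.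

Lemma enc_cons s m : enc (s :: m) = map sbit s ++ Sep :: enc m.
Proof. by rewrite /enc /= cat_rcons. Qed.

Lemma enc_cat m1 m2 : enc (m1 ++ m2) = enc m1 ++ enc m2.
Proof. by rewrite /enc map_cat flatten_cat. Qed.

Lemma nonblank_bits s : all nonblank (map sbit s).
Proof. by elim: s => //= -[]. Qed.

Lemma nonblank_enc m : all nonblank (enc m).
Proof. by elim: m => //= s m IH; rewrite enc_cons all_cat nonblank_bits. Qed.

Lemma consb_nb a l : nonblank a -> consb a l = a :: l.
Proof. by rewrite /consb; case: a. Qed.

(** Fails only for [[:: Blank]]: otherwise rewriting the scanned symbol and moving left restores the
    same list. *)
Definition canonical (r : seq sym) := consb (head Blank r) (behead r) = r.

Lemma canonical_nb r : all nonblank r -> canonical r.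
Proof. by case: r => [|a r] //= /andP[nba _]; rewrite /canonical consb_nb. Qed.

Definition home_step E (e : E) (a : sym) : option E * sym * dir :=
  if is_blank a then (Some e, a, DR) else (None, a, DL).

(** The first move is unconditional because the head may stand on the blank behind the last stack;
    the loop then stops at the blank in front of the first one. *)
Definition home E (e : E) : frag E :=
  bind (act (fun a => (tt, a, DL))) (fun _ => floop (act (home_step e))).

Lemma runs_home E (e : E) l r : all nonblank l -> canonical r ->
  runs (home e) (l, r) ((size l).+3) e ([::], catrev l r).
Proof.
move=> nbl cr.
have step0 w : runs (floop (act (home_step e))) ([::], Blank :: w) 1 e ([::], w).
  exact: (runs_loop_exit (runs_act (home_step e) ([::], Blank :: w))).
have step1 l' x w : nonblank x -> runs (act (home_step e)) (l', x :: w) 1 None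
    (behead l', consb (head Blank l') (x :: w)).
  move=> nbx; have := runs_act (home_step e) (l', x :: w).
  by rewrite /home_step /= (negbTE nbx) /= (consb_nb _ nbx).
have loop l' x w : all nonblank l' -> nonblank x ->
    runs (floop (act (home_step e))) (l', x :: w) (1 + (size l').+1) e
      ([::], catrev l' (x :: w)).
  elim: l' x w => [|y l' IH] x w nbl' nbx.
    exact: (runs_loop_next (step1 [::] x w nbx) (step0 (x::w))).
  case/andP: nbl' => nby nbl'; apply: runs_loop_next (step1 _ _ _ nbx) _.
  by rewrite /= (consb_nb _ nby); apply: IH.
have first := runs_act (fun a => (tt, a, DL)) (l, r).
rewrite /= cr in first.
apply: runs_leq (_ : 1 + (size l).+2 <= _) => //; apply: runs_bind first _.
case: l nbl => [|y l] /=.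
  move=> _; apply: (@runs_leq _ _ _ 1) => //; case: (r) => [|x w]; last exact: step0.
  exact: (runs_loop_exit (runs_act (home_step e) ([::], [::]))).
case/andP => nby nbl; rewrite (consb_nb _ nby).
by apply: runs_leq (loop _ _ _ nbl nby) _; lia.
Qed.

Definition skip_step (a : sym) : option unit * sym * dir :=
  (if a is Sep then Some tt else None, a, DR).

Definition skip_stack : frag unit := floop (act skip_step).

Lemma runs_skip l s w :
  runs skip_stack (l, map sbit s ++ Sep :: w) (size s).+1 tt
    (catrev (rcons (map sbit s) Sep) l, w).
Proof.
elim: s l => [|b s IH] l.
  exact: (runs_loop_exit (runs_act skip_step (l, Sep :: w))).
apply: runs_leq (_ : 1 + (size s).+1 <= _) => //; apply: runs_loop_next (IH _).
have := runs_act skip_step (l, sbit b :: map sbit s ++ Sep :: w).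
by rewrite /skip_step /= consb_nb; case: b.
Qed.

Fixpoint at_stack E (i : nat) (F : frag E) : frag E :=
  if i is i'.+1 then bind skip_stack (fun _ => at_stack i' F) else F.

Lemma runs_at E (F : frag E) m1 l w t e tp' :
  runs F (catrev (enc m1) l, w) t e tp' ->
  runs (at_stack (size m1) F) (l, enc m1 ++ w) (size (enc m1) + t) e tp'.
Proof.
elim: m1 l => [|s m1 IH] l //= H.
rewrite enc_cons -catA cat_cons.
apply: runs_leq (_ : (size s).+1 + (size (enc m1) + t) <= _); last first.
  by rewrite size_cat /= size_map; lia.
apply: runs_bind (runs_skip _ _ _) (IH _ _).
by rewrite enc_cons -cat_rcons catrev_catl in H.
Qed.

Definition peek (i : nat) : frag (option bool) :=
  bind (at_stack i (act (fun a => (obit a, a, DR)))) (fun o => home o).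

Lemma catrev_catrev T (u w : seq T) : catrev (catrev u [::]) w = u ++ w.
Proof. by rewrite !catrevE cats0 revK. Qed.

Lemma size_catrev T (u l : seq T) : size (catrev u l) = size u + size l.
Proof. by rewrite catrevE size_cat size_rev. Qed.

Lemma all_catrev (u l : seq sym) : all nonblank u -> all nonblank l ->
  all nonblank (catrev u l).
Proof. by move=> nbu nbl; rewrite catrevE all_cat all_rev nbu. Qed.

Lemma enc_head s m : exists a w,
  [/\ enc (s :: m) = a :: w, nonblank a, all nonblank w & obit a = ohead s].
Proof.
have := nonblank_enc (s :: m); rewrite enc_cons.
by case: s => [|b s] /=; [move=> nb2|case/andP=> nb1 nb2]; do 2!eexists; split=> //; case: (b).
Qed.

(** Reading, inserting and deleting a bit all get the same bound, linear in the tape size, which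
    keeps the later estimates uniform. *)
Lemma runs_peek m1 s m2 T : size (enc (m1 ++ s :: m2)) <= T ->
  runs (peek (size m1)) (stacks (m1 ++ s :: m2)) (4 * T + 20)
    (ohead s) (stacks (m1 ++ s :: m2)).
Proof.
rewrite /stacks enc_cat; have [a [w [-> nba nbw <-]]] := enc_head s m2.
rewrite size_cat /= => leT.
apply: runs_leq (_ : size (enc m1) + 1 + (size (enc m1) + 1).+3 <= _); last lia.
rewrite /peek; apply: (@runs_bind _ _ _ _ _ _ (obit a)).
  by apply: runs_at; apply: (runs_act (fun a => (obit a, a, DR))).
have nbl : all nonblank (a :: catrev (enc m1) [::]).
  by rewrite /= nba all_catrev ?nonblank_enc.
rewrite /= (consb_nb _ nba); have := runs_home (obit a) nbl (canonical_nb nbw).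
by rewrite /= catrev_catrev size_catrev /= addn0 addn1.
Qed.

(** The state holds the symbol displaced from the previous cell, so everything behind the insertion
    point moves one cell to the right. *)
Definition insert_bit (b : bool) : frag unit :=
  @Frag unit sym (sbit b) (fun c a => (if is_blank a then inr tt else inl a, c, DR)).

Definition ins E (i : nat) (b : bool) (e : E) : frag E :=
  bind (at_stack i (insert_bit b)) (fun _ => home e).

Lemma runs_insert b l w : all nonblank w ->
  runs (insert_bit b) (l, w) (size w).+1 tt (catrev (sbit b :: w) l, [::]).
Proof.
move=> nbw; exists (size w).+1 => //.
have gen c : nonblank c ->
    @exec _ (insert_bit b) c (l, w) (size w).+1 tt (catrev (c :: w) l, [::]).
  elim: w l c nbw => [|a w IH] l c; rewrite [catrev _ _]/=.
    by move=> _ nbc; rewrite -(consb_nb l nbc); apply: (exec_exit (d := DR)).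
  case/andP=> nba nbw nbc.
  apply: (@exec_next _ (insert_bit b) c _ a c DR); first by rewrite /= (negbTE nba).
  by have := IH (c :: l) a nbw nba; rewrite /= consb_nb.
by apply: gen; case: b.
Qed.

Lemma runs_ins E (e : E) b m1 s m2 T : size (enc (m1 ++ s :: m2)) <= T ->
  runs (ins (size m1) b e) (stacks (m1 ++ s :: m2)) (4 * T + 20)
    e (stacks (m1 ++ (b :: s) :: m2)).
Proof.
rewrite /stacks !enc_cat size_cat => leT; set w := enc (s :: m2).
have -> : enc ((b :: s) :: m2) = sbit b :: w by rewrite /w !enc_cons.
have nbw : all nonblank w by apply: nonblank_enc.
have nbl : all nonblank (catrev (sbit b :: w) (catrev (enc m1) [::])).
  by rewrite !all_catrev ?nonblank_enc //=; case: (b).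
apply: runs_leq (_ : size (enc m1) + (size w).+1 +
   (size (catrev (sbit b :: w) (catrev (enc m1) [::]))).+3 <= _); last first.
  by rewrite !size_catrev /=; move: leT; rewrite -/w; lia.
apply: (@runs_bind _ _ _ _ _ _ tt); first by apply: runs_at; apply: runs_insert.
have := runs_home e nbl (erefl : canonical [::]).
suff -> : catrev (catrev (sbit b :: w) (catrev (enc m1) [::])) [::] =
   enc m1 ++ sbit b :: w by [].
by rewrite !catrevE rev_cons !cats0 -cats1 !rev_cat !revK.
Qed.

Definition shift_stack (c : sym) : frag unit :=
  @Frag unit sym c (fun c a => (if a is Sep then inr tt else inl a, c, DR)).

Fixpoint shift_right (c : sym) (i : nat) : frag unit :=
  if i is i'.+1 then bind (shift_stack c) (fun _ => shift_right Sep i')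
  else act (fun _ => (tt, c, DR)).

(* Deletion writes a blank at the left end of the tape and shifts everything
   before the deleted symbol one cell to the right. *)
Definition del E (i : nat) (e : E) : frag E :=
  bind (shift_right Blank i) (fun _ => home e).

Lemma runs_shift_stack c l s w :
  runs (shift_stack c) (l, map sbit s ++ Sep :: w) (size s).+1 tt
    (catrev (map sbit s) (consb c l), w).
Proof.
exists (size s).+1 => //; rewrite [finit _]/=.
move: {1}c => c0; elim: s c l => [|b s IH] c l /=.
  by apply: (exec_exit (d := DR)).
apply: (@exec_next _ (shift_stack c0) c _ (sbit b) c DR); first by case: b.
by have := IH (sbit b) (consb c l); rewrite [consb (sbit b) _]consb_nb //; case: (b).
Qed.

Lemma runs_shift_right c l m1 x w :
  runs (shift_right c (size m1)) (l, enc m1 ++ x :: w) (size (enc m1)).+1 tt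
    (catrev (enc m1) (consb c l), w).
Proof.
elim: m1 c l => [|s m1 IH] c l /=.
  by apply: (runs_act (fun _ => (tt, c, DR)) (l, x :: w)).
rewrite enc_cons -catA cat_cons.
apply: runs_leq (_ : (size s).+1 + (size (enc m1)).+1 <= _); last first.
  by rewrite size_cat /= size_map; lia.
rewrite catrev_catl /=; apply: runs_bind (runs_shift_stack _ _ _ _) _.
exact: IH.
Qed.

Lemma runs_del_gen E (e : E) m1 x w T : size (enc m1) < T -> all nonblank w ->
  runs (del (size m1) e) ([::], enc m1 ++ x :: w) (4 * T + 20) e ([::], enc m1 ++ w).
Proof.
move=> leT nbw.
have nbl : all nonblank (catrev (enc m1) [::]) by rewrite all_catrev ?nonblank_enc.
apply: runs_leq (_ : (size (enc m1)).+1 + (size (catrev (enc m1) [::])).+3 <= _); last first.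
  by rewrite size_catrev /=; lia.
apply: runs_bind (runs_shift_right _ _ _ _ _) _.
by have := runs_home e nbl (canonical_nb nbw); rewrite catrev_catrev.
Qed.

Lemma runs_del E (e : E) b m1 s m2 T : size (enc (m1 ++ (b :: s) :: m2)) <= T ->
  runs (del (size m1) e) (stacks (m1 ++ (b :: s) :: m2)) (4 * T + 20)
    e (stacks (m1 ++ s :: m2)).
Proof.
rewrite /stacks !enc_cat enc_cons size_cat /= => leT.
rewrite -[map sbit s ++ _]enc_cons.
by apply: runs_del_gen; rewrite ?nonblank_enc //; lia.
Qed.

Lemma runs_del_nil E (e : E) m1 m2 T : size (enc (m1 ++ [::] :: m2)) <= T ->
  runs (del (size m1) e) (stacks (m1 ++ [::] :: m2)) (4 * T + 20) e (stacks (m1 ++ m2)).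
Proof.
rewrite /stacks !enc_cat enc_cons size_cat /= => leT.
by apply: runs_del_gen; rewrite ?nonblank_enc //; lia.
Qed.

(** The tape is unbounded to the left, so a new empty stack is just a separator written in front of
    the others. *)
Definition new_stack : frag unit :=
  bind (act (fun a => (tt, a, DL))) (fun _ =>
  bind (act (fun _ => (tt, Sep, DL))) (fun _ => act (fun _ => (tt, Blank, DR)))).

Lemma runs_new m : runs new_stack (stacks m) 3 tt (stacks ([::] :: m)).
Proof.
apply: (@runs_bind _ _ _ _ _ 1 tt ([::], consb Blank (enc m)) 2).
  have := runs_act (fun a => (tt, a, DL)) (stacks m).
  by rewrite /= (canonical_nb (nonblank_enc m)).
apply: (@runs_bind _ _ _ _ _ 1 tt ([::], Blank :: Sep :: enc m) 1).
  have := runs_act (fun a => (tt, Sep, DL)) ([::], consb Blank (enc m)).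
  by case: (enc m).
exact: (runs_act (fun a => (tt, Blank, DR)) ([::], Blank :: Sep :: enc m)).
Qed.

(** An exit always costs a step and a move, hence even doing nothing has to return home. *)
Definition nop E (e : E) : frag E :=
  bind (act (fun a => (tt, a, DR))) (fun _ => home e).

Lemma runs_nop E (e : E) m : runs (nop e) (stacks m) 5 e (stacks m).
Proof.
case: m => [|s m].
  apply: (@runs_bind _ _ _ _ _ 1 tt ([::], [::]) 4).
    exact: (runs_act (fun a => (tt, a, DR)) ([::], [::])).
  by apply: (runs_leq (runs_home e (isT : all nonblank [::]) (erefl : canonical [::]))).
rewrite /stacks; have [a [w [-> nba nbw _]]] := enc_head s m.
apply: (@runs_bind _ _ _ _ _ 1 tt ([:: a], w) 4).
  by have := runs_act (fun a => (tt, a, DR)) ([::], a :: w); rewrite /= consb_nb.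
have nbl : all nonblank [:: a] by rewrite /= nba.
exact: (runs_home e nbl (canonical_nb nbw)).
Qed.

Lemma size_enc_cons s m : size (enc (s :: m)) = size s + (size (enc m)).+1.
Proof. by rewrite enc_cons size_cat size_map. Qed.

Lemma size_enc_cat m1 m2 : size (enc (m1 ++ m2)) = size (enc m1) + size (enc m2).
Proof. by rewrite enc_cat size_cat. Qed.

Definition size_enc := (size_enc_cons, size_enc_cat).

Definition drop_stack (i : nat) : frag unit :=
  floop (bind (peek i) (fun o => if o is Some _ then del i None else del i (Some tt))).

Lemma runs_drop m1 s m2 T : size (enc (m1 ++ s :: m2)) <= T ->
  runs (drop_stack (size m1)) (stacks (m1 ++ s :: m2)) ((size s).+1 * (8 * T + 40))
    tt (stacks (m1 ++ m2)).
Proof.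
elim: s => [|b s IH] leT.
  rewrite mul1n; apply: runs_loop_exit.
  apply: runs_leq (_ : (4 * T + 20) + (4 * T + 20) <= _); last lia.
  by apply: runs_bind (runs_peek leT) _; apply: runs_del_nil.
rewrite mulSn; apply: (@runs_loop_next _ _ _ _ (stacks (m1 ++ s :: m2))).
  apply: runs_leq (_ : (4 * T + 20) + (4 * T + 20) <= _); last lia.
  by apply: runs_bind (runs_peek leT) _; apply: (@runs_del _ _ b).
by apply: IH; move: leT; rewrite !size_enc /=; lia.
Qed.

(** The least significant bit is on top, so a zero pushed onto an empty stack would be a leading
    zero. *)
Definition cons_bit (b : bool) (s : seq bool) : seq bool :=
  if ~~ b && nilp s then [::] else b :: s.

Lemma size_cons_bit b s : size (cons_bit b s) <= (size s).+1.
Proof. by rewrite /cons_bit; case: ifP. Qed.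

Definition cins E (i : nat) (b : bool) (e : E) : frag E :=
  if b then ins i b e
  else bind (peek i) (fun o => if o is Some _ then ins i b e else nop e).

Lemma runs_cins E (e : E) b m1 s m2 T : size (enc (m1 ++ s :: m2)) <= T ->
  runs (cins (size m1) b e) (stacks (m1 ++ s :: m2)) (8 * T + 40)
    e (stacks (m1 ++ cons_bit b s :: m2)).
Proof.
move=> leT; rewrite /cins /cons_bit; case: b => /=.
  by apply: runs_leq (runs_ins _ _ leT) _; lia.
apply: runs_leq (_ : (4 * T + 20) + (4 * T + 20) <= _); last lia.
apply: runs_bind (runs_peek leT) _; case: s leT => [|b s] leT /=.
  by apply: runs_leq (runs_nop _ _) _; lia.
exact: (runs_ins e false leT).
Qed.

(* The scratch stack 0 receives the source reversed, so that popping it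
   rebuilds both the source and its copy. *)
Definition copy_stack (i : nat) : frag unit :=
  bind new_stack (fun _ => bind new_stack (fun _ =>
  bind (floop (bind (peek i.+2) (fun o =>
    if o is Some b then bind (del i.+2 tt) (fun _ => ins 0 b None) else nop (Some tt))))
  (fun _ => bind (floop (bind (peek 0) (fun o =>
    if o is Some b then bind (del 0 tt) (fun _ =>
      bind (ins i.+2 b tt) (fun _ => cins 1 b None)) else nop (Some tt))))
  (fun _ => del 0 tt)))).

(** The source is rebuilt bit by bit but the copy is built with [cins], so copying also strips
    leading zeros; this is how the input is normalised later. *)
Lemma runs_copy m1 s m2 T : size (enc (m1 ++ s :: m2)) <= T ->
  runs (copy_stack (size m1)) (stacks (m1 ++ s :: m2)) ((T + 10) * (100 * T + 1000))
    tt (stacks (foldr cons_bit [::] s :: m1 ++ s :: m2)).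
Proof.
move=> leT; have les : size s <= T.
  by move: leT; rewrite !size_enc /=; lia.
(* Cost of one bit operation: the scratch stack and the copy together at most double the tape, up to
   a constant. *)
pose U := 4 * (2 * T + 5) + 20.
have L1 s1 s2 : size s1 + size s2 = size s ->
  runs (floop (bind (peek (size m1).+2) (fun o =>
    if o is Some b then bind (del (size m1).+2 tt) (fun _ => ins 0 b None) else nop (Some tt))))
    (stacks [:: s1, [::] & m1 ++ s2 :: m2]) ((size s2).+1 * (3 * U)) tt
    (stacks [:: catrev s2 s1, [::] & m1 ++ [::] :: m2]).
  elim: s2 s1 => [|b s2 IH] s1 sz.
    rewrite mul1n; apply: runs_loop_exit.
    apply: runs_leq (_ : U + 5 <= _); last lia.
    apply: (@runs_bind _ _ _ _ _ U None _ 5); last exact: runs_nop.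
    apply: (@runs_peek (s1 :: [::] :: m1) [::] m2).
    by rewrite ?cat_cons ?cat0s !size_enc; move: leT sz; rewrite !size_enc /=; lia.
  rewrite mulSn /=; apply: (@runs_loop_next _ _ _ _ (stacks [:: b :: s1, [::] & m1 ++ s2 :: m2])).
    apply: runs_leq (_ : U + (U + U) <= _); last lia.
    apply: (@runs_bind _ _ _ _ _ _ (Some b) (stacks [:: s1, [::] & m1 ++ (b :: s2) :: m2])).
      apply: (@runs_peek (s1 :: [::] :: m1) (b :: s2) m2).
      by rewrite ?cat_cons ?cat0s !size_enc; move: leT sz; rewrite !size_enc /=; lia.
    apply: (@runs_bind _ _ _ _ _ _ tt (stacks [:: s1, [::] & m1 ++ s2 :: m2])).
      apply: (@runs_del _ tt b (s1 :: [::] :: m1) s2 m2).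
      by rewrite ?cat_cons ?cat0s !size_enc; move: leT sz; rewrite !size_enc /=; lia.
    apply: (@runs_ins _ None b [::] s1).
    by rewrite ?cat_cons ?cat0s !size_enc; move: leT sz; rewrite !size_enc /=; lia.
  by apply: IH; move: sz; rewrite /=; lia.
have L2 s1 s2 o : size s1 + size s2 = size s -> size o <= size s2 ->
  runs (floop (bind (peek 0) (fun o =>
    if o is Some b then bind (del 0 tt) (fun _ =>
      bind (ins (size m1).+2 b tt) (fun _ => cins 1 b None)) else nop (Some tt))))
    (stacks [:: s1, o & m1 ++ s2 :: m2]) ((size s1).+1 * (5 * U)) tt
    (stacks [:: [::], foldr cons_bit o (rev s1) & m1 ++ (catrev s1 s2) :: m2]).
  elim: s1 s2 o => [|b s1 IH] s2 o sz szo.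
    rewrite mul1n; apply: runs_loop_exit.
    apply: runs_leq (_ : U + 5 <= _); last lia.
    apply: (@runs_bind _ _ _ _ _ U None _ 5); last exact: runs_nop.
    apply: (@runs_peek [::] [::]).
    by rewrite ?cat_cons ?cat0s !size_enc; move: leT sz; rewrite !size_enc /=; lia.
  rewrite mulSn /=; apply: (@runs_loop_next _ _ _ _ (stacks [:: s1, cons_bit b o & m1 ++ (b :: s2) :: m2])).
    apply: runs_leq (_ : U + (U + (U + 2 * U)) <= _); last lia.
    apply: (@runs_bind _ _ _ _ _ _ (Some b) (stacks [:: (b :: s1), o & m1 ++ s2 :: m2])).
      apply: (@runs_peek [::] (b :: s1) (o :: m1 ++ s2 :: m2) (2 * T + 5)).
      by rewrite ?cat_cons ?cat0s !size_enc; move: leT sz; rewrite !size_enc /=; lia.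
    apply: (@runs_bind _ _ _ _ _ _ tt (stacks [:: s1, o & m1 ++ s2 :: m2])).
      apply: (@runs_del _ tt b [::] s1 (o :: m1 ++ s2 :: m2)).
      by rewrite ?cat_cons ?cat0s !size_enc; move: leT sz; rewrite !size_enc /=; lia.
    apply: (@runs_bind _ _ _ _ _ _ tt (stacks [:: s1, o & m1 ++ (b :: s2) :: m2])).
      apply: (@runs_ins _ tt b (s1 :: o :: m1) s2 m2).
      by rewrite ?cat_cons ?cat0s !size_enc; move: leT sz; rewrite !size_enc /=; lia.
    apply: runs_leq (_ : 8 * (2 * T + 5) + 40 <= _); last lia.
    apply: (@runs_cins _ None b [:: s1] o (m1 ++ (b :: s2) :: m2)).
    by rewrite ?cat_cons ?cat0s !size_enc; move: leT sz; rewrite !size_enc /=; lia.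
  rewrite rev_cons -cats1 foldr_cat /=.
  apply: IH; first by move: sz; rewrite /=; lia.
  by have := size_cons_bit b o; rewrite /=; lia.
rewrite /copy_stack.
apply: runs_leq (_ : 3 + (3 + ((size s).+1 * (3 * U) + ((size s).+1 * (5 * U) + U))) <= _); last first.
  have h : (size s).+1 * U <= T.+1 * U by rewrite leq_mul2r ltnS les orbT.
  by move: h; rewrite /U; nia.
apply: runs_bind (runs_new _) _; apply: runs_bind (runs_new _) _.
apply: runs_bind (L1 [::] s (erefl _)) _.
have sz : size (catrev s [::]) + size (Nil bool) = size s.
  by rewrite size_catrev /= !addn0.
have {}L2 := L2 (catrev s [::]) [::] [::] sz erefl.
rewrite size_catrev /= addn0 catrev_catrev cats0 in L2.
apply: runs_bind L2 _.
rewrite catrevE cats0 revK.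
apply: (@runs_del_nil _ tt [::]).
rewrite /= !size_enc /=; move: leT; rewrite !size_enc /=.
have : size (foldr cons_bit [::] s) <= size s.
  elim: (s) => //= b s' IH; apply: leq_trans (size_cons_bit _ _) _; lia.
lia.
Qed.

(** * Polynomial-time functions on memories of natural numbers *)

(** Unlike in the input encoding, zero is the empty stack, so that a single peek tests for zero and
    otherwise yields the parity. *)
Definition bits (n : nat) : seq bool :=
  if n == 0 then [::]
  else [seq odd (n %/ 2 ^ i) | i <- iota 0 (trunc_log 2 n).+1].

Definition bits_val (s : seq bool) : nat := foldr (fun (b : bool) n => b + n.*2) 0 s.

Lemma bits_half n : 0 < n -> bits n = odd n :: bits n./2.
Proof.
case: n => // -[|n] _; first by [].
rewrite /bits (@trunc_log2S n.+2) //; move: (trunc_log 2 _) => t.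
rewrite -[RHS]/(odd n.+2 :: [seq odd (n.+2./2 %/ 2 ^ i) | i <- iota 0 t.+1]).
rewrite -[LHS]/(odd (n.+2 %/ 1) :: [seq odd (n.+2 %/ 2 ^ i) | i <- iota (1 + 0) t.+1]).
rewrite divn1 iotaDl -map_comp; congr cons; apply: eq_map => i.
by rewrite [LHS]/= add1n expnS divnMA divn2.
Qed.

Lemma bits_cons (b : bool) n : bits (b + n.*2) = cons_bit b (bits n).
Proof.
have [->|n0] := posnP n; first by case: b.
rewrite bits_half; last by lia.
have -> : (b + n.*2)./2 = n by rewrite half_bit_double.
rewrite oddD odd_double addbF; case: b => //=.
by rewrite /cons_bit bits_half.
Qed.

Lemma bits_valK n : bits_val (bits n) = n.
Proof.
elim/ltn_ind: n => n IH; have [->|n0] := posnP n; first by [].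
by rewrite bits_half //= IH ?odd_double_half //; lia.
Qed.

Lemma bits_of_val s : bits (bits_val s) = foldr cons_bit [::] s.
Proof. by elim: s => //= b s IH; rewrite bits_cons IH. Qed.

Lemma canon_bits n : foldr cons_bit [::] (bits n) = bits n.
Proof. by rewrite -bits_of_val bits_valK. Qed.

Definition bitlen (n : nat) : nat := size (bits n).

Lemma bitlen_half n : 0 < n -> bitlen n = (bitlen n./2).+1.
Proof. by move=> n0; rewrite /bitlen bits_half. Qed.

Lemma leq_bitlen m n : m <= n -> bitlen m <= bitlen n.
Proof.
elim/ltn_ind: n m => n IH m; have [->|m0] := posnP m; first by [].
move=> le; rewrite (bitlen_half m0) (bitlen_half (leq_trans m0 le)).
by rewrite ltnS; apply: IH; lia.
Qed.

Lemma ltn_bitlen n : n < 2 ^ bitlen n.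
Proof.
elim/ltn_ind: n => n IH; have [->|n0] := posnP n; first by [].
rewrite bitlen_half // expnS; have := IH n./2; lia.
Qed.

Lemma bitlen_exp n : 0 < n -> 2 ^ (bitlen n).-1 <= n.
Proof.
elim/ltn_ind: n => n IH n0; rewrite bitlen_half //=.
case: (posnP n./2) => [->|h0]; first by rewrite /bitlen /= expn0.
have := IH n./2; rewrite (bitlen_half h0) /= expnS; lia.
Qed.

Lemma bitlen_ltP n e : (bitlen n <= e) = (n < 2 ^ e).
Proof.
apply/idP/idP => [le|lt].
  by apply: leq_trans (ltn_bitlen n) _; rewrite leq_exp2l.
have [->|n0] := posnP n; first by [].
have := leq_ltn_trans (bitlen_exp n0) lt; rewrite ltn_exp2l //.
by rewrite bitlen_half.
Qed.

Definition tsize (v : seq nat) : nat := size (enc (map bits v)).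
Definition nmem (v : seq nat) : tape := stacks (map bits v).

Lemma tsize_cons x v : tsize (x :: v) = bitlen x + (tsize v).+1.
Proof. by rewrite /tsize /= size_enc_cons. Qed.

Lemma tsize_cat v w : tsize (v ++ w) = tsize v + tsize w.
Proof. by rewrite /tsize map_cat size_enc_cat. Qed.

Lemma tsize_nil : tsize [::] = 0. Proof. by []. Qed.

Lemma bitlen_nth v i : bitlen (nth 0 v i) <= tsize v.
Proof.
elim: v i => [|x v IH] [|i]; rewrite ?nth_nil //= tsize_cons; first lia.
by have := IH i; lia.
Qed.

(** The base is at least 2, so constants, sums and products of such powers are again below one such
    power. *)
Definition poly (f : nat -> nat) := exists c, forall x, f x <= x.+2 ^ c.

Lemma poly_leq f g : (forall x, f x <= g x) -> poly g -> poly f.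
Proof. by move=> le [c H]; exists c => x; apply: leq_trans (le x) (H x). Qed.

Lemma poly_const k : poly (fun=> k).
Proof.
exists k => x; apply: leq_trans (ltnW (ltn_expl k (isT : 1 < 2))) _.
by case: k => // k; rewrite leq_exp2r.
Qed.

Lemma poly_id : poly id.
Proof. by exists 1 => x; rewrite expn1; lia. Qed.

Lemma expn_add x a b : x.+2 ^ a + x.+2 ^ b <= x.+2 ^ (a + b).+1.
Proof.
rewrite expnS expnD; set p := _ ^ a; set q := _ ^ b.
have p0 : 0 < p by rewrite expn_gt0.
have q0 : 0 < q by rewrite expn_gt0.
nia.
Qed.

Lemma poly_add f g : poly f -> poly g -> poly (fun x => f x + g x).
Proof.
move=> [a Ha] [b Hb]; exists (a + b).+1 => x.
by apply: leq_trans (leq_add (Ha x) (Hb x)) (expn_add _ _ _).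
Qed.

Lemma poly_mul f g : poly f -> poly g -> poly (fun x => f x * g x).
Proof.
move=> [a Ha] [b Hb]; exists (a + b) => x.
by rewrite expnD leq_mul.
Qed.

Lemma poly_exp f c : poly f -> poly (fun x => f x ^ c).
Proof.
move=> H; elim: c => [|c IH]; first exact: (poly_const 1).
by have := poly_mul H IH; apply: poly_leq => x; rewrite expnS.
Qed.

Lemma poly_S f : poly f -> poly (fun x => (f x).+1).
Proof. by move=> H; have := poly_add H (poly_const 1); apply: poly_leq => x; lia. Qed.

Lemma poly_comp f g : poly f -> poly g -> poly (fun x => f (g x)).
Proof.
move=> [a Ha] Hg; have := poly_exp a (poly_S (poly_S Hg)).
by apply: poly_leq => x; apply: Ha.
Qed.

Ltac polytac := repeat
  (assumption || apply: poly_id || apply: poly_const || apply: poly_S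
   || apply: poly_exp || apply: poly_add || apply: poly_mul).

(** The rest [r] of the memory is left alone but enters the time bound, since each bit operation may
    shift the whole tape. *)
Definition PTV (k : nat) (phi : seq nat -> seq nat) : Prop :=
  exists (F : frag unit) (c : nat), forall v r, size v = k ->
    runs F (nmem (v ++ r)) ((tsize (v ++ r)).+2 ^ c) tt (nmem (phi v ++ r)).

Lemma PTV_intro k phi (F : frag unit) (f : nat -> nat) : poly f ->
  (forall v r, size v = k ->
    runs F (nmem (v ++ r)) (f (tsize (v ++ r))) tt (nmem (phi v ++ r))) ->
  PTV k phi.
Proof.
by move=> [c Hc] H; exists F, c => v r sz; apply: runs_leq (H v r sz) (Hc _).
Qed.

Lemma PTV_ext k phi psi : (forall v, size v = k -> phi v = psi v) ->
  PTV k phi -> PTV k psi.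
Proof. by move=> E [F [c H]]; exists F, c => v r sz; rewrite -E //; apply: H. Qed.

Lemma tsize_runs (F : frag unit) v w t : runs F (nmem v) t tt (nmem w) ->
  tsize w <= tsize v + t.*2.
Proof. by move=> H; have := runs_size H. Qed.

Lemma PTV_size k phi : PTV k phi ->
  exists c, forall v, size v = k -> tsize (phi v) <= (tsize v).+2 ^ c.
Proof.
move=> [F [c H]].
have [c' Hc'] : poly (fun x => x + 2 * x.+2 ^ c) by polytac.
exists c' => v sz; apply: leq_trans (Hc' _).
have := H v [::] sz; rewrite !cats0 => H'; have := tsize_runs H'; lia.
Qed.

Lemma PTV_comp k k' phi psi : PTV k phi -> PTV k' psi ->
  (forall v, size v = k -> size (phi v) = k') -> PTV k (fun v => psi (phi v)).
Proof.
move=> [F [c HF]] [G [d HG]] sz.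
apply: (@PTV_intro _ _ (bind F (fun _ => G))
   (fun x => x.+2 ^ c + (x + 2 * x.+2 ^ c).+2 ^ d)); first by polytac.
move=> v r sv; have H1 := HF v r sv; have H2 := HG (phi v) r (sz v sv).
apply: (runs_bind H1 (runs_leq H2 _)).
have := tsize_runs H1; rewrite mul2n => le; case: (d) => // d'.
by rewrite leq_exp2r // !ltnS.
Qed.

Lemma PTV_frame k j phi : PTV k phi ->
  PTV (k + j) (fun v => phi (take k v) ++ drop k v).
Proof.
move=> [F [c H]]; exists F, c => v r sz.
have := H (take k v) (drop k v ++ r); rewrite !catA cat_take_drop; apply.
by rewrite size_takel // sz leq_addr.
Qed.

Lemma PTV_copy k i : i < k -> PTV k (fun v => nth 0 v i :: v).
Proof.
move=> ik; apply: (@PTV_intro _ _ (copy_stack i)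
  (fun x => (x + 10) * (100 * x + 1000))); first by polytac.
move=> v r sz; rewrite /nmem cat_cons /=.
have -> : map bits (v ++ r) = map bits (take i v) ++
    bits (nth 0 v i) :: map bits (drop i.+1 v ++ r).
  by rewrite -map_cons -map_cat -cat_cons -drop_nth ?sz // catA cat_take_drop.
have -> : i = size (map bits (take i v)) by rewrite size_map size_takel // sz ltnW.
have := @runs_copy (map bits (take i v)) (bits (nth 0 v i))
  (map bits (drop i.+1 v ++ r)) _ (leqnn _).
have -> : size (enc (map bits (take i v) ++ bits (nth 0 v i) :: map bits (drop i.+1 v ++ r)))
    = tsize (v ++ r).
  rewrite /tsize; congr (size (enc _)).
  by rewrite -map_cons -map_cat -cat_cons -drop_nth ?sz // catA cat_take_drop.
by rewrite canon_bits size_map size_takel // sz ltnW.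
Qed.

Lemma PTV_drop k i : i < k -> PTV k (fun v => take i v ++ drop i.+1 v).
Proof.
move=> ik; apply: (@PTV_intro _ _ (drop_stack i)
  (fun x => x.+1 * (8 * x + 40))); first by polytac.
move=> v r sz; set T := tsize _.
have E : map bits (v ++ r) = map bits (take i v) ++
    bits (nth 0 v i) :: map bits (drop i.+1 v ++ r).
  by rewrite -map_cons -map_cat -cat_cons -drop_nth ?sz // catA cat_take_drop.
have E2 : map bits ((take i v ++ drop i.+1 v) ++ r) =
    map bits (take i v) ++ map bits (drop i.+1 v ++ r) by rewrite -catA map_cat.
rewrite /nmem E E2.
have si : i = size (map bits (take i v)) by rewrite size_map size_takel // sz ltnW.
have leT : size (enc (map bits (take i v) ++
    bits (nth 0 v i) :: map bits (drop i.+1 v ++ r))) <= T by rewrite -E.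
have H := runs_drop leT; rewrite -si in H; apply: (runs_leq H).
rewrite leq_mul2r ltnS; apply/orP; right.
by apply: leq_trans (bitlen_nth v i) _; rewrite /T tsize_cat leq_addr.
Qed.

Lemma PTV_new k : PTV k (fun v => 0 :: v).
Proof.
apply: (@PTV_intro _ _ new_stack (fun _ => 3)); first by polytac.
by move=> v r _; apply: runs_new.
Qed.

Lemma PTV_push k (b : bool) : PTV k.+1 (fun v => (b + (head 0 v).*2) :: behead v).
Proof.
apply: (@PTV_intro _ _ (cins 0 b tt) (fun x => 8 * x + 40)); first by polytac.
move=> [|x v] // r _; rewrite /nmem /= bits_cons.
exact: (@runs_cins _ tt b [::] (bits x) (map bits (v ++ r)) _ (leqnn _)).
Qed.

Lemma PTV_half k : PTV k.+1 (fun v => (head 0 v)./2 :: behead v).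
Proof.
apply: (@PTV_intro _ _ (bind (peek 0)
   (fun o => if o is None then nop tt else del 0 tt))
   (fun x => (4 * x + 20) + (4 * x + 20))); first by polytac.
move=> [|x v] // r _; set T := tsize _.
have leT : size (enc (bits x :: map bits (v ++ r))) <= T by [].
apply: (runs_bind (runs_peek (m1 := [::]) leT)); rewrite /= /nmem /=.
have [->|x0] := posnP x; first by apply: (runs_leq (runs_nop _ _)); lia.
rewrite bits_half //= in leT *.
exact: (@runs_del _ tt (odd x) [::] _ _ _ leT).
Qed.

Lemma PTV_if k phi0 phi1 phie : PTV k.+1 phi0 -> PTV k.+1 phi1 -> PTV k.+1 phie ->
  PTV k.+1 (fun v => if head 0 v == 0 then phie v
                     else if odd (head 0 v) then phi1 v else phi0 v).
Proof.
move=> [F0 [c0 H0]] [F1 [c1 H1]] [Fe [ce He]].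
apply: (@PTV_intro _ _ (bind (peek 0)
   (fun o => match o with None => Fe | Some false => F0 | Some true => F1 end))
   (fun x => (4 * x + 20) + (x.+2 ^ c0 + x.+2 ^ c1 + x.+2 ^ ce))).
  by polytac.
move=> [|x v] // r sz; set T := tsize _.
have leT : size (enc (bits x :: map bits (v ++ r))) <= T by [].
apply: (runs_bind (runs_peek (m1 := [::]) leT)).
have [x0|x0] := posnP x.
  have H := He (x :: v) r sz; move: H; rewrite -/T; move: (T) => T'; rewrite x0 => H.
  by apply: (runs_leq H); lia.
have -> : ohead (bits x) = Some (odd x) by rewrite bits_half.
rewrite /=; case: (odd x).
- by apply: (runs_leq (H1 (x :: v) r sz)); rewrite -/T; lia.
- by apply: (runs_leq (H0 (x :: v) r sz)); rewrite -/T; lia.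
Qed.

(** The first entry is the loop flag. Once it is zero further rounds change nothing, so the number
    of rounds may be overestimated. *)
Definition wstep (phi : seq nat -> seq nat) (v : seq nat) :=
  if head 0 v == 0 then v else phi v.

Lemma wstep_stable phi n v : head 0 v = 0 -> iter n (wstep phi) v = v.
Proof. by move=> h; elim: n => //= n ->; rewrite /wstep h. Qed.

Lemma wstep_stop phi m n v : head 0 (iter m (wstep phi) v) = 0 -> m <= n ->
  iter n (wstep phi) v = iter m (wstep phi) v.
Proof. by move=> h le; rewrite -(subnK le) iterD wstep_stable. Qed.

(** Polynomially many rounds of a polynomial-time body do not suffice, because each round could
    square the size; hence the separate bound [B] on all intermediate memories. *)
Lemma PTV_while k k' iota phi (M : seq nat -> nat) (N B : nat -> nat) :
  PTV k (fun v => iota v ++ v) -> PTV k'.+1 phi ->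
  (forall v, size v = k -> size (iota v) = k'.+1) ->
  (forall v, size v = k'.+1 -> size (phi v) = k'.+1) -> poly N -> poly B ->
  (forall v, size v = k -> M v <= N (tsize v)) ->
  (forall v, size v = k -> head 0 (iter (M v) (wstep phi) (iota v)) = 0) ->
  (forall v i, size v = k -> i <= M v ->
     tsize (iter i (wstep phi) (iota v)) <= B (tsize v)) ->
  PTV k (fun v => iter (M v) (wstep phi) (iota v) ++ v).
Proof.
move=> [F0 [c0 HF0]] [F [c HF]] szi sz [n Hn] [b Hb] HM stop bound.
pose body := bind (peek 0) (fun o =>
  if o is None then nop (Some tt) else bind F (fun _ => nop None)).
pose K x := 4 * (x.+2 ^ b + x) + 20 + ((x.+2 ^ b + x).+2 ^ c + 5).
apply: (@PTV_intro _ _ (bind F0 (fun _ => floop body))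
  (fun x => x.+2 ^ c0 + (x.+2 ^ n).+1 * K x)); first by rewrite /K; polytac.
move=> v r sv; set x := tsize (v ++ r).
have lex : tsize v <= x by rewrite /x tsize_cat leq_addr.
apply: (runs_bind (HF0 v r sv)); rewrite -!catA.
apply: (@runs_leq _ _ _ ((M v).+1 * K x)); last first.
  rewrite leq_mul2r ltnS; apply/orP; right; apply: leq_trans (HM v sv) _.
  apply: leq_trans (Hn _) _.
  by case: (n) => // n'; rewrite leq_exp2r.
have bd i : tsize (iter i (wstep phi) (iota v)) <= x.+2 ^ b.
  (* After [M v] rounds the memory is constant, so the size bound extends to every [i]. *)
  wlog iM : i / i <= M v => [H|].
    case: (leqP i (M v)) => [/H //|/ltnW /(wstep_stop (stop v sv)) ->].
    exact: H.
  apply: leq_trans (bound v i sv iM) _; apply: leq_trans (Hb _) _.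
  by case: (b) => // b'; rewrite leq_exp2r.
have ler : tsize (v ++ r) <= x by [].
move: (v ++ r) (x) lex bd ler {HF0} => {}r {}x lex bd ler.
suff key m w : size w = k'.+1 ->
    (forall i, tsize (iter i (wstep phi) w) <= x.+2 ^ b) ->
    head 0 (iter m (wstep phi) w) = 0 ->
    runs (floop body) (nmem (w ++ r)) (m.+1 * K x) tt (nmem (iter m (wstep phi) w ++ r)).
  by apply: key => //; [exact: szi | exact: stop].
elim: m w => [|m IH] w sw {}bd hw.
  rewrite mul1n; apply: runs_loop_exit; case: w sw hw bd => // y w _ /= -> bd.
  have leT : size (enc (bits 0 :: map bits (w ++ r))) <= x.+2 ^ b + x.
    have := bd 0; rewrite [iter _ _ _]/= -[size _]/(tsize (0 :: w ++ r)) !tsize_cons.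
    by rewrite tsize_cat; lia.
  apply: (@runs_leq _ _ _ (4 * (x.+2 ^ b + x) + 20 + 5)); last by rewrite /K; lia.
  by apply: (runs_bind (runs_peek (m1 := [::]) leT)); apply: runs_nop.
have [h0|h0] := eqVneq (head 0 w) 0.
  rewrite wstep_stable //.
  have := IH w sw bd; rewrite wstep_stable // => /(_ h0) H.
  by apply: runs_leq H _; rewrite leq_mul2r ltnW ?orbT.
rewrite [in X in runs _ _ X]mulSn iterSr.
have sphi : wstep phi w = phi w by rewrite /wstep (negbTE h0).
rewrite sphi in hw *; rewrite iterSr sphi in hw.
have leT : tsize (w ++ r) <= x.+2 ^ b + x.
  by rewrite tsize_cat; have := bd 0; rewrite /=; lia.
have {}IH : runs (floop body) (nmem (phi w ++ r)) (m.+1 * K x) tt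
    (nmem (iter m (wstep phi) (phi w) ++ r)).
  by apply: IH => //; [exact: sz | move=> i; have := bd i.+1; rewrite iterSr sphi].
apply: runs_loop_next IH; rewrite /K.
have HFw := HF w r sw.
have HB : runs (bind F (fun=> nop None)) (nmem (w ++ r))
    ((x.+2 ^ b + x).+2 ^ c + 5) (None : option unit) (nmem (phi w ++ r)).
  apply: (@runs_bind _ _ _ _ _ _ tt (nmem (phi w ++ r))); last exact: runs_nop.
  by apply: (runs_leq HFw); case: (c) => // c'; rewrite leq_exp2r // !ltnS.
case: w {sw bd hw sphi HFw} h0 leT HB => // y w /= y0 leT HB.
apply: (runs_bind (runs_peek (m1 := [::]) leT)).
by have -> : ohead (bits y) = Some (odd y) by rewrite bits_half ?lt0n.
Qed.

(** * Functions with a single value and their closure properties *)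

Definition PT (k : nat) (f : seq nat -> nat) := PTV k (fun v => f v :: v).

Lemma PT_ext k f g : (forall v, size v = k -> f v = g v) -> PT k f -> PT k g.
Proof. by move=> E; apply: PTV_ext => v sz; rewrite E. Qed.

Lemma PT_size k f : PT k f ->
  exists c, forall v, size v = k -> bitlen (f v) <= (tsize v).+2 ^ c.
Proof.
by move=> /PTV_size[c H]; exists c => v sz; have := H v sz; rewrite tsize_cons; lia.
Qed.

Lemma PTV_id k : PTV k (fun v => v).
Proof.
apply: PTV_ext (PTV_comp (PTV_new k) (@PTV_drop k.+1 0 isT) _) => v sz.
  by rewrite take0 drop1.
by rewrite /= sz.
Qed.

Lemma PTV_copies j l : PTV (j + l) (fun v => drop j v ++ v).
Proof.
suff H i : i <= l -> PTV (j + l) (fun v => drop (j + l - i) v ++ v).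
  by apply: PTV_ext (H l (leqnn l)) => v _; rewrite addnK.
elim: i => [|i IH] il.
  by apply: PTV_ext (PTV_id _) => v sz; rewrite subn0 drop_oversize ?sz.
apply: PTV_ext (PTV_comp (IH (ltnW il)) (@PTV_copy (i + (j + l)) (j + l).-1 _) _) => [v sz||v sz].
- have -> : j + l - i = (j + l - i.+1).+1 by lia.
  rewrite [in RHS](drop_nth 0) ?sz /=; last by lia.
  congr cons; rewrite nth_cat size_drop sz.
  have -> : (j + l).-1 < j + l - (j + l - i.+1).+1 = false by lia.
  by congr nth; lia.
- by lia.
- by rewrite size_cat size_drop sz; lia.
Qed.

Lemma PTV_drops k i n : i + n <= k -> PTV k (fun v => take i v ++ drop (i + n) v).
Proof.
elim: n => [|n IH] le.
  by apply: PTV_ext (PTV_id k) => v sz; rewrite addn0 cat_take_drop.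
apply: PTV_ext (PTV_comp (IH _) (@PTV_drop (k - n) i _) _) => [v sz|||v sz]; try lia.
- have st : size (take i v) = i by rewrite size_takel // sz; lia.
  rewrite take_size_cat // drop_cat st ltnNge leqW //= subSnn drop_drop.
  by congr (_ ++ drop _ _); lia.
- by rewrite size_cat size_drop size_take_min sz; lia.
Qed.

Lemma PT_shift j l g : PT l g -> PTV (j + l) (fun v => g (drop j v) :: v).
Proof.
move=> Hg.
apply: PTV_ext (PTV_comp (PTV_copies j l)
  (PTV_comp (PTV_frame (j + l) Hg)
     (@PTV_drops (l + (j + l)).+1 1 l _) _) _) => [v sz|||v sz].
- have sd : size (drop j v) = l by rewrite size_drop sz addKn.
  by rewrite /= take_size_cat // drop_size_cat // ?add1n /= take0 drop_size_cat.
- by lia.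
- by move=> v sz; rewrite size_cat /= size_takel ?size_drop ?sz; lia.
- by rewrite size_cat size_drop sz; lia.
Qed.

Fixpoint PTs (k : nat) (gs : seq (seq nat -> nat)) : Prop :=
  if gs is g :: gs' then PT k g /\ PTs k gs' else True.

Lemma PTV_args l gs : PTs l gs -> PTV l (fun v => [seq g v | g <- gs] ++ v).
Proof.
elim: gs => [|g gs IH] /=.
  move=> _; apply: PTV_ext (@PTV_drops l 0 0 isT) => v _.
  by rewrite take0 drop0.
case=> Hg /IH H.
apply: PTV_ext (PTV_comp H (PT_shift (size gs) Hg) _) => v sz.
- by rewrite drop_size_cat ?size_map.
- by rewrite size_cat size_map sz.
Qed.

Lemma PT_comp l k f gs : PT k f -> size gs = k -> PTs l gs ->
  PT l (fun v => f [seq g v | g <- gs]).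
Proof.
move=> Hf sg Hg.
apply: PTV_ext (PTV_comp (PTV_args Hg)
  (PTV_comp (PTV_frame l Hf) (@PTV_drops (k + l).+1 1 k _) _) _) => [v sz|||v sz].
- by rewrite /= take_size_cat ?size_map // drop_size_cat ?size_map // ?add1n /= take0 drop_size_cat ?size_map.
- by lia.
- by move=> v sz; rewrite size_cat /= size_takel ?size_drop ?sz; lia.
- by rewrite size_cat size_map sg sz.
Qed.

Lemma PT_var k i : i < k -> PT k (fun v => nth 0 v i).
Proof. exact: PTV_copy. Qed.

Lemma PT_comp1 l f g : PT 1 f -> PT l g -> PT l (fun v => f [:: g v]).
Proof. by move=> Hf Hg; apply: (@PT_comp l 1 f [:: g]). Qed.

Lemma PT_comp2 l f g h : PT 2 f -> PT l g -> PT l h ->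
  PT l (fun v => f [:: g v; h v]).
Proof. by move=> Hf Hg Hh; apply: (@PT_comp l 2 f [:: g; h]). Qed.

Lemma PT_zero k : PT k (fun=> 0).
Proof. exact: PTV_new. Qed.

Lemma PT_push k (b : bool) f : PT k f -> PT k (fun v => b + (f v).*2).
Proof. by move=> Hf; apply: PTV_ext (PTV_comp Hf (@PTV_push k b) _) => // v /= ->. Qed.

Lemma PT_half k f : PT k f -> PT k (fun v => (f v)./2).
Proof. by move=> Hf; apply: PTV_ext (PTV_comp Hf (@PTV_half k) _) => // v /= ->. Qed.

Lemma PT_const k n : PT k (fun=> n).
Proof.
elim/ltn_ind: n => n IH; have [->|n0] := posnP n; first exact: PT_zero.
have := @PT_push k (odd n) _ (IH n./2 _); rewrite odd_double_half; apply.
by lia.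
Qed.

Lemma PT_if k f g0 g1 ge : PT k f -> PT k g0 -> PT k g1 -> PT k ge ->
  PT k (fun v => if f v == 0 then ge v else if odd (f v) then g1 v else g0 v).
Proof.
move=> Hf H0 H1 He.
have br g : PT k g -> PTV k.+1 (fun w => g (behead w) :: behead w).
  move=> Hg; apply: PTV_ext (PTV_comp (@PTV_drop k.+1 0 isT) Hg _) => v.
    by rewrite take0 drop1.
  by rewrite take0 drop1 size_behead => ->.
apply: PTV_ext (PTV_comp Hf (PTV_if (br _ H0) (br _ H1) (br _ He)) _) => v sz.
  by rewrite /=; case: eqP => // _; case: odd.
by rewrite /= sz.
Qed.

Lemma PTV_map k gs : PTs k gs -> size gs = k -> PTV k (fun v => [seq g v | g <- gs]).
Proof.
move=> Hg sg.
apply: PTV_ext (PTV_comp (PTV_args Hg) (@PTV_drops (k + k) k k _) _) => [v sz||v sz].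
- by rewrite take_size_cat ?size_map // drop_oversize ?cats0 // size_cat size_map sg sz.
- by [].
- by rewrite size_cat size_map sg sz.
Qed.

Lemma size_wstep phi k n v : (forall w, size w = k -> size (phi w) = k) ->
  size v = k -> size (iter n (wstep phi) v) = k.
Proof.
by move=> H sv; elim: n => //= n IH; rewrite /wstep; case: ifP => // _; apply: H.
Qed.

Lemma PT_while k k' inits gs (M : seq nat -> nat) (N B : nat -> nat) j :
  let S := wstep (fun v => [seq g v | g <- gs]) in
  let init v := [seq g v | g <- inits] in
  PTs k inits -> size inits = k'.+1 ->
  PTs k'.+1 gs -> size gs = k'.+1 -> j < k'.+1 -> poly N -> poly B ->
  (forall v, size v = k -> M v <= N (tsize v)) ->
  (forall v, size v = k -> head 0 (iter (M v) S (init v)) = 0) ->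
  (forall v i, size v = k -> i <= M v -> tsize (iter i S (init v)) <= B (tsize v)) ->
  PT k (fun v => nth 0 (iter (M v) S (init v)) j).
Proof.
move=> S init Hi si Hg sg jk polyN polyB HM stop bound.
have szm v : size v = k'.+1 -> size [seq g v | g <- gs] = k'.+1 by rewrite size_map sg.
have szi v : size v = k -> size (init v) = k'.+1 by rewrite size_map si.
have HW := PTV_while (PTV_args Hi) (PTV_map Hg sg) szi szm polyN polyB HM stop bound.
have szS v : size v = k -> size (iter (M v) S (init v)) = k'.+1.
  by move=> sv; apply: size_wstep (szi v sv).
apply: PTV_ext (PTV_comp HW
  (PTV_comp (@PTV_copy (k'.+1 + k) j _)
     (@PTV_drops (k'.+1 + k).+1 1 k'.+1 _) _) _) => [v sz|||w sw|w sw].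
- by rewrite /= take0 drop_size_cat ?szS // nth_cat szS // jk.
- by lia.
- by lia.
- by rewrite /= sw.
- by rewrite size_cat szS // sw.
Qed.

(** * Arithmetic in polynomial time *)

Lemma PTs_cat k fs gs : PTs k fs -> PTs k gs -> PTs k (fs ++ gs).
Proof. by elim: fs => //= f fs IH [Hf /IH H] /H; split. Qed.

Lemma PT_behead k f : PT k f -> PT k.+1 (fun w => f (behead w)).
Proof. by move=> /(PT_shift 1); apply: PTV_ext => v _; rewrite drop1. Qed.

Lemma PT_odd k f g0 g1 : PT k f -> PT k g0 -> PT k g1 ->
  PT k (fun v => if odd (f v) then g1 v else g0 v).
Proof.
move=> Hf H0 H1; apply: PT_ext (PT_if Hf H0 H1 H0) => v _.
by case: eqP => // ->.
Qed.

Lemma PT_if0 k f g h : PT k f -> PT k g -> PT k h ->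
  PT k (fun v => if f v == 0 then g v else h v).
Proof.
by move=> Hf Hg Hh; apply: PT_ext (PT_if Hf Hh Hh Hg) => v _; rewrite if_same.
Qed.

Lemma PT_bit3 (F : bool -> bool -> bool -> bool) k f g h :
  PT k f -> PT k g -> PT k h ->
  PT k (fun v => nat_of_bool (F (odd (f v)) (odd (g v)) (odd (h v)))).
Proof.
move=> Hf Hg Hh.
have H b1 b2 : PT k (fun v => nat_of_bool (F b1 b2 (odd (h v)))).
  apply: PT_ext (PT_odd Hh (PT_const k (F b1 b2 false)) (PT_const k (F b1 b2 true))).
  by move=> v _; case: odd.
have {}H b1 : PT k (fun v => nat_of_bool (F b1 (odd (g v)) (odd (h v)))).
  apply: PT_ext (PT_odd Hg (H b1 false) (H b1 true)).
  by move=> v _; case: (odd (g v)).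
apply: PT_ext (PT_odd Hf (H false) (H true)).
by move=> v _; case: (odd (f v)).
Qed.

Lemma bitlen_cons (b : bool) n : bitlen (b + n.*2) <= (bitlen n).+1.
Proof. by rewrite /bitlen bits_cons size_cons_bit. Qed.

Lemma bitlen_half_leq n : bitlen n./2 <= bitlen n.
Proof. by apply: leq_bitlen; lia. Qed.

Lemma bitlen_bool (b : bool) : bitlen b <= 1. Proof. by case: b. Qed.

Lemma wstep_inv (P : seq nat -> Prop) phi v n :
  (forall w, P w -> head 0 w != 0 -> P (phi w)) -> P v -> P (iter n (wstep phi) v).
Proof.
by move=> H Pv; elim: n => //= n IH; rewrite {1}/wstep; case: eqP => // /eqP /(H _ IH).
Qed.

Definition rev_gs : seq (seq nat -> nat) :=
  [:: fun v => (nth 0 v 0)./2; fun v => odd (nth 0 v 0) + (nth 0 v 1).*2].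

(** Moves the bits of [t] one by one onto [o], in reverse order. It stops when [t] becomes 0, so
    zeros at the high end of [t] survive only below a leading 1. *)
Definition rev_acc (t o : nat) : nat :=
  nth 0 (iter (bitlen t) (wstep (fun v => [seq g v | g <- rev_gs])) [:: t; o]) 1.

Lemma rev_acc0 o : rev_acc 0 o = o. Proof. by []. Qed.

Lemma rev_accE t o : 0 < t -> rev_acc t o = rev_acc t./2 (odd t + o.*2).
Proof.
move=> t0; rewrite /rev_acc bitlen_half // iterSr; congr (nth _ (iter _ _ _) _).
by rewrite /wstep /= eqn0Ngt t0.
Qed.

Lemma PT_push_odd k f g : PT k f -> PT k g -> PT k (fun v => odd (f v) + (g v).*2).
Proof.
move=> Hf Hg; apply: PT_ext (PT_odd Hf (PT_push false Hg) (PT_push true Hg)).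
by move=> v _; case: odd.
Qed.

Lemma PT_rev_acc k f g : PT k f -> PT k g -> PT k (fun v => rev_acc (f v) (g v)).
Proof.
move=> Hf Hg; suff H : PT 2 (fun v => rev_acc (nth 0 v 0) (nth 0 v 1)).
  exact: (PT_comp2 H Hf Hg).
apply: (@PT_while 2 1 [:: fun v => nth 0 v 0; fun v => nth 0 v 1] rev_gs
  (fun v => bitlen (nth 0 v 0)) id (fun x => x + 2) 1) => //.
- by do ![split]; apply: PT_var.
- split; first exact: PT_half (PT_var _).
  by split=> //; apply: PT_push_odd; apply: PT_var.
- exact: poly_id.
- by polytac.
- by move=> v _; apply: bitlen_nth.
- move=> v _ /=; move: (nth 0 v 0) (nth 0 v 1) => t o.
  elim/ltn_ind: t o => t IH o; have [->//|t0] := posnP t.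
  rewrite bitlen_half // iterSr {2}/wstep /= eqn0Ngt t0 /=.
  by apply: IH; lia.
- move=> v i sv _.
  (* Each round moves a bit from one number to the other, so the memory does not grow. *)
  have H w : size w = 2 -> tsize (wstep (fun v => [seq g v | g <- rev_gs]) w) <= tsize w.
    case: w => [|t [|o []]] // _; rewrite /wstep /=; case: posnP => // t0.
    rewrite !tsize_cons /=; have := bitlen_cons (odd t) o.
    by rewrite (bitlen_half t0); lia.
  apply: (@leq_trans (tsize v)); last lia.
  case: v sv => [|t [|o []]] // _ /=.
  elim: i => //= i IH; apply: leq_trans (H _ _) IH.
  by apply: size_wstep.
Qed.

(* A Mealy machine reading the two numbers a and b least significant bit first:
   the state is [:: running flag; a; b; carry; output], the output being
   accumulated in reverse after a leading 1. *)
Definition scan_gs (nxt out : bool -> bool -> bool -> bool) : seq (seq nat -> nat) :=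
  [:: fun v => if (nth 0 v 1)./2 == 0 then (if (nth 0 v 2)./2 == 0 then 0 else 1) else 1;
      fun v => (nth 0 v 1)./2;
      fun v => (nth 0 v 2)./2;
      fun v => nat_of_bool (nxt (odd (nth 0 v 1)) (odd (nth 0 v 2)) (odd (nth 0 v 3)));
      fun v => out (odd (nth 0 v 1)) (odd (nth 0 v 2)) (odd (nth 0 v 3)) + (nth 0 v 4).*2].

Definition scan_step nxt out := wstep (fun v => [seq g v | g <- scan_gs nxt out]).

Definition scan nxt out (x y : nat) : seq nat :=
  iter (bitlen x + bitlen y).+1 (scan_step nxt out) [:: 1; x; y; 0; 1].

(** As long as bits remain, a round shortens at least one of the two numbers; the extra round covers
    the case that both are 0 at the start. *)
Lemma scan_stop nxt out x y : head 0 (scan nxt out x y) = 0.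
Proof.
suff gen M f a b c t : bitlen a + bitlen b < M ->
    head 0 (iter M (scan_step nxt out) [:: f; a; b; c; t]) = 0 by apply: gen.
elim: M f a b c t {x y} => // M IH f x y c t leM.
rewrite iterSr /scan_step {2}/wstep /=; case: eqP => [f0|_].
  by rewrite wstep_stable.
have xy : x./2 != 0 \/ y./2 != 0 -> bitlen x./2 + bitlen y./2 < M.
  have := bitlen_half_leq x; have := bitlen_half_leq y.
  by move=> ? ? [] h0; [have := @bitlen_half x _|have := @bitlen_half y _]; lia.
case: eqP => [x0|/eqP x0]; last by apply: IH; apply: xy; left.
case: eqP => [y0|/eqP y0]; last by apply: IH; apply: xy; right.
by rewrite wstep_stable.
Qed.

Lemma PT_scan nxt out j k f g : j < 5 -> PT k f -> PT k g ->
  PT k (fun v => nth 0 (scan nxt out (f v) (g v)) j).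
Proof.
move=> j5 Hf Hg; suff H : PT 2 (fun v => nth 0 (scan nxt out (nth 0 v 0) (nth 0 v 1)) j).
  exact: (PT_comp2 H Hf Hg).
have P0 := @PT_var 2 0 isT; have P1 := @PT_var 2 1 isT.
apply: (@PT_while 2 4 [:: fun=> 1; fun v => nth 0 v 0; fun v => nth 0 v 1; fun=> 0; fun=> 1]
  (scan_gs nxt out)
  (fun v => (bitlen (nth 0 v 0) + bitlen (nth 0 v 1)).+1) (fun x => (x + x).+1)
  (fun x => (x + 10) + (x + x).+1 * 3) j) => //.
- by do ![split]; rewrite //; apply: PT_const.
- have V i : i < 5 -> PT 5 (fun v => nth 0 v i) by apply: PT_var.
  have V1 := PT_half (V 1 isT); have V2 := PT_half (V 2 isT).
  split; first by apply: PT_if0 => //; [apply: PT_if0 => //; apply: PT_const | apply: PT_const].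
  do 2![split=> //]; split; first by apply: PT_bit3; apply: V.
  split=> //; pose F v := nat_of_bool (out (odd (nth 0 v 1)) (odd (nth 0 v 2)) (odd (nth 0 v 3))).
  have HF : PT 5 F by apply: PT_bit3; apply: V.
  apply: PT_ext (PT_push_odd HF (V 4 isT)) => v _.
  by rewrite /F; case: (out _ _ _).
- by polytac.
- by polytac.
- by move=> v _; have := bitlen_nth v 0; have := bitlen_nth v 1; lia.
- by move=> v _; apply: scan_stop.
- move=> v i sv le.
  have H w : size w = 5 -> tsize (scan_step nxt out w) <= tsize w + 3.
    case: w => [|q [|a [|b [|c [|t []]]]]] // _; rewrite /scan_step /wstep /=.
    case: posnP => [|q0]; first lia.
    rewrite !tsize_cons /=.
    set o := out _ _ _; set n := nxt _ _ _.
    have := bitlen_cons o t; have := bitlen_half_leq a; have := bitlen_half_leq b.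
    have := bitlen_bool n; case: eqP => _; first case: eqP => _; rewrite /bitlen /=; lia.
  have Hi : tsize (iter i (scan_step nxt out) [:: 1; nth 0 v 0; nth 0 v 1; 0; 1])
     <= tsize v + 10 + i * 3.
    elim: (i) => [|j' IH].
      case: v sv {le} => [|x [|y []]] // _; rewrite !tsize_cons /= /bitlen /=; lia.
    apply: leq_trans (H _ _) _; first exact: size_wstep.
    by apply: leq_trans (leq_add IH (leqnn 3)) _; lia.
  apply: leq_trans Hi _; rewrite leq_add2l leq_mul2r.
  apply: leq_trans le _.
  by have := bitlen_nth v 0; have := bitlen_nth v 1; lia.
Qed.

Definition add_carry (a b c : bool) : bool := (a && b) || ((a || b) && c).
Definition sub_borrow (a b c : bool) : bool := (~~ a && (b || c)) || (b && c).
Definition xor3 (a b c : bool) : bool := a (+) b (+) c.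

Lemma odd_halfE n : n = odd n + n./2.*2. Proof. by rewrite odd_double_half. Qed.

Lemma rev_acc_cons (b : bool) t o : 0 < t ->
  rev_acc (b + t.*2) o = rev_acc t (b + o.*2).
Proof.
move=> t0; rewrite rev_accE; last by lia.
by rewrite half_bit_double oddD odd_double addbF oddb.
Qed.

(** Invariant: the output so far, placed below the sum of the unread parts and the carry, is the
    total. The leading 1 of the accumulator is moved last and becomes the lowest bit, whence
    [.*2.+1] and the final halving. *)
Lemma scan_add x y : let w := scan add_carry xor3 x y in
  (rev_acc (nth 0 w 4) (nth 0 w 3))./2 = x + y.
Proof.
pose P w := exists q a b (c : bool) t, [/\ w = [:: q; a; b; nat_of_bool c; t],
  q = 0 -> a = 0 /\ b = 0, 0 < t & rev_acc t (a + b + c) = (x + y).*2.+1].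
have : P (scan add_carry xor3 x y).
  apply: wstep_inv; last first.
    exists 1, x, y, false, 1; split => //=.
    by rewrite rev_accE // addn0 rev_acc0 add1n.
  move=> _ [q [a [b [c [t [-> q0 t0 E]]]]]] _.
  rewrite /=; do 5!eexists; split; first by reflexivity.
  - by case: eqP => // a0; case: eqP.
  - by lia.
  rewrite oddb rev_acc_cons // -E; congr rev_acc.
  rewrite [in RHS](odd_halfE a) [in RHS](odd_halfE b).
  by move: (odd a) (odd b) c {E} => [] [] []; rewrite /xor3 /add_carry /=; lia.
case=> q [a [b [c [t [E q0 t0 R]]]]] w; have := scan_stop add_carry xor3 x y.
rewrite /w E /= => /q0[a0 b0]; rewrite a0 b0 !add0n in R.
by rewrite R; lia.
Qed.

(** Comparing the unread parts with the borrow taken into account always decides [x < y]; when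
    nothing is left, the borrow itself is the answer. *)
Lemma scan_borrow x y : nth 0 (scan sub_borrow xor3 x y) 3 = (x < y).
Proof.
pose P w := exists q a b (c : bool) t, [/\ w = [:: q; a; b; nat_of_bool c; t],
  q = 0 -> a = 0 /\ b = 0 & (a < b + c) = (x < y)].
have : P (scan sub_borrow xor3 x y).
  apply: wstep_inv; last by exists 1, x, y, false, 1; split => //=; rewrite addn0.
  move=> _ [q [a [b [c [t [-> q0 E]]]]]] _.
  rewrite /=; do 5!eexists; split; first by reflexivity.
  - by case: eqP => // a0; case: eqP.
  rewrite oddb -E.
  rewrite [in RHS](odd_halfE a) [in RHS](odd_halfE b).
  by move: (odd a) (odd b) c {E} => [] [] []; rewrite /sub_borrow /=; lia.
case=> q [a [b [c [t [E q0 <-]]]]]; have := scan_stop sub_borrow xor3 x y.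
by rewrite E /= => /q0[-> ->]; case: (c).
Qed.

Lemma scan_sub x y : y <= x -> let w := scan sub_borrow xor3 x y in
  (rev_acc (nth 0 w 4) 0)./2 = x - y.
Proof.
move=> yx; pose P w := exists q a b (c : bool) t, [/\ w = [:: q; a; b; nat_of_bool c; t],
  q = 0 -> a = 0 /\ b = 0, 0 < t, b + c <= a & rev_acc t (a - (b + c)) = (x - y).*2.+1].
have : P (scan sub_borrow xor3 x y).
  apply: wstep_inv; last first.
    exists 1, x, y, false, 1; split => //=; first by rewrite addn0.
    by rewrite rev_accE // addn0 rev_acc0 add1n.
  move=> _ [q [a [b [c [t [-> q0 t0 le E]]]]]] _.
  rewrite /=; do 5!eexists; split; first by reflexivity.
  - by case: eqP => // a0; case: eqP.
  - by lia.
  - move: le; rewrite oddb [in X in X -> _](odd_halfE a) [in X in X -> _](odd_halfE b).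
    by move: (odd a) (odd b) c {E} => [] [] []; rewrite /sub_borrow /=; lia.
  rewrite oddb rev_acc_cons // -E; congr rev_acc.
  move: le; rewrite [in X in X -> _](odd_halfE a) [in X in X -> _](odd_halfE b).
  rewrite [in RHS](odd_halfE a) [in RHS](odd_halfE b).
  by move: (odd a) (odd b) c {E} => [] [] []; rewrite /xor3 /sub_borrow /=; lia.
case=> q [a [b [c [t [E q0 t0 le R]]]]] w; have := scan_stop sub_borrow xor3 x y.
rewrite /w E /= => /q0[a0 b0]; rewrite a0 b0 sub0n in R.
by rewrite R; lia.
Qed.

Lemma PT_add k f g : PT k f -> PT k g -> PT k (fun v => f v + g v).
Proof.
move=> Hf Hg; pose w j v := nth 0 (scan add_carry xor3 (f v) (g v)) j.
have H j : j < 5 -> PT k (w j) by move=> ?; apply: PT_scan.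
apply: PT_ext (PT_half (PT_rev_acc (H 4 isT) (H 3 isT))) => v _.
exact: scan_add.
Qed.

Lemma PT_ltn k f g : PT k f -> PT k g -> PT k (fun v => nat_of_bool (f v < g v)).
Proof.
move=> Hf Hg; apply: PT_ext (PT_scan sub_borrow xor3 (isT : 3 < 5) Hf Hg) => v _.
exact: scan_borrow.
Qed.

Lemma PT_ite k (b : seq nat -> bool) g h : PT k (fun v => nat_of_bool (b v)) ->
  PT k g -> PT k h -> PT k (fun v => if b v then g v else h v).
Proof.
by move=> Hb Hg Hh; apply: PT_ext (PT_if0 Hb Hh Hg) => v _; case: (b v).
Qed.

Lemma PT_neg k (b : seq nat -> bool) : PT k (fun v => nat_of_bool (b v)) ->
  PT k (fun v => nat_of_bool (~~ b v)).
Proof.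
move=> Hb; apply: PT_ext (PT_ite Hb (PT_const k 0) (PT_const k 1)) => v _.
by case: (b v).
Qed.

Lemma PT_and k (b c : seq nat -> bool) : PT k (fun v => nat_of_bool (b v)) ->
  PT k (fun v => nat_of_bool (c v)) -> PT k (fun v => nat_of_bool (b v && c v)).
Proof.
move=> Hb Hc; apply: PT_ext (PT_ite Hb Hc (PT_const k 0)) => v _.
by case: (b v).
Qed.

Lemma PT_leq k f g : PT k f -> PT k g -> PT k (fun v => nat_of_bool (f v <= g v)).
Proof.
move=> Hf Hg; apply: PT_ext (PT_neg (PT_ltn Hg Hf)) => v _.
by rewrite -leqNgt.
Qed.

Lemma PT_eq k f g : PT k f -> PT k g -> PT k (fun v => nat_of_bool (f v == g v)).
Proof.
move=> Hf Hg; apply: PT_ext (PT_and (PT_leq Hf Hg) (PT_leq Hg Hf)) => v _.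
by rewrite -eqn_leq.
Qed.

Lemma PT_sub k f g : PT k f -> PT k g -> PT k (fun v => f v - g v).
Proof.
move=> Hf Hg.
have H := PT_half (PT_rev_acc (PT_scan sub_borrow xor3 (isT : 4 < 5) Hf Hg) (PT_const k 0)).
apply: PT_ext (PT_ite (PT_ltn Hf Hg) (PT_const k 0) H) => v _.
case: ltnP => [lt|le]; first by apply/esym/eqP; rewrite subn_eq0 ltnW.
exact: (scan_sub le).
Qed.

Lemma PT_min k f g : PT k f -> PT k g -> PT k (fun v => minn (f v) (g v)).
Proof. by move=> Hf Hg; apply: PT_ite => //; apply: PT_ltn. Qed.

(** Bounded in value and not only in bit length: such numbers may be exponents or numbers of
    iterations. *)
Definition small (k : nat) (f : seq nat -> nat) :=
  exists c, forall v, size v = k -> f v <= (tsize v).+2 ^ c.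

Lemma small_poly k (N : nat -> nat) f : poly N ->
  (forall v, size v = k -> f v <= N (tsize v)) -> small k f.
Proof. by move=> [c H] le; exists c => v sv; apply: leq_trans (le v sv) (H _). Qed.

Lemma small_leq k f g : (forall v, size v = k -> f v <= g v) -> small k g -> small k f.
Proof. by move=> le [c H]; exists c => v sv; apply: leq_trans (le v sv) (H v sv). Qed.

Lemma small_const k n : small k (fun=> n).
Proof. by apply: (@small_poly _ (fun=> n)) => //; apply: poly_const. Qed.

Lemma small_add k f g : small k f -> small k g -> small k (fun v => f v + g v).
Proof.
move=> [a Ha] [b Hb]; apply: (@small_poly _ (fun x => x.+2 ^ a + x.+2 ^ b)).
  by polytac.
by move=> v sv; apply: leq_add; [apply: Ha | apply: Hb].
Qed.

Lemma small_mul k f g : small k f -> small k g -> small k (fun v => f v * g v).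
Proof.
move=> [a Ha] [b Hb]; apply: (@small_poly _ (fun x => x.+2 ^ a * x.+2 ^ b)).
  by polytac.
by move=> v sv; apply: leq_mul; [apply: Ha | apply: Hb].
Qed.

Lemma small_S k f : small k f -> small k (fun v => (f v).+1).
Proof.
by move=> H; apply: small_leq (small_add H (small_const k 1)) => v _; rewrite addn1.
Qed.

Lemma small_exp k f n : small k f -> small k (fun v => f v ^ n).
Proof.
move=> H; elim: n => [|n IH]; first exact: (small_const k 1).
by apply: small_leq (small_mul H IH) => v _; rewrite expnS.
Qed.

Lemma small_bitlen k f : PT k f -> small k (fun v => bitlen (f v)).
Proof. by move/PT_size. Qed.

Lemma leq_tsize_exp c x y : x <= y -> x.+2 ^ c <= y.+2 ^ c.
Proof. by case: c => // c le; rewrite leq_exp2r. Qed.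

Lemma small_behead k f : small k f -> small k.+1 (fun w => f (behead w)).
Proof.
move=> [c H]; exists c => -[|x v] // [sv] /=; apply: leq_trans (H v sv) _.
by apply: leq_tsize_exp; rewrite tsize_cons; lia.
Qed.

Lemma PT_S k f : PT k f -> PT k (fun v => (f v).+1).
Proof. by move=> H; apply: PT_ext (PT_add H (PT_const k 1)) => v _; rewrite addn1. Qed.

Lemma PTs_vars n i k : i + k <= n -> PTs n [seq (fun w => nth 0 w j) | j <- iota i k].
Proof.
elim: k i => //= k IH i le; split; last by apply: IH; lia.
by apply: PT_var; lia.
Qed.

Lemma map_vars i k w : i + k = size w ->
  [seq g w | g <- [seq (fun w => nth 0 w j) | j <- iota i k]] = drop i w.
Proof.
move=> E; rewrite -map_comp.
rewrite (@eq_map _ _ _ (nth 0 w)) // map_nth_iota; last by lia.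
by rewrite take_oversize // size_drop; lia.
Qed.

Lemma PT_rec k a s g : PT k a -> PT k.+2 s -> PT k g -> small k g ->
  (exists c, forall v i, size v = k -> i <= g v ->
     bitlen (iteri i (fun j h => s [:: j, h & v]) (a v)) <= (tsize v).+2 ^ c) ->
  PT k (fun v => iteri (g v) (fun j h => s [:: j, h & v]) (a v)).
Proof.
move=> Ha Hs Hg [d gsmall] [b bound]; have [e gsize] := small_bitlen Hg.
pose gs := [:: (fun w => nth 0 w 0 - 1); (fun w => (nth 0 w 1).+1);
   (fun w => s (behead w))] ++ [seq (fun w : seq nat => nth 0 w j) | j <- iota 3 k].
pose inits := [:: g; (fun=> 0); a] ++ [seq (fun w : seq nat => nth 0 w j) | j <- iota 0 k].
(* Countdown, index, accumulator and parameters; the countdown is the loop flag. *)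
pose st c v i := [:: c - i, i, iteri i (fun j h => s [:: j, h & v]) (a v) & v].
have initE v : size v = k -> [seq f v | f <- inits] = st (g v) v 0.
  by move=> sv; rewrite /inits map_cat map_vars ?add0n // drop0 /st subn0.
have stepE v c i : size v = k -> i <= c ->
    iter i (wstep (fun w => [seq f w | f <- gs])) (st c v 0) = st c v i.
  move=> sv; elim: i => // i IH le; rewrite iterS IH ?(ltnW le) // /wstep /=.
  rewrite subn_eq0 leqNgt le /= map_vars /= ?sv //.
  by rewrite /st -subnDA addn1 drop0.
have Hgs : PTs k.+3 gs.
  apply: PTs_cat; last by apply: PTs_vars; lia.
  split; first by apply: PT_sub; [apply: PT_var | apply: PT_const].
  split; first by apply: PT_S; apply: PT_var.
  by split=> //; apply: (PT_behead Hs).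
have Hinits : PTs k inits.
  apply: PTs_cat; last by apply: PTs_vars; lia.
  by split=> //; split=> //; apply: PT_const.
apply: (PT_ext _ (@PT_while k k.+2 inits gs g (fun x => x.+2 ^ d)
   (fun x => x.+2 ^ e + x.+2 ^ e + x.+2 ^ b + 3 + x) 2 Hinits _ Hgs _ _ _ _ _ _ _)).
- by move=> v sv; rewrite initE // stepE.
- by rewrite size_cat size_map size_iota.
- by rewrite size_cat size_map size_iota.
- by [].
- by polytac.
- by polytac.
- by [].
- by move=> v sv; rewrite initE // stepE //= subnn.
- move=> v i sv le; rewrite initE // stepE // !tsize_cons.
  have := bound v i sv le; have := gsize v sv.
  have := leq_bitlen le; have := leq_bitlen (leq_subr i (g v)).
  by move: (_ ^ e) (_ ^ b) => E' B'; lia.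
Qed.

Lemma bitlen_leq n : bitlen n <= n.
Proof. by rewrite bitlen_ltP ltn_expl. Qed.

Lemma PT_bitlen k f : PT k f -> PT k (fun v => bitlen (f v)).
Proof.
move=> Hf; suff H : PT 1 (fun v => bitlen (nth 0 v 0)) by exact: (PT_comp1 H Hf).
pose gs : seq (seq nat -> nat) := [:: fun v => (nth 0 v 0)./2; fun v => (nth 0 v 1).+1].
have stepE i x n : i <= bitlen x -> exists x', bitlen x' = bitlen x - i /\
    iter i (wstep (fun w => [seq f w | f <- gs])) [:: x; n] = [:: x'; n + i].
  elim: i x n => [|i IH] x n le; first by exists x; rewrite subn0 addn0.
  case: (posnP x) le => [->//|x0]; rewrite bitlen_half // => le.
  have [x' [E1 E2]] := IH x./2 n.+1 le; exists x'; split; first by rewrite E1; lia.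
  by rewrite iterSr {2}/wstep /= eqn0Ngt x0 E2 addSnnS.
apply: (PT_ext _ (@PT_while 1 1 [:: fun v => nth 0 v 0; fun=> 0] gs
  (fun v => bitlen (nth 0 v 0)) id (fun x => x + x + 2) 1 _ _ _ _ _ _ _ _ _ _)) => //.
- move=> v _ /=; have [x' [_ ->]] := stepE (bitlen (nth 0 v 0)) (nth 0 v 0) 0 (leqnn _).
  by rewrite /= add0n.
- by split; [apply: PT_var | split=> //; apply: PT_const].
- by split; [apply: PT_half; apply: PT_var | split=> //; apply: PT_S; apply: PT_var].
- exact: poly_id.
- by polytac.
- by move=> v _; apply: bitlen_nth.
- move=> v _ /=; have [x' [+ ->]] := stepE (bitlen (nth 0 v 0)) (nth 0 v 0) 0 (leqnn _).
  by rewrite subnn; have := bitlen_half; case: (posnP x') => // x0 /(_ _ x0) ->.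
- move=> v i _ /= le; have [x' [h ->]] := stepE i (nth 0 v 0) 0 le.
  rewrite !tsize_cons /= tsize_nil add0n h.
  by have := bitlen_nth v 0; have := bitlen_leq i; lia.
Qed.

Lemma iter_half n x : iteri n (fun _ h => h./2) x = x %/ 2 ^ n.
Proof. by elim: n => [|n /= ->]; rewrite ?divn1 // -divn2 -divnMA -expnSr. Qed.

Lemma PT_shr k f g : PT k f -> PT k g -> PT k (fun v => f v %/ 2 ^ g v).
Proof.
move=> Hf Hg; suff H : PT 2 (fun v => nth 0 v 0 %/ 2 ^ nth 0 v 1).
  exact: (PT_comp2 H Hf Hg).
have V i : i < 2 -> PT 2 (fun v => nth 0 v i) by apply: PT_var.
(* The shift itself may be exponentially large, but halving as often as there are bits already gives
   0. *)
have Hm : PT 2 (fun v => minn (nth 0 v 1) (bitlen (nth 0 v 0))).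
  by apply: PT_min; [apply: V | apply: PT_bitlen; apply: V].
have Hh : PT 4 (fun w => (nth 0 w 1)./2) by apply: PT_half; apply: PT_var.
apply: PT_ext (PT_rec (V 0 isT) Hh Hm _ _) => [v _||].
- rewrite iter_half; case: leqP => // /ltnW le; rewrite !divn_small //.
    by rewrite -bitlen_ltP.
  exact: ltn_bitlen.
- apply: (@small_poly _ id); first exact: poly_id.
  by move=> v _; apply: leq_trans (geq_minr _ _) (bitlen_nth v 0).
- exists 1 => v i _ _; rewrite iter_half expn1.
  have := leq_bitlen (leq_div (nth 0 v 0) (2 ^ i)); have := bitlen_nth v 0; lia.
Qed.

Lemma PT_subst1 k s x : PT k.+1 s -> PT k.+1 x -> PT k.+1 (fun w => s (x w :: behead w)).
Proof.
move=> Hs Hx; pose gs := x :: [seq (fun w : seq nat => nth 0 w j) | j <- iota 1 k].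
apply: (PT_ext _ (PT_comp (gs := gs) Hs _ _)).
- by move=> v sv /=; rewrite map_vars ?sv // drop1.
- by rewrite /= size_map size_iota.
- by split=> //; apply: PTs_vars.
Qed.

(** Bounded recursion on notation, run from the top bits downwards: round [j] deals with the number
    formed by the [j + 1] leading bits of [f v]. *)
Lemma PT_notation_rec k (H : nat -> seq nat -> nat) f a s :
  PT k f -> PT k a -> PT k.+2 s ->
  (forall v, size v = k -> H 0 v = a v) ->
  (forall x v, size v = k -> 0 < x -> H x v = s [:: x, H x./2 v & v]) ->
  (exists c, forall v x, size v = k -> x <= f v -> bitlen (H x v) <= (tsize v).+2 ^ c) ->
  PT k (fun v => H (f v) v).
Proof.
move=> Hf Ha Hs H0 H1 [c bound].
pose x w := f (behead (behead w)) %/ 2 ^ (bitlen (f (behead (behead w))) - (nth 0 w 0).+1).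
have Hx : PT k.+2 x.
  have Hf2 : PT k.+2 (fun w => f (behead (behead w))) by exact: (PT_behead (PT_behead Hf)).
  apply: PT_shr => //; apply: PT_sub; first exact: PT_bitlen.
  by apply: PT_S; apply: PT_var.
have E v i : size v = k -> i <= bitlen (f v) ->
  iteri i (fun j h => s [:: x [:: j, h & v], h & v]) (a v) =
    H (f v %/ 2 ^ (bitlen (f v) - i)) v.
  move=> sv; elim: i => [|i IH] le /=.
    by rewrite subn0 divn_small ?ltn_bitlen // H0.
  rewrite IH ?(ltnW le) // /x /= [in RHS]H1 //.
    congr (s [:: _, H _ _ & _]); rewrite -divn2 -divnMA -expnSr; congr (_ %/ 2 ^ _).
    by lia.
  rewrite divn_gt0 ?expn_gt0 //.
  have f0 : 0 < f v by case: (f v) le.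
  by apply: leq_trans (bitlen_exp f0); rewrite leq_exp2l //; lia.
apply: PT_ext (PT_rec Ha (PT_subst1 Hs Hx) (PT_bitlen Hf) (small_bitlen Hf) _).
- by move=> v sv /=; rewrite E // subnn divn1.
- by exists c => v i sv le; rewrite /= E //; apply: bound => //; apply: leq_div.
Qed.

Lemma bitlen_mul x y : bitlen (x * y) <= bitlen x + bitlen y.
Proof.
rewrite bitlen_ltP expnD; have := ltn_bitlen x; have := ltn_bitlen y.
by case: (posnP y) => [->|y0] *; [rewrite muln0 muln_gt0 !expn_gt0 | apply: ltn_mul].
Qed.

Lemma PT_mul k f g : PT k f -> PT k g -> PT k (fun v => f v * g v).
Proof.
move=> Hf Hg; suff H : PT 2 (fun v => nth 0 v 0 * nth 0 v 1) by exact: (PT_comp2 H Hf Hg).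
have V i : i < 4 -> PT 4 (fun v => nth 0 v i) by apply: PT_var.
pose s w := (if odd (nth 0 w 0) then nth 0 w 3 else 0) + (nth 0 w 1).*2.
have Hs : PT 4 s.
  apply: PT_add; first by apply: PT_odd; [apply: V | apply: PT_const | apply: V].
  by apply: PT_ext (PT_push false (V 1 isT)).
apply: (@PT_notation_rec 2 (fun x v => x * nth 0 v 1) _ (fun=> 0) s) => //.
- exact: PT_var.
- exact: PT_const.
- move=> x v _ x0; rewrite /s /= {1}(odd_halfE x) mulnDl doubleMl.
  by case: (odd x); rewrite ?mul1n.
- exists 2 => v x sv le.
  apply: leq_trans (bitlen_mul _ _) _; have := leq_bitlen le.
  by have := bitlen_nth v 0; have := bitlen_nth v 1; rewrite expnS expn1; nia.
Qed.

Lemma PT_mod k f g : PT k f -> PT k g -> PT k (fun v => f v %% g v).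
Proof.
move=> Hf Hg; suff H : PT 2 (fun v => nth 0 v 0 %% nth 0 v 1) by exact: (PT_comp2 H Hf Hg).
have V i : i < 4 -> PT 4 (fun v => nth 0 v i) by apply: PT_var.
pose r w := odd (nth 0 w 0) + (nth 0 w 1).*2.
pose s w := if r w < nth 0 w 3 then r w else r w - nth 0 w 3.
have Hr : PT 4 r by apply: PT_push_odd; apply: V.
have Hs : PT 4 s.
  apply: PT_ite => //; first by apply: PT_ltn => //; apply: V.
  by apply: PT_sub => //; apply: V.
apply: (@PT_notation_rec 2 (fun x v => x %% nth 0 v 1) _ (fun=> 0) s) => //.
- exact: PT_var.
- exact: PT_const.
- by move=> v _; rewrite mod0n.
- move=> x v _ x0; rewrite /s /r /=; move: (nth 0 v 1) => y.
  have [->|y0] := posnP y; first by rewrite !modn0 subn0 -odd_halfE.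
  have lt := ltn_pmod x./2 y0.
  rewrite {1}(odd_halfE x) {1}(divn_eq x./2 y) doubleD doubleMl addnCA.
  rewrite modnMDl; case: ltnP => le; first by rewrite modn_small.
  rewrite -[in LHS](subnK le) modnDr modn_small //.
  by move: lt le; case: (odd x) => /=; lia.
- exists 1 => v x sv le; apply: leq_trans (leq_bitlen (leq_mod _ _)) _.
  by apply: leq_trans (leq_bitlen le) _; rewrite expn1; have := bitlen_nth v 0; lia.
Qed.

(** Long division. The remainder of the prefix is recomputed in every round with [PT_mod], so the
    recursion carries the quotient only. *)
Lemma PT_div k f g : PT k f -> PT k g -> PT k (fun v => f v %/ g v).
Proof.
move=> Hf Hg; suff H : PT 2 (fun v => nth 0 v 0 %/ nth 0 v 1) by exact: (PT_comp2 H Hf Hg).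
have V i : i < 4 -> PT 4 (fun v => nth 0 v i) by apply: PT_var.
pose r w := odd (nth 0 w 0) + ((nth 0 w 0)./2 %% nth 0 w 3).*2.
pose b w := (0 < nth 0 w 3) && (nth 0 w 3 <= r w).
pose s w := b w + (nth 0 w 1).*2.
have Hr : PT 4 r.
  apply: PT_push_odd; first exact: V.
  by apply: PT_mod; [apply: PT_half|]; apply: V.
have Hs : PT 4 s.
  have Hb : PT 4 (fun w => nat_of_bool (b w)).
    apply: PT_and; first by apply: PT_ltn; [apply: PT_const | apply: V].
    by apply: PT_leq => //; apply: V.
  apply: PT_ext (PT_push_odd Hb (V 1 isT)) => v _.
  by rewrite /s; case: (b v).
apply: (@PT_notation_rec 2 (fun x v => x %/ nth 0 v 1) _ (fun=> 0) s) => //.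
- exact: PT_var.
- exact: PT_const.
- by move=> v _; rewrite div0n.
- move=> x v _ x0; rewrite /s /b /r /=; move: (nth 0 v 1) => y.
  have [->|y0] := posnP y; first by rewrite !divn0.
  have lt := ltn_pmod x./2 y0.
  rewrite {1}(odd_halfE x) {1}(divn_eq x./2 y) doubleD doubleMl addnCA.
  rewrite divnMDl // addnC; congr (_ + _); case: leqP => le; last by rewrite divn_small.
  rewrite -[in LHS](subnK le) divnDr // divnn y0 divn_small //.
  by move: lt le; case: (odd x) => /=; lia.
- exists 1 => v x sv le; apply: leq_trans (leq_bitlen (leq_div _ _)) _.
  by apply: leq_trans (leq_bitlen le) _; rewrite expn1; have := bitlen_nth v 0; lia.
Qed.

Lemma PT_exp k f g : PT k f -> PT k g -> small k g -> PT k (fun v => f v ^ g v).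
Proof.
move=> Hf Hg gs.
have Hs : PT k.+2 (fun w => nth 0 w 1 * f (behead (behead w))).
  by apply: PT_mul; [apply: PT_var | exact: (PT_behead (PT_behead Hf))].
have E i v : iteri i (fun _ h => h * f v) 1 = f v ^ i.
  by elim: i => //= i ->; rewrite expnSr.
apply: PT_ext (PT_rec (PT_const k 1) Hs Hg gs _) => [v _|].
  exact: E.
have [a Ha] := small_add (small_const k 1) (small_mul gs (small_bitlen Hf)).
exists a => v i sv le; rewrite /= E; apply: leq_trans (Ha v sv).
apply: (@leq_trans (1 + i * bitlen (f v))); last by rewrite leq_add2l leq_mul2r le orbT.
elim: (i) => [|j IH]; first by rewrite expn0 mul0n.
by rewrite expnS mulSn; apply: leq_trans (bitlen_mul _ _) _; lia.
Qed.

Lemma PT_sum k f g : PT k.+1 f -> PT k g -> small k g ->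
  PT k (fun v => \sum_(i < g v) f (val i :: v)).
Proof.
move=> Hf Hg [d gs].
pose s w := nth 0 w 1 + f (nth 0 w 0 :: behead (behead w)).
have Hs : PT k.+2 s.
  apply: PT_add; first exact: PT_var.
  pose hs := [seq (fun w : seq nat => nth 0 w j) | j <- 0 :: iota 2 k].
  apply: (PT_ext _ (PT_comp (gs := hs) Hf _ _)).
  - move=> v sv /=; rewrite map_vars ?sv //.
    by case: (v) => [|x [|y w]] //=; rewrite drop0.
  - by rewrite /= size_map size_iota.
  - by split; [apply: PT_var | apply: PTs_vars].
have E i v : iteri i (fun j h => s [:: j, h & v]) 0 = \sum_(j < i) f (val j :: v).
  by elim: i => [|i /= ->]; rewrite ?big_ord0 // big_ord_recr.
apply: PT_ext (PT_rec (PT_const k 0) Hs Hg _ _) => [v _||].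
- exact: E.
- by exists d.
have [b Hb] := PT_size Hf.
have polyB : poly (fun x => x.+2 ^ d + (x.+2 ^ d + x.+1).+2 ^ b) by polytac.
have [a Ha] := polyB; exists a => v i sv le; rewrite E; apply: leq_trans (Ha _).
(* Bounds the bit length of every summand: the index is at most [g v], and its bit length is at most
   its value. *)
set C := (_ + (tsize v).+1).+2 ^ b.
have fb j : j < i -> f (j :: v) < 2 ^ C.
  move=> ji; rewrite -bitlen_ltP; apply: leq_trans (Hb _ _) _; first by rewrite /= sv.
  apply: leq_tsize_exp; rewrite tsize_cons leq_add2r.
  by apply: leq_trans (bitlen_leq _) _; apply: leq_trans (gs v sv); lia.
rewrite bitlen_ltP expnD.
apply: (@leq_ltn_trans (i * 2 ^ C)).
  rewrite -[i in i * _]card_ord -sum_nat_const; apply: leq_sum => j _.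
  exact: ltnW (fb _ (ltn_ord j)).
rewrite ltn_pmul2r ?expn_gt0 //; apply: leq_ltn_trans (leq_trans le (gs v sv)) _.
exact: ltn_expl.
Qed.

(** If [b <= a], then [2 * (b * (a %% b)) <= a * b], so each Euclidean step at least halves the
    product of the pair. The first step establishes the order and leaves two numbers at most
    [nth 0 v 1], which explains [M]. *)
Lemma PT_gcd k f g : PT k f -> PT k g -> PT k (fun v => gcdn (f v) (g v)).
Proof.
move=> Hf Hg; suff H : PT 2 (fun v => gcdn (nth 0 v 0) (nth 0 v 1)) by exact: (PT_comp2 H Hf Hg).
have V i : i < 2 -> PT 2 (fun v => nth 0 v i) by apply: PT_var.
pose gs := [:: fun v => nth 0 v 1 %% nth 0 v 0; fun v => nth 0 v 0].
pose S := wstep (fun w => [seq h w | h <- gs]).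
pose M v := (bitlen (nth 0 v 1) + bitlen (nth 0 v 1)).+1.
have SE a b : 0 < b -> S [:: b; a] = [:: a %% b; b].
  by move=> b0; rewrite /S /wstep /= eqn0Ngt b0.
have stop m a b : b <= a -> bitlen (a * b) <= m -> head 0 (iter m S [:: b; a]) = 0.
  elim: m a b => [|m IH] a b ba.
    by rewrite bitlen_ltP ltnS leqn0 muln_eq0 => /orP[] /eqP h; move: ba; rewrite h //= leqn0 => /eqP ->.
  case: (posnP b) => [-> _|b0 le]; first by rewrite wstep_stable.
  rewrite iterSr SE //; apply: IH; first by rewrite ltnW // ltn_pmod.
  rewrite bitlen_ltP; move: le; rewrite bitlen_ltP expnS.
  have lt := ltn_pmod a b0.
  have : 2 * (b * (a %% b)) <= a * b.
    rewrite mulnCA mulnC leq_mul2r; apply/orP; right.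
    rewrite {2}(divn_eq a b); have : 0 < a %/ b by rewrite divn_gt0.
    by nia.
  by lia.
have stop' v : size v = 2 -> head 0 (iter (M v) S [:: nth 0 v 1; nth 0 v 0]) = 0.
  move=> _; rewrite /M; move: (nth 0 v 0) (nth 0 v 1) => a b.
  case: (posnP b) => [->|b0]; first by rewrite wstep_stable.
  rewrite iterSr SE //; apply: stop; first by rewrite ltnW // ltn_pmod.
  apply: leq_trans (bitlen_mul _ _) _; rewrite leq_add2l.
  by apply: leq_bitlen; rewrite ltnW // ltn_pmod.
have inv (P : nat -> nat -> Prop) a b i : P a b ->
    (forall c d, 0 < d -> P c d -> P d (c %% d)) ->
    exists c d, iter i S [:: b; a] = [:: d; c] /\ P c d.
  move=> Pab HP; apply: (@wstep_inv (fun w => exists c d, w = [:: d; c] /\ P c d)).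
    move=> _ [c [d [-> Pcd]]] /=; rewrite -lt0n => d0.
    by exists d, (c %% d); split => //; apply: HP.
  by exists a, b.
apply: (PT_ext _ (@PT_while 2 1 [:: fun v => nth 0 v 1; fun v => nth 0 v 0] gs M
  (fun x => (x + x).+1) (fun x => x + x + x + x + 2) 1 _ _ _ _ _ _ _ _ _ _)) => //.
- move=> v sv; rewrite -[LHS]/(nth 0 (iter (M v) S [:: nth 0 v 1; nth 0 v 0]) 1).
  have := stop' v sv; have [||c [d [-> <-]]] := @inv (fun c d => gcdn c d = gcdn (nth 0 v 0) (nth 0 v 1))
      (nth 0 v 0) (nth 0 v 1) (M v).
  - by [].
  - by move=> c d d0 <-; rewrite gcdn_modr gcdnC.
  by move=> /= ->; rewrite gcdn0.
- by split; [apply: V | split=> //; apply: V].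
- by split; [apply: PT_mod; apply: V | split=> //; apply: V].
- by polytac.
- by polytac.
- by move=> v _; rewrite /M; have := bitlen_nth v 1; lia.
- move=> v i _ _; set x := nth 0 v 0; set y := nth 0 v 1.
  rewrite -[iter _ _ _]/(iter i S [:: y; x]).
  have [||c [d [-> [cm dm]]]] := @inv (fun c d => bitlen c <= bitlen x + bitlen y /\
    bitlen d <= bitlen x + bitlen y) x y i.
  - by split; lia.
  - move=> c d d0 [H1 H2]; split => //; apply: leq_trans H1.
    by apply: leq_bitlen; apply: leq_mod.
  rewrite !tsize_cons tsize_nil.
  by have := bitlen_nth v 0; have := bitlen_nth v 1; rewrite -/x -/y; lia.
Qed.

(** * Replacing quantifiers by guessed bits *)

Import Order.TTheory GRing.Theory Num.Theory.

Section Syntax.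
Variables (p : nat) (ar : 'I_p -> nat).
Notation form := (fo2form ar).

Lemma eval_fv n (w : world ar n) (f : form) env env' :
  (forall u, u \in fv f -> env u = env' u) -> eval w env f = eval w env' f.
Proof.
elim: f env env' => [R args|u v|f IH|f IHf g IHg|v f IH] env env' H /=.
- apply: eq_existsb => t; congr (_ && _); apply: eq_forallb => i.
  by rewrite H //=; apply/mapP; exists i; rewrite ?mem_enum.
- by rewrite !H //= !inE eqxx ?orbT.
- by rewrite (IH env env').
- by rewrite (IHf env env') ?(IHg env env') // => u uf; apply: H; rewrite /= mem_cat uf ?orbT.
- apply: eq_existsb => d; apply: IH => u uf; case: eqP => // /eqP uv.
  by apply: H; rewrite /= mem_filter uv.
Qed.

Lemma eval_ext n (w : world ar n) (f : form) env env' :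
  env =1 env' -> eval w env f = eval w env' f.
Proof. by move=> H; apply: eval_fv => u _. Qed.

Lemma models_eval n (w : world ar n) (f : form) env :
  is_sentence f -> models w f = eval w env f.
Proof. by move=> /nilP s; apply: eval_fv; rewrite s. Qed.

(** Atoms over the two variables. Under an assignment, a quantifier-free formula sees of a world
    only the set [loc] of those that hold. *)
Definition satom : finType := {R : 'I_p & {ffun 'I_(ar R) -> bool}}.
Definition mksat (R : 'I_p) (t : {ffun 'I_(ar R) -> bool}) : satom :=
  @Tagged 'I_p R (fun R => {ffun 'I_(ar R) -> bool}) t.

Definition emb n (e : bool -> 'I_n) (s : satom) : gatom ar n :=
  mkatom [ffun i => e (tagged s i)].
Definition loc n (w : world ar n) (e : bool -> 'I_n) : {set satom} :=
  [set s | emb e s \in w].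

(* Subformulas [exists v, f] are numbered in prefix order; in [ev] the k-th one
   is replaced by the guessed bit [g u k] of the element bound to its free
   variable u. *)
Fixpoint nodes (f : form) : seq (bool * form) :=
  match f with
  | FAtom _ _ | FEq _ _ => [::]
  | FNot g => nodes g
  | FAnd g h => nodes g ++ nodes h
  | FEx v g => (v, g) :: nodes g
  end.

Fixpoint ev (L : {set satom}) (eq : bool) (g : bool -> nat -> bool) (k : nat)
    (f : form) : bool :=
  match f with
  | FAtom R args => mksat [ffun i => args i] \in L
  | FEq u v => (u == v) || eq
  | FNot f => ~~ ev L eq g k f
  | FAnd f h => ev L eq g k f && ev L eq g (k + size (nodes f)) h
  | FEx v _ => g (~~ v) k
  end.

Lemma ev_ext L eq g g' k f : (forall u, g u =1 g' u) -> ev L eq g k f = ev L eq g' k f.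
Proof.
move=> H; elim: f k => //= [f IH|f IHf h IHh|v f _] k; first by rewrite IH.
  by rewrite IHf IHh.
exact: H.
Qed.

Definition pair_env A (x y : A) (u : bool) : A := if u then y else x.
Definition upd_env A (v : bool) (a d : A) : bool -> A := if v then pair_env a d else pair_env d a.

Variable Gamma : form.

Definition node (k : nat) : bool * form := nth (false, Gamma) (nodes Gamma) k.
Definition nnode := size (nodes Gamma).

(** An occurrence rather than a formula: equal subformulas at different places have different
    numbers. *)
Definition subform (k : nat) (f : form) :=
  exists pre post, nodes Gamma = pre ++ nodes f ++ post /\ size pre = k.

Lemma sub_node k : k < nnode -> subform k.+1 (node k).2.
Proof.
rewrite /subform /node /nnode; move: (false, Gamma) => d; move: Gamma => h.
elim: h k => //= [f IHf h IHh|v f IH] k lt.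
- rewrite nth_cat; case: ltnP => kf.
    have [pre [post [E sp]]] := IHf k kf; exists pre, (post ++ nodes h).
    by rewrite {1}E -!catA.
  have [|pre [post [E sp]]] := IHh (k - size (nodes f)).
    by move: lt; rewrite size_cat; lia.
  by exists (nodes f ++ pre), post; rewrite {1}E -!catA size_cat sp; split => //; lia.
- case: k lt => [|k] lt /=; first by exists [:: (v, f)], [::]; rewrite cats0.
  have [pre [post [E sp]]] := IH k lt; exists ((v, f) :: pre), post.
  by rewrite {1}E /= sp.
Qed.

Lemma sub_top : subform 0 Gamma.
Proof. by exists [::], [::]; rewrite cats0. Qed.

Section World.
Variables (n : nat) (w : world ar n).

Definition truth (a : 'I_n) (k : nat) : bool :=
  eval w (fun _ => Some a) (FEx (node k).1 (node k).2).

Definition witness (G : 'I_n -> nat -> bool) (k : nat) (a d : 'I_n) : bool :=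
  let e := upd_env (node k).1 a d in
  ev (loc w e) (e false == e true) (fun u => G (e u)) k.+1 (node k).2.

Lemma eval_exE v f (e : bool -> option 'I_n) a : e (~~ v) = Some a ->
  eval w e (FEx v f) = [exists d, eval w (fun u => Some (upd_env v a d u)) f].
Proof.
move=> ea; apply: eq_existsb => d; apply: eval_ext => u.
by move: ea; rewrite /upd_env /pair_env; case: v; case: u => //= ->.
Qed.

(** One induction serves both assumptions on the guess. At a quantifier, a guess equal to the truth
    value closes the case; a guess that agrees with its own witnesses is unfolded, and the induction
    hypothesis applies to the body. *)
Lemma eval_evP G : (forall k a, k < nnode -> 
     G a k = eval w (fun _ => Some a) (FEx (node k).1 (node k).2)) \/
   (forall k a, k < nnode -> G a k = [exists d, witness G k a d]) ->
  forall f k e, subform k f ->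
  eval w (fun u => Some (e u)) f = ev (loc w e) (e false == e true) (fun u => G (e u)) k f.
Proof.
move=> HG; elim=> [R args|u v|f IH|f IHf h IHh|v f IH] k e sf.
- rewrite /= inE /emb /=; apply/existsP/idP => [[t /andP[/forallP H tw]]|H].
    have -> : [ffun i => e ([ffun i0 => args i0] i)] = t :> {ffun _ -> _}; last by [].
    by apply/ffunP => i; rewrite !ffunE; have /eqP[->] := H i.
  exists [ffun i => e (args i)]; apply/andP; split.
    by apply/forallP => i; rewrite ffunE.
  by move: H; congr (mkatom _ \in w); apply/ffunP => i; rewrite !ffunE.
- by case: u {sf}; case: v; rewrite /= ?eqxx // eq_sym.
- by rewrite /= (IH k).
- have [pre [post [E sp]]] := sf; rewrite /= in E.
  rewrite /= (IHf k) ?(IHh (k + size (nodes f))) //.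
    by exists (pre ++ nodes f), post; rewrite E size_cat sp -!catA.
  by exists pre, (nodes h ++ post); rewrite E -!catA.
- have [pre [post [E sp]]] := sf; rewrite /= in E.
  have Ek : node k = (v, f) by rewrite /node E nth_cat sp ltnn subnn.
  have kn : k < nnode by rewrite /nnode E size_cat /= size_cat sp; lia.
  rewrite (@eval_exE _ _ _ (e (~~ v))) //=.
  case: HG => HG; rewrite HG //.
    by rewrite Ek (@eval_exE _ _ (fun _ => Some (e (~~ v))) (e (~~ v))).
  apply: eq_existsb => d; rewrite /witness Ek (IH k.+1) //.
  by exists (rcons pre (v, f)), post; rewrite E size_rcons sp cat_rcons.
Qed.

Lemma truth_witness G : (forall k a, k < nnode -> G a k = truth a k) ->
  forall k a, k < nnode -> G a k = [exists d, witness G k a d].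
Proof.
move=> H k a kn; rewrite H // /truth (@eval_exE _ _ _ a) //; apply: eq_existsb => d.
by apply: eval_evP (sub_node kn); left.
Qed.

(** Uniqueness of the consistent guess: nested quantifiers are resolved from the inside out. This is
    what makes the later sum over guesses count each model once. *)
Lemma witness_truth G : (forall k a, k < nnode -> G a k = [exists d, witness G k a d]) ->
  forall k a, k < nnode -> G a k = truth a k.
Proof.
move=> H k a kn; rewrite H // /truth (@eval_exE _ _ _ a) //; apply: eq_existsb => d.
by rewrite (eval_evP (or_intror H) _ (sub_node kn)).
Qed.

Lemma eval_truth G a : (forall k a, k < nnode -> G a k = truth a k) ->
  eval w (fun _ => Some a) Gamma = ev (loc w (pair_env a a)) true (fun _ => G a) 0 Gamma.
Proof.
move=> H; transitivity (eval w (fun u => Some (pair_env a a u)) Gamma).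
  by apply: eval_ext => -[].
rewrite (eval_evP (G := G) _ _ sub_top); last by left.
by rewrite /= eqxx; apply: ev_ext => -[].
Qed.

End World.
End Syntax.

(** * Sums over worlds *)

Lemma big_option (T : Type) (idx : T) (op : Monoid.com_law idx) (X : finType)
    (F : option X -> T) :
  \big[op/idx]_j F j = op (F None) (\big[op/idx]_x F (Some x)).
Proof.
rewrite (bigD1 None) //=; congr (op _ _).
rewrite (reindex_omap Some id) /=; last by case.
by apply: eq_bigl => x; rewrite eqxx.
Qed.

Lemma big_ord_pairs (T : Type) (idx : T) (op : Monoid.com_law idx) n
    (f : 'I_n -> 'I_n -> T) :
  \big[op/idx]_x \big[op/idx]_y f x y = op (\big[op/idx]_x f x x)
    (\big[op/idx]_(xy : 'I_n * 'I_n | (xy.1 < xy.2)%N) op (f xy.1 xy.2) (f xy.2 xy.1)).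
Proof.
rewrite pair_big /= (bigID (fun xy : 'I_n * 'I_n => xy.1 == xy.2)) /=; congr (op _ _).
  rewrite (reindex_onto (fun t => (t, t)) fst) /=; last by move=> [t t'] /eqP /= ->.
  by apply: eq_bigl => t; rewrite !eqxx.
rewrite (bigID (fun xy : 'I_n * 'I_n => (xy.1 < xy.2)%N)) big_split /=; congr (op _ _).
  by apply: eq_bigl => -[x y] /=; rewrite -val_eqE /=; case: ltngtP.
rewrite (reindex_onto (fun xy => (xy.2, xy.1)) (fun xy => (xy.2, xy.1))) /=; last by case.
by apply: eq_bigl => -[x y] /=; rewrite eqxx -val_eqE /=; case: ltngtP.
Qed.

(** * Identities for sums and products in a commutative ring *)

Section Generic.
Local Open Scope ring_scope.
Variable R : comNzRingType.

(** Coefficients of inclusion-exclusion: [s] selects the term requiring that no witness exists. The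
    guess [false] is that term, the guess [true] is 1 minus it. *)
Definition kappa (b s : bool) : R := if b then (if s then -1 else 1) else (s%:R).

Lemma natr_bool_all (I : finType) (P : pred I) :
  \prod_i (P i)%:R = [forall i, P i]%:R :> R.
Proof.
case: forallP => [H|/forallP]; first by apply: big1 => i _; rewrite H.
by rewrite negb_forall => /existsP[i /negbTE Pi]; rewrite (bigD1 i) //= Pi mul0r.
Qed.

Lemma natr_andb (b c : bool) : (b && c)%:R = b%:R * c%:R :> R.
Proof. by case: b; case: c; rewrite ?mulr1 ?mulr0 ?mul0r. Qed.

Lemma kappa_exists (I : finType) (b : bool) (P : pred I) :
  (b == [exists i, P i])%:R = \sum_(s : bool) kappa b s * \prod_i (s ==> ~~ P i)%:R.
Proof.
rewrite big_bool !natr_bool_all /=.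
have -> : [forall i : I, true] by apply/forallP.
rewrite -negb_exists; case: existsP => _; case: b; rewrite /kappa /=;
  by rewrite ?mulr1 ?mulr0 ?mul0r ?mul1r ?addr0 ?add0r ?addNr.
Qed.

Lemma sum_ffun_pair (I A B : finType) (F : {ffun I -> A * B} -> R) :
  \sum_f F f = \sum_(g : {ffun I -> A}) \sum_(h : {ffun I -> B}) F [ffun i => (g i, h i)].
Proof.
rewrite pair_big /=.
rewrite (reindex (fun gh : {ffun I -> A} * {ffun I -> B} => [ffun i => (gh.1 i, gh.2 i)])) //.
exists (fun f : {ffun I -> A * B} => ([ffun i => (f i).1], [ffun i => (f i).2])) => [[g h] _|f _] /=.
  by congr pair; apply/ffunP => i; rewrite !ffunE.
by apply/ffunP => i; rewrite !ffunE; case: (f i).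
Qed.

Lemma sum_ffun2 (I K S : finType) (F : I -> K -> S -> R) :
  \sum_(s : {ffun I -> {ffun K -> S}}) \prod_i \prod_k F i k (s i k) =
  \prod_i \prod_k \sum_b F i k b.
Proof.
under [RHS]eq_bigr do rewrite bigA_distr_bigA.
by rewrite bigA_distr_bigA.
Qed.

Lemma sum_ffun_eq (I S : finType) (o : I -> S) :
  \sum_(f : {ffun I -> S}) \prod_i (f i == o i)%:R = 1 :> R.
Proof.
rewrite -(bigA_distr_bigA (fun i b => (b == o i)%:R)) big1 // => i _.
by rewrite (bigD1 (o i)) //= eqxx big1 ?addr0 // => b /negbTE ->.
Qed.

Lemma sum_blocks (A J : finType) (key : A -> J) (phi : J -> {set A} -> R) :
  (forall j w, phi j w = phi j (w :&: [set x | key x == j])) ->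
  \sum_(w : {set A}) \prod_j phi j w =
  \prod_j \sum_(w : {set A} | w \subset [set x | key x == j]) phi j w.
Proof.
move=> Hphi; rewrite bigA_distr_big_dep.
pose h (w : {set A}) := [ffun j => w :&: [set x | key x == j]].
pose h' (f : {ffun J -> {set A}}) := [set x | x \in f (key x)].
rewrite (reindex_onto h h') /=.
  apply: eq_big => [w|w _]; last by apply: eq_bigr => j _; rewrite ffunE -Hphi.
  symmetry; apply/andP; split.
    by apply/familyP => j; rewrite ffunE unfold_in subsetIr.
  by apply/eqP/setP => x; rewrite !inE ffunE !inE eqxx andbT.
move=> f /familyP H; apply/ffunP => j; rewrite ffunE; apply/setP => x; rewrite !inE.
apply/andP/idP => [[xf /eqP <-] //|xf]; have := H j; rewrite unfold_in => /subsetP /(_ x xf).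
by rewrite inE => /eqP kx; rewrite kx.
Qed.

Lemma sum_pick (A : finType) (D P0 : {set A}) (F : {set A} -> R) :
  \sum_(P : {set A} | P \subset D) F P * (P == P0)%:R = F P0 * (P0 \subset D)%:R.
Proof.
have [PD|PD] := boolP (P0 \subset D).
  rewrite (bigD1 P0) //= eqxx big1 ?addr0 // => P /andP[_ /negbTE ->].
  by rewrite mulr0.
rewrite mulr0 big1 // => P PD'; case: eqP => [E|_]; last by rewrite mulr0.
by rewrite -E PD' in PD.
Qed.

(** Used to rename the ground atoms of one block as predicates or symbolic atoms, so that its
    contribution no longer depends on the elements involved. *)
Lemma sum_embed (A A' : finType) (h : A' -> A) (D : {set A'}) (zeta : A -> R)
    (psi : {set A'} -> R) : {in D &, injective h} ->
  \sum_(w : {set A} | w \subset h @: D)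
     (\prod_(x in w) zeta x) * psi [set s in D | h s \in w] =
  \sum_(P : {set A'} | P \subset D) (\prod_(s in P) zeta (h s)) * psi P.
Proof.
move=> inj.
rewrite (reindex_onto (fun P : {set A'} => h @: P)
  (fun w : {set A} => [set s in D | h s \in w])) /=; last first.
  move=> w /subsetP wD; apply/setP => x; apply/imsetP/idP => [[s + ->]|xw].
    by rewrite inE => /andP[].
  have /imsetP[s sD E] := wD x xw; exists s => //.
  by rewrite inE sD -E.
have E (P : {set A'}) : P \subset D -> [set s in D | h s \in h @: P] = P.
  move=> /subsetP PD; apply/setP => s; rewrite inE; apply/andP/idP => [[sD /imsetP[s' sP' E]]|sP].
    by rewrite (inj _ _ sD (PD _ sP') E).
  by split; [apply: PD | apply: imset_f].
apply: eq_big => [P|P /andP[_ /eqP EP]].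
  apply/andP/idP => [[_ /eqP <-]|PD]; first by apply/subsetP => s; rewrite inE => /andP[].
  by rewrite E // imsetS.
rewrite EP; congr (_ * _); rewrite big_imset //.
move=> s s' sP sP'; apply: inj.
  by move: sP; rewrite -EP inE => /andP[].
by move: sP'; rewrite -EP inE => /andP[].
Qed.

Lemma sum_subsets (A : finType) (D : {set A}) (zeta : A -> R) :
  \sum_(w : {set A} | w \subset D) \prod_(x in w) zeta x = \prod_(x in D) (1 + zeta x).
Proof.
rewrite [RHS](eq_bigr (fun x => zeta x + 1)); last by move=> x _; rewrite addrC.
rewrite [RHS]big_mkcond /=.
rewrite [RHS](eq_bigr (fun x => (if x \in D then zeta x else 0) + 1)); last first.
  by move=> x _; case: ifP; rewrite ?add0r.
rewrite bigA_distr /= [LHS]big_mkcond /=; apply: eq_bigr => w _.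
case: ifP => [/subsetP wD|/negbT /subsetPn[x xw xD]].
  rewrite [LHS]big_mkcond /=; apply: eq_bigr => x _.
  by case: ifP => // /wD ->.
by rewrite (bigD1 x) //= xw (negbTE xD) mul0r.
Qed.

Lemma prod_const_card (I : finType) (P : pred I) (x : R) :
  \prod_(i | P i) x = x ^+ #|[set i | P i]|.
Proof. by rewrite -prodr_const; apply: eq_bigl => i; rewrite inE. Qed.

Definition hist (I T : finType) (s : {ffun I -> T}) (t : T) : nat := #|[set a | s a == t]|.

Definition hist_weight (T : finType) (u : T -> R) (r : T -> T -> R) (c : T -> nat) : R :=
  (\prod_t u t ^+ c t) * (\prod_t r t t ^+ 'C(c t, 2)) *
  \prod_(tt : T * T | (enum_rank tt.1 < enum_rank tt.2)%N) r tt.1 tt.2 ^+ (c tt.1 * c tt.2).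

(** Since [r] is symmetric, two distinct types contribute through [e t t' + e t' t], the number of
    pairs consisting of one element of each type. *)
Lemma prod_hist (n : nat) (T : finType) (u : T -> R) (r : T -> T -> R)
    (s : {ffun 'I_n -> T}) : (forall t t', r t t' = r t' t) ->
  (\prod_a u (s a)) * \prod_(xy : 'I_n * 'I_n | (xy.1 < xy.2)%N) r (s xy.1) (s xy.2) =
  hist_weight u r (hist s).
Proof.
move=> rC; rewrite /hist_weight -mulrA; congr (_ * _).
  rewrite (partition_big s xpredT) //=; apply: eq_bigr => t _.
  by rewrite (eq_bigr (fun=> u t)) ?prod_const_card // => a /eqP ->.
pose e t t' := #|[set xy : 'I_n * 'I_n | (xy.1 < xy.2)%N && ((s xy.1, s xy.2) == (t, t'))]|.
have E1 : \prod_(xy : 'I_n * 'I_n | (xy.1 < xy.2)%N) r (s xy.1) (s xy.2) =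
    \prod_(tt : T * T) r tt.1 tt.2 ^+ e tt.1 tt.2.
  rewrite (partition_big (fun xy : 'I_n * 'I_n => (s xy.1, s xy.2)) xpredT) //=.
  apply: eq_bigr => -[t t'] _ /=.
  rewrite (eq_bigr (fun=> r t t')); last by move=> xy /andP[_ /eqP[-> ->]].
  by rewrite prod_const_card.
have swap (P : pred ('I_n * 'I_n)) :
    #|[set xy : 'I_n * 'I_n | P (xy.2, xy.1)]| = #|[set xy | P xy]|.
  rewrite -(card_imset _ (f := fun xy : 'I_n * 'I_n => (xy.2, xy.1))); last first.
    by move=> [a b] [a' b'] /= [-> ->].
  apply: eq_card => -[a b]; apply/imsetP/idP => [[[a' b'] + [-> ->]]|]; rewrite !inE //=.
  by move=> Pab; exists (b, a); rewrite ?inE.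
have cX t t' : #|[set xy : 'I_n * 'I_n | (s xy.1 == t) && (s xy.2 == t')]|
    = (hist s t * hist s t')%N.
  by rewrite /hist -cardsX; apply: eq_card => -[a b]; rewrite !inE.
have E2 t t' : t != t' -> (e t t' + e t' t)%N = (hist s t * hist s t')%N.
  move=> tt'; rewrite -cX -[e t' t]swap /e /=.
  rewrite -cardsUI [X in (_ + X)%N](_ : _ = 0%N) ?addn0; last first.
    apply/eqP; rewrite cards_eq0; apply/eqP/setP => -[a b]; rewrite !inE /=.
    by case: ltngtP; rewrite /= ?andbF.
  apply: eq_card => -[a b]; rewrite !inE /= !xpair_eqE.
  case: (ltngtP a b) => [ab|ab|/val_inj ->] //=; rewrite ?orbF //.
    by rewrite andbC.
  by apply/esym/negbTE; apply: contra tt' => /andP[/eqP <- /eqP <-].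
(* The ordered pairs of elements of type [t] split into increasing, decreasing and diagonal ones. *)
have E3 t : e t t = 'C(hist s t, 2).
  have : (e t t + e t t + hist s t)%N = (hist s t * hist s t)%N.
    rewrite -cX -[X in (_ + X + _)%N]swap /e /hist.
    rewrite -(card_imset _ (f := fun a : 'I_n => (a, a))); last by move=> a b [].
    have D a b : ((a, b) \in [set (c, c) | c in [set c | s c == t]]) = (a == b) && (s a == t).
      apply/imsetP/andP => [[c + [-> ->]]|[/eqP <- sa]]; first by rewrite inE eqxx.
      by exists a; rewrite ?inE.
    rewrite -cardsUI [X in (_ + X + _)%N](_ : _ = 0%N) ?addn0; last first.
      apply/eqP; rewrite cards_eq0; apply/eqP/setP => -[a b]; rewrite !inE /=.
      by case: ltngtP; rewrite /= ?andbF.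
    rewrite -cardsUI [X in (_ + X)%N](_ : _ = 0%N) ?addn0; last first.
      apply/eqP; rewrite cards_eq0; apply/eqP/setP => -[a b]; rewrite !inE D -val_eqE /=.
      by case: ltngtP; rewrite /= ?andbF.
    apply: eq_card => -[a b]; rewrite !inE D -val_eqE /= !xpair_eqE.
    case: (ltngtP a b) => [ab|ab|/val_inj ->] /=; rewrite ?orbF ?andbb //.
    by rewrite andbC.
  by rewrite bin2; move: (e t t) (hist s t) => x [|y]; nia.
rewrite E1 (bigID (fun tt : T * T => tt.1 == tt.2)) /=; congr (_ * _).
  rewrite (reindex_onto (fun t => (t, t)) fst) /=; last by move=> [t t'] /eqP /= ->.
  by apply: eq_big => [t|t _]; rewrite ?eqxx // E3.
rewrite (bigID (fun tt : T * T => (enum_rank tt.1 < enum_rank tt.2)%N)) /=.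
rewrite [X in _ * X](reindex_onto (fun tt => (tt.2, tt.1)) (fun tt => (tt.2, tt.1))) /=; last by case.
rewrite [X in _ * X](eq_big (fun tt : T * T => (tt.1 != tt.2) && (enum_rank tt.1 < enum_rank tt.2)%N)
   (fun tt => r tt.1 tt.2 ^+ e tt.2 tt.1)); last 2 first.
- move=> [t t'] /=; rewrite eqxx andbT eq_sym -(inj_eq enum_rank_inj) -val_eqE /=.
  by case: ltngtP.
- by move=> [t t'] _ /=; rewrite rC.
rewrite -big_split /=; apply: eq_big => [[t t']|[t t'] /andP[/= tt' _]] /=.
  by rewrite -(inj_eq enum_rank_inj) -val_eqE /=; case: ltngtP.
by rewrite -exprD E2.
Qed.
End Generic.

(** * The cell formula *)

Section Cells.
Local Open Scope ring_scope.
Variables (p : nat) (ar : 'I_p -> nat) (Gamma : fo2form ar).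
Notation m := (nnode Gamma).
Notation node := (node Gamma).

Definition bitn (x : {ffun 'I_m -> bool}) (k : nat) : bool :=
  if insub k is Some i then x i else false.

Lemma bitn_ord x (k : 'I_m) : bitn x k = x k.
Proof. by rewrite /bitn valK. Qed.

(* An element type: truth values of the quantified subformulas, the subset of
   them selected by inclusion-exclusion, and the unary atoms. *)
Definition etype : finType :=
  ({ffun 'I_m -> bool} * {ffun 'I_m -> bool} * {set 'I_p})%type.

(** The share of one ordered pair in the inclusion-exclusion conditions: if the element at the free
    variable has selected node [k], the other element must not be a witness for it. *)
Definition ok_pair (t t' : etype) (L : {set satom ar}) (eq : bool) : bool :=
  [forall k : 'I_m, (pair_env t t' (~~ (node k).1)).1.2 k ==>
     ~~ ev L eq (fun u => bitn (pair_env t t' u).1.1) k.+1 (node k).2].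

Definition ok_top (t : etype) (L : {set satom ar}) : bool :=
  ev L true (fun _ => bitn t.1.1) 0 Gamma.

Definition nullary : {set 'I_p} := [set R | ar R == 0%N].
Definition positive : {set 'I_p} := [set R | (0 < ar R)%N].

(** Atoms in which both variables occur. Nullary atoms are excluded too, because for them both
    universal statements hold vacuously. *)
Definition mixed : {set satom ar} :=
  [set s : satom ar | ~~ [forall i, ~~ tagged s i] && ~~ [forall i, tagged s i]].

Definition diag_table (nu pi : {set 'I_p}) : {set satom ar} :=
  [set s : satom ar | if ar (tag s) == 0%N then tag s \in nu else tag s \in pi].

Definition pair_table (nu pi pi' : {set 'I_p}) (P : {set satom ar}) : {set satom ar} :=
  [set s : satom ar | if ar (tag s) == 0%N then tag s \in nu
           else if [forall i, ~~ tagged s i] then tag s \in pi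
           else if [forall i, tagged s i] then tag s \in pi' else s \in P].

Definition swap_satom (s : satom ar) : satom ar := mksat [ffun i => ~~ tagged s i].
Definition swap_set (P : {set satom ar}) : {set satom ar} := [set s : satom ar | swap_satom s \in P].

Definition ok_mixed (nu : {set 'I_p}) (t t' : etype) (P : {set satom ar}) : bool :=
  ok_pair t t' (pair_table nu t.2 t'.2 P) false &&
  ok_pair t' t (pair_table nu t'.2 t.2 (swap_set P)) false.

Definition ok_diag (nu : {set 'I_p}) (t : etype) : bool :=
  [&& ok_top t (diag_table nu t.2), ok_pair t t (diag_table nu t.2) true
    & t.2 \subset positive].

Lemma swapK : involutive swap_satom.
Proof.
case=> R f; rewrite /swap_satom /mksat; congr (Tagged _ _).
by apply/ffunP => i; rewrite !ffunE /= ?ffunE negbK.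
Qed.

Lemma swap_setK : involutive swap_set.
Proof. by move=> P; apply/setP => s; rewrite !inE swapK. Qed.

Lemma mixed_swap s : (swap_satom s \in mixed) = (s \in mixed).
Proof.
rewrite !inE andbC; congr (~~ _ && ~~ _); apply: eq_forallb => i; rewrite /swap_satom /= ffunE //.
exact: negbK.
Qed.

Lemma sum_tag n Q : (\sum_(A : gatom ar n) (tag A == Q) = n ^ ar Q)%N.
Proof.
rewrite (eq_bigr (fun A : gatom ar n => if tag A == Q then 1 else 0)%N); last by move=> A _; case: eqP.
rewrite -big_mkcond sum1_card -[n in RHS]card_ord -[ar Q in RHS]card_ord -card_ffun.
have inj : injective (@mkatom p ar n Q).
  by move=> t t' /eqP; rewrite eq_Tagged => /eqP.
rewrite -(card_imset _ inj); apply: eq_card => -[Q' t]; rewrite [LHS]unfold_in /=.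
apply/eqP/imsetP => [/val_inj E|[t' _ E]].
  by move: t; rewrite E => t; exists t.
exact: (congr1 (fun A : gatom ar n => val (tag A)) E).
Qed.

Section Weights.
Variables (R : comNzRingType) (z : 'I_p -> R).

Definition cell_weight (nu : {set 'I_p}) (t : etype) : R :=
  (\prod_k kappa R (t.1.1 k) (t.1.2 k)) * (\prod_(Q in t.2) z Q) * (ok_diag nu t)%:R.

Definition pair_weight (nu : {set 'I_p}) (t t' : etype) : R :=
  \sum_(P : {set satom ar} | P \subset mixed)
     (\prod_(s in P) z (tag s)) * (ok_mixed nu t t' P)%:R.

Lemma pair_weightC nu t t' : pair_weight nu t t' = pair_weight nu t' t.
Proof.
rewrite /pair_weight (reindex_inj (inv_inj swap_setK)) /=; apply: eq_big => P.
  apply/subsetP/subsetP => H s.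
    by rewrite -mixed_swap => sP; apply: H; rewrite inE swapK.
  by rewrite inE => /H; rewrite mixed_swap.
move=> _; congr (_ * _); last first.
  by rewrite /ok_mixed swap_setK andbC.
rewrite (reindex_inj (inv_inj swapK)) /=; apply: eq_bigl => s.
by rewrite inE swapK.
Qed.

Variable n' : nat.
Notation N := n'.+1.
Notation world := (world ar N).

(** For a nullary [Q] this does not depend on [a], so [ord0] can stand in; this requires a nonempty
    domain. *)
Definition catom (Q : 'I_p) (a : 'I_N) : gatom ar N := mkatom [ffun _ : 'I_(ar Q) => a].
Definition nulltype (w : world) : {set 'I_p} := [set Q in nullary | catom Q ord0 \in w].
Definition onetype (w : world) (a : 'I_N) : {set 'I_p} :=
  [set Q in positive | catom Q a \in w].
Definition twotype (w : world) (x y : 'I_N) : {set satom ar} :=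
  [set s : satom ar in mixed | emb (pair_env x y) s \in w].

Lemma emb_nullary (e : bool -> 'I_N) (s : satom ar) a : ar (tag s) = 0%N -> emb e s = catom (tag s) a.
Proof.
move=> s0; rewrite /emb /catom; congr (mkatom _); apply/ffunP => i.
by exfalso; case: i; rewrite s0.
Qed.

Lemma emb_const (e : bool -> 'I_N) (s : satom ar) b : (forall i, tagged s i = b) ->
  emb e s = catom (tag s) (e b).
Proof. by move=> H; congr (mkatom _); apply/ffunP => i; rewrite !ffunE H. Qed.

Lemma loc_pair (w : world) x y : loc w (pair_env x y) =
  pair_table (nulltype w) (onetype w x) (onetype w y) (twotype w x y).
Proof.
apply/setP => s; rewrite !inE; have [s0|s0] := eqVneq (ar (tag s)) 0%N.
  by rewrite (@emb_nullary _ _ ord0).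
rewrite lt0n s0 /=; case: forallP => [H|/forallP H0].
  by rewrite (@emb_const _ _ false) // => i; apply: negbTE.
by case: forallP => [H|_] //=; rewrite (@emb_const _ _ true).
Qed.

Lemma loc_diag (w : world) a : loc w (pair_env a a) = diag_table (nulltype w) (onetype w a).
Proof.
apply/setP => s; rewrite !inE; have [s0|s0] := eqVneq (ar (tag s)) 0%N.
  by rewrite (@emb_nullary _ _ ord0).
rewrite lt0n s0 /=; congr (_ \in w); congr (mkatom _).
by apply/ffunP => i; rewrite !ffunE; case: (tagged s i).
Qed.

Lemma twotypeC (w : world) x y : twotype w y x = swap_set (twotype w x y).
Proof.
apply/setP => s; rewrite !inE; congr (_ && _).
  by have := mixed_swap s; rewrite !inE.
congr (_ \in w); congr (mkatom _); apply/ffunP => i; rewrite !ffunE /= ?ffunE.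
by case: (tagged s i).
Qed.

Hypothesis sentence : is_sentence Gamma.

(** Regroups the conditions on ordered pairs by node and by element at the free variable; for a node
    that binds the first variable the pair is read in the opposite order. *)
Lemma prod_ok_pair (w : world) (s : {ffun 'I_N -> etype}) :
  \prod_x \prod_y (ok_pair (s x) (s y) (loc w (pair_env x y)) (x == y))%:R =
  \prod_a \prod_(k < m) \prod_d
    ((s a).1.2 k ==> ~~ witness Gamma w (fun a => bitn (s a).1.1) k a d)%:R :> R.
Proof.
pose c (k : 'I_m) x y : R := ((s (pair_env x y (~~ (node k).1))).1.2 k ==>
   ~~ ev (loc w (pair_env x y)) (x == y) (fun u => bitn (s (pair_env x y u)).1.1) k.+1 (node k).2)%:R.
have E x y : (ok_pair (s x) (s y) (loc w (pair_env x y)) (x == y))%:R = \prod_k c k x y :> R.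
  rewrite natr_bool_all; congr (nat_of_bool _)%:R; apply: eq_forallb => k.
  congr (_ ==> ~~ _); first by case: (~~ _).
  by apply: ev_ext => -[].
under eq_bigr do under eq_bigr do rewrite E.
under eq_bigr do rewrite exchange_big.
rewrite exchange_big [RHS]exchange_big /=; apply: eq_bigr => k _.
rewrite /c /witness /upd_env; case: (node k) => -[] f /=; first by [].
rewrite exchange_big /=; apply: eq_bigr => a _; apply: eq_bigr => d _.
by rewrite eq_sym.
Qed.

(** The consistency conditions over all elements and nodes multiply to the indicator of the guess
    [g0] by truth values, so one guess survives; each condition is then expanded with
    [kappa_exists]. The unary atoms join the type as a coordinate pinned to its actual value. *)
Lemma models_sum (w : world) : (models w Gamma)%:R =
  \sum_(s : {ffun 'I_N -> etype})
    (\prod_a ((\prod_k kappa R ((s a).1.1 k) ((s a).1.2 k)) *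
       (ok_top (s a) (loc w (pair_env a a)) && ((s a).2 == onetype w a))%:R)) *
    \prod_x \prod_y (ok_pair (s x) (s y) (loc w (pair_env x y)) (x == y))%:R.
Proof.
under eq_bigr do rewrite prod_ok_pair big_split /=.
rewrite sum_ffun_pair /= sum_ffun_pair /=.
pose g0 : {ffun 'I_N -> {ffun 'I_m -> bool}} := [ffun a => [ffun k : 'I_m => truth Gamma w a k]].
pose wit (g : {ffun 'I_N -> {ffun 'I_m -> bool}}) := witness Gamma w (fun a => bitn (g a)).
have bg0 k a : (k < m)%N -> bitn (g0 a) k = truth Gamma w a k.
  by move=> km; rewrite -[k]/(val (Ordinal km)) bitn_ord !ffunE.
have key (g : {ffun 'I_N -> {ffun 'I_m -> bool}}) : (\prod_a \prod_(k < m) (g a k == [exists d, wit g k a d])%:R) = (g == g0)%:R :> R.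
  under eq_bigr do rewrite natr_bool_all.
  rewrite natr_bool_all; congr (nat_of_bool _)%:R; apply/forallP/eqP => [H|->].
    have {}H k a : (k < m)%N -> bitn (g a) k = [exists d, witness Gamma w (fun a => bitn (g a)) k a d].
      move=> km; rewrite -[k]/(val (Ordinal km)) bitn_ord.
      by have /forallP/(_ (Ordinal km))/eqP := H a.
    apply/ffunP => a; apply/ffunP => k.
    by rewrite !ffunE -bitn_ord (witness_truth H).
  move=> a; apply/forallP => k; rewrite -bitn_ord; apply/eqP.
  exact: (truth_witness (G := fun a => bitn (g0 a)) bg0).
pose top (g : {ffun 'I_N -> {ffun 'I_m -> bool}}) a := ev (loc w (pair_env a a)) true (fun _ => bitn (g a)) 0 Gamma.
have topE : \prod_a (top g0 a)%:R = (models w Gamma)%:R :> R.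
  rewrite natr_bool_all; congr (nat_of_bool _)%:R.
  have E a : top g0 a = models w Gamma.
    by rewrite /top -(eval_truth a (G := fun a => bitn (g0 a)) bg0) -models_eval.
  (* A sentence has the same truth value at every element; one element is needed to read it off. *)
  by apply/forallP/idP => [/(_ ord0)|H a]; rewrite E.
transitivity (\sum_g (\prod_a (top g a)%:R) * (g == g0)%:R : R).
  rewrite (bigD1 g0) //= eqxx mulr1 topE big1 ?addr0 // => g /negbTE ->.
  by rewrite mulr0.
apply: eq_bigr => g _.
transitivity (\sum_(s : {ffun 'I_N -> {ffun 'I_m -> bool}}) (\prod_a (top g a)%:R) *
  \prod_a \prod_(k < m) (kappa R (g a k) (s a k) *
     \prod_d (s a k ==> ~~ wit g k a d)%:R)).
  rewrite -big_distrr /=; congr (_ * _); rewrite -key.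
  rewrite (sum_ffun2 (fun a k b => kappa R (g a k) b * \prod_d (b ==> ~~ wit g k a d)%:R)).
  by apply: eq_bigr => a _; apply: eq_bigr => k _; rewrite kappa_exists.
apply: eq_bigr => s _.
transitivity (\sum_(f : {ffun 'I_N -> {set 'I_p}}) (\prod_a (f a == onetype w a)%:R) *
  ((\prod_a (top g a)%:R) * \prod_a \prod_(k < m) (kappa R (g a k) (s a k) *
     \prod_d (s a k ==> ~~ wit g k a d)%:R))).
  by rewrite -big_distrl /= sum_ffun_eq mul1r.
apply: eq_bigr => f _.
set W1 := \prod_a \prod_(k < m) (_ * _).
have -> : W1 = (\prod_a \prod_k kappa R (g a k) (s a k)) *
    \prod_a \prod_(k < m) \prod_d (s a k ==> ~~ wit g k a d)%:R.
  by rewrite -big_split; apply: eq_bigr => a _; rewrite -big_split.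
transitivity ((\prod_a \prod_k kappa R (g a k) (s a k)) *
   (\prod_a (top g a && (f a == onetype w a))%:R) *
   (\prod_a \prod_(k < m) \prod_d (s a k ==> ~~ wit g k a d)%:R)).
  have -> : \prod_a (top g a && (f a == onetype w a))%:R =
      (\prod_a (top g a)%:R) * \prod_a (f a == onetype w a)%:R :> R.
    by rewrite -big_split; apply: eq_bigr => a _; apply: natr_andb.
  rewrite !mulrA; congr (_ * _); rewrite mulrC -[RHS]mulrA; congr (_ * _).
  exact: mulrC.
congr (_ * _ * _); apply: eq_bigr => a _.
- by apply: eq_bigr => k _; rewrite !ffunE.
- by rewrite !ffunE.
- apply: eq_bigr => k _; apply: eq_bigr => d _; rewrite !ffunE /wit /witness.
  by congr (_ ==> ~~ _)%:R; apply: ev_ext => u v; rewrite !ffunE.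
Qed.

Definition zeta (A : gatom ar N) : R := z (tag A).

(* Once the nullary and unary atoms of w are prescribed, the summand splits
   into independent contributions of the single elements and of the pairs. *)
Lemma models_weight :
  \sum_(w : world | models w Gamma) \prod_(A in w) zeta A =
  \sum_(nu : {set 'I_p}) \sum_(s : {ffun 'I_N -> etype})
   (\prod_a ((\prod_k kappa R ((s a).1.1 k) ((s a).1.2 k)) *
      (ok_top (s a) (diag_table nu (s a).2) &&
       ok_pair (s a) (s a) (diag_table nu (s a).2) true)%:R)) *
   \sum_(w : world) (\prod_(A in w) zeta A) *
     ((nulltype w == nu)%:R *
      ((\prod_a (onetype w a == (s a).2)%:R) *
       \prod_(xy : 'I_N * 'I_N | (xy.1 < xy.2)%N)
         (ok_mixed nu (s xy.1) (s xy.2) (twotype w xy.1 xy.2))%:R)).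
Proof.
pose c (w : world) (s : {ffun 'I_N -> etype}) : R := (\prod_a ((\prod_k kappa R ((s a).1.1 k) ((s a).1.2 k)) *
       (ok_top (s a) (loc w (pair_env a a)) && ((s a).2 == onetype w a))%:R)) *
    \prod_x \prod_y (ok_pair (s x) (s y) (loc w (pair_env x y)) (x == y))%:R.
transitivity (\sum_(w : world) \sum_(nu : {set 'I_p}) \sum_s
     (\prod_(A in w) zeta A) * ((nulltype w == nu)%:R * c w s)).
  rewrite big_mkcond /=; apply: eq_bigr => w _.
  rewrite (bigD1 (nulltype w)) //= eqxx [X in _ + X]big1 ?addr0; last first.
    by move=> nu /negbTE h; apply: big1 => s _; rewrite eq_sym h mul0r mulr0.
  rewrite [RHS](eq_bigr (fun s => (\prod_(A in w) zeta A) * c w s)); last first.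
    by move=> s _; rewrite mul1r.
  rewrite -big_distrr /= -models_sum.
  by case: models; rewrite ?mulr1 ?mulr0.
rewrite exchange_big /=; apply: eq_bigr => nu _.
rewrite exchange_big /=; apply: eq_bigr => s _.
rewrite big_distrr /=; apply: eq_bigr => w _.
rewrite [RHS]mulrCA; congr (_ * _); rewrite [RHS]mulrCA.
case: eqP => [nuE|_]; rewrite ?mul0r // !mul1r.
rewrite /c big_ord_pairs.
have loc1 a : onetype w a = (s a).2 -> loc w (pair_env a a) = diag_table nu (s a).2.
  by move=> <-; rewrite loc_diag nuE.
(* If the unary atoms of some element differ from those prescribed by its type, both sides
   vanish. *)
have [/forallP H|/forallPn[a ha]] := boolP [forall a, onetype w a == (s a).2]; last first.
  rewrite [X in _ = _ * (X * _)](bigD1 a) //= (negbTE ha) !mul0r mulr0.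
  by rewrite [X in X * _](bigD1 a) //= [_ == onetype w a]eq_sym (negbTE ha) andbF mulr0 !mul0r.
rewrite [X in _ = _ * (X * _)]big1 ?mul1r; last by move=> a _; rewrite H.
rewrite mulrA -big_split /=; congr (_ * _); last apply: eq_bigr => -[x y] /= xy.
  apply: eq_bigr => a _.
  rewrite eq_sym H andbT (loc1 a (eqP (H a))) eqxx -mulrA; congr (_ * _).
  by rewrite natr_andb.
rewrite -natr_andb; congr (nat_of_bool _)%:R; rewrite /ok_mixed !loc_pair nuE.
rewrite (eqP (H x)) (eqP (H y)) -twotypeC.
by rewrite -!val_eqE /= (gtn_eqF xy) (ltn_eqF xy).
Qed.

(** * Partition of the ground atoms into blocks *)

Definition arg_set (A : gatom ar N) : {set 'I_N} := [set tagged A i | i : 'I_(ar (tag A))].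

(** [None] collects the atoms with at least three distinct arguments, invisible to two variables;
    [Some None] the nullary ones. All others are keyed by their sorted arguments, a repeated entry
    meaning a single element. *)
Definition block (A : gatom ar N) : option (option ('I_N * 'I_N)) :=
  if arg_set A == set0 then Some None
  else omap Some [pick xy : 'I_N * 'I_N | (xy.1 <= xy.2)%N && (arg_set A == [set xy.1; xy.2])].

Lemma arg_set_eq0 A : (arg_set A == set0) = (ar (tag A) == 0%N).
Proof.
apply/eqP/eqP => [A0|A0].
  case E : (ar (tag A)) => [|k] //.
  have i : 'I_(ar (tag A)) by rewrite E; apply: ord0.
  have : tagged A i \in arg_set A by apply/imsetP; exists i.
  by rewrite A0 inE.
apply/setP => x; rewrite inE; apply/negbTE/negP => /imsetP[i _ _].
by move: i; rewrite A0 => -[].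
Qed.

Lemma set2_inj (a b x y : 'I_N) : (a <= b)%N -> (x <= y)%N ->
  [set a; b] = [set x; y] -> (a, b) = (x, y).
Proof.
move=> ab xy /setP E.
have := E a; have := E b; have := E x; have := E y.
rewrite !inE !eqxx ?orbT -!val_eqE /= => h1 h2 h3 h4.
by congr pair; apply: val_inj => /=; lia.
Qed.

Lemma block_null A : (block A == Some None) = (ar (tag A) == 0%N).
Proof.
rewrite /block -arg_set_eq0; have [_|_] := eqVneq (arg_set A) set0; first by rewrite eqxx.
by case: pickP.
Qed.

Lemma block_pair A x y : (block A == Some (Some (x, y))) =
  (x <= y)%N && (arg_set A == [set x; y]).
Proof.
rewrite /block; have [A0|A0] := eqVneq (arg_set A) set0.
  apply/esym/negbTE; rewrite negb_and A0 orbC; apply/orP; left; apply/eqP => /setP /(_ x).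
  by rewrite !inE eqxx.
case: pickP => [[a b] /= /andP[ab /eqP Aab]|H] /=; last by rewrite (H (x, y)).
apply/eqP/andP => [[<- <-]|[xy /eqP E]]; first by rewrite Aab.
by rewrite (set2_inj ab xy) // -E.
Qed.

Lemma eq_gatom (A B : gatom ar N) : tag A = tag B ->
  (forall i j, val i = val j -> tagged A i = tagged B j) -> A = B.
Proof.
case: A B => Q t [Q' t'] /= E; subst Q' => H; congr (Tagged _ _).
by apply/ffunP => i; apply: H.
Qed.

Lemma block_null_set : [set A | block A == Some None] = (fun Q => catom Q ord0) @: nullary.
Proof.
apply/setP => A; rewrite inE block_null; apply/eqP/imsetP => [A0|[Q + ->]].
  exists (tag A); rewrite ?inE ?A0 //; apply: eq_gatom => // i.
  by exfalso; case: i; rewrite A0.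
by rewrite inE => /eqP.
Qed.

Lemma block_diag_set x :
  [set A | block A == Some (Some (x, x))] = (fun Q => catom Q x) @: positive.
Proof.
apply/setP => A; rewrite inE block_pair leqnn setUid /=; apply/eqP/imsetP => [Ax|[Q + ->]].
  exists (tag A).
    rewrite inE lt0n -arg_set_eq0 Ax; apply/eqP => /setP /(_ x).
    by rewrite !inE eqxx.
  apply: eq_gatom => // i j _; rewrite ffunE; apply/set1P; rewrite -Ax.
  by apply/imsetP; exists i.
rewrite inE => Q0; apply/setP => y; rewrite inE; apply/imsetP/eqP => [[i _ ->]|->].
  by rewrite ffunE.
by exists (Ordinal Q0); rewrite ?ffunE.
Qed.

Lemma block_lt_set (x y : 'I_N) : (x < y)%N ->
  [set A | block A == Some (Some (x, y))] = emb (pair_env x y) @: mixed.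
Proof.
move=> xy; have yx : (y == x) = false by rewrite -val_eqE /= gtn_eqF.
apply/setP => A; rewrite inE block_pair (ltnW xy) /=; apply/eqP/imsetP => [Axy|[s + ->]].
  have Ain i : tagged A i \in [set x; y] by rewrite -Axy; apply/imsetP; exists i.
  exists (mksat [ffun i => tagged A i == y]).
    rewrite !inE; apply/andP; split; apply/forallPn.
      have : y \in arg_set A by rewrite Axy !inE eqxx orbT.
      by move=> /imsetP[i _ E]; exists i; rewrite /= ffunE -E eqxx.
    have : x \in arg_set A by rewrite Axy !inE eqxx.
    by move=> /imsetP[i _ E]; exists i; rewrite /= ffunE -E eq_sym yx.
  apply: eq_gatom => // i j /val_inj <-; rewrite /= ffunE /= ffunE /pair_env.
  by have := Ain i; rewrite !inE; case: eqP => [->|_] /=; [rewrite eq_sym yx|move=> /eqP ->; rewrite eqxx].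
rewrite !inE => /andP[/forallPn[i /negbNE si] /forallPn[j /negbTE sj]].
apply/setP => a; rewrite !inE; apply/imsetP/orP => [[k _ ->]|[/eqP ->|/eqP ->]].
- by rewrite /= ffunE /pair_env; case: (tagged s k); rewrite eqxx; [right | left].
- by exists j; rewrite //= ffunE sj.
- by exists i; rewrite //= ffunE si.
Qed.

Lemma block_gt_set (x y : 'I_N) : (y < x)%N -> [set A | block A == Some (Some (x, y))] = set0.
Proof. by move=> yx; apply/setP => A; rewrite !inE block_pair leqNgt yx. Qed.

Lemma catom_inj a : injective (fun Q => catom Q a).
Proof. by move=> Q Q' E; have := congr1 tag E. Qed.

Lemma emb_inj x y : x != y -> injective (@emb p ar N (pair_env x y)).
Proof.
move=> xy [Q f] [Q' f'] E; have EQ : Q = Q' := congr1 tag E; subst Q'.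
congr (Tagged _ _); apply/ffunP => i.
have /eqP : emb (pair_env x y) (mksat f) == emb (pair_env x y) (mksat f') by rewrite E.
move/eqP; rewrite eq_Tagged => /eqP /ffunP /(_ i); rewrite !ffunE /pair_env /=.
case: (f i); case: (f' i) => // /eqP; first by rewrite eq_sym (negbTE xy).
by rewrite (negbTE xy).
Qed.

(** The blocks contribute independently: invisible atoms are free and give [1 + zeta A], nullary and
    one-element blocks are prescribed, and two-element blocks give the pair weights. *)
Lemma block_sum (nu : {set 'I_p}) (s : {ffun 'I_N -> etype}) :
  \sum_(w : world) (\prod_(A in w) zeta A) *
     ((nulltype w == nu)%:R *
      ((\prod_a (onetype w a == (s a).2)%:R) *
       \prod_(xy : 'I_N * 'I_N | (xy.1 < xy.2)%N)
         (ok_mixed nu (s xy.1) (s xy.2) (twotype w xy.1 xy.2))%:R)) =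
  (\prod_(A | block A == None) (1 + zeta A)) *
  (((\prod_(Q in nu) z Q) * (nu \subset nullary)%:R) *
   ((\prod_a ((\prod_(Q in (s a).2) z Q) * ((s a).2 \subset positive)%:R)) *
    \prod_(xy : 'I_N * 'I_N | (xy.1 < xy.2)%N) pair_weight nu (s xy.1) (s xy.2))).
Proof.
(* The condition borne by each block. Blocks keyed by a decreasing pair are empty, so they carry
   1. *)
pose psi (j : option (option ('I_N * 'I_N))) (w : world) : R :=
  match j with
  | None => 1
  | Some None => (nulltype w == nu)%:R
  | Some (Some (x, y)) =>
      if (x < y)%N then (ok_mixed nu (s x) (s y) (twotype w x y))%:R
      else if x == y then (onetype w x == (s x).2)%:R else 1
  end.
pose phi j (w : world) := (\prod_(A in w | block A == j) zeta A) * psi j w.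
have psiI j w : psi j w = psi j (w :&: [set A | block A == j]).
  case: j => [[[x y]|]|] //=.
  - case: ltngtP => [xy|yx|/val_inj <-]; last 2 first.
      by rewrite -val_eqE /= (gtn_eqF yx).
      rewrite eqxx block_diag_set; congr ((_ == _)%:R); apply/setP => Q; rewrite !inE.
      by case Q0 : (0 < ar Q)%N => //=; rewrite (imset_f (fun Q => catom Q x)) ?andbT // inE.
    rewrite block_lt_set //; congr ((nat_of_bool (ok_mixed _ _ _ _))%:R).
    apply/setP => t; rewrite /twotype [LHS]in_set [RHS]in_set in_setI.
    by case T0 : (t \in mixed) => //=; rewrite (imset_f (emb (pair_env x y))) ?andbT.
  - rewrite block_null_set; congr ((_ == _)%:R); apply/setP => Q; rewrite !inE.
    by case Q0 : (ar Q == 0)%N => //=; rewrite (imset_f (fun Q => catom Q ord0)) ?andbT // inE.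
have phiI j w : phi j w = phi j (w :&: [set A | block A == j]).
  rewrite /phi -psiI; congr (_ * _); apply: eq_bigl => A; rewrite !inE.
  by case: (block A == j); rewrite ?andbT ?andbF.
transitivity (\sum_w \prod_j phi j w).
  apply: eq_bigr => w _; rewrite /phi big_split /=; congr (_ * _).
    by rewrite (partition_big block xpredT).
  rewrite !big_option /= mul1r; congr (_ * _).
  pose f (x y : 'I_N) : R := if (x < y)%N then (ok_mixed nu (s x) (s y) (twotype w x y))%:R
      else if x == y then (onetype w x == (s x).2)%:R else 1.
  rewrite [RHS](eq_bigr (fun xy => f xy.1 xy.2)); last by case.
  rewrite -(pair_bigA _ f) /= big_ord_pairs; congr (_ * _); last apply: eq_bigr => -[x y] /= xy.
    by apply: eq_bigr => a _; rewrite /f ltnn eqxx.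
  by rewrite /f xy ltnNge (ltnW xy) /= -val_eqE /= gtn_eqF // mulr1.
rewrite (sum_blocks phiI).
have E j : \sum_(w : world | w \subset [set A | block A == j]) phi j w =
    \sum_(w : world | w \subset [set A | block A == j]) (\prod_(A in w) zeta A) * psi j w.
  apply: eq_bigr => w /subsetP wB; congr (_ * _); apply: eq_bigl => A.
  by case Aw: (A \in w) => //=; have := wB A Aw; rewrite inE.
under eq_bigr do rewrite E.
rewrite !big_option /=; congr (_ * (_ * _)).
- under eq_bigr do rewrite mulr1.
  rewrite sum_subsets; apply: eq_bigl => A; exact: in_set.
- rewrite block_null_set (sum_embed zeta (fun P => (P == nu)%:R)) ?sum_pick //.
  by move=> Q Q' _ _; apply: catom_inj.
pose f x y : R := \sum_(w : world | w \subset [set A | block A == Some (Some (x, y))])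
   (\prod_(A in w) zeta A) * psi (Some (Some (x, y))) w.
rewrite [LHS](eq_bigr (fun xy => f xy.1 xy.2)); last by case.
rewrite -(pair_bigA _ f) /= big_ord_pairs; congr (_ * _); last apply: eq_bigr => -[x y] /= xy.
  apply: eq_bigr => a _; rewrite /f /= ltnn eqxx block_diag_set.
  rewrite (sum_embed zeta (fun P => (P == (s a).2)%:R)) ?sum_pick //.
  by move=> Q Q' _ _; apply: catom_inj.
rewrite [f y x](_ : _ = 1) ?mulr1; last first.
  rewrite /f block_gt_set // (big_pred1 set0) => [|w]; last by rewrite subset0.
  by rewrite big_set0 mul1r /= ltnNge (ltnW xy) /= -val_eqE /= gtn_eqF.
rewrite /f block_lt_set //= xy.
rewrite (sum_embed zeta (fun P => (ok_mixed nu (s x) (s y) P)%:R)) //.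
by move=> t t' _ _; apply: emb_inj; rewrite -val_eqE /= ltn_eqF.
Qed.

Definition num_mixed (Q : 'I_p) : nat := (\sum_(s in mixed) (tag s == Q))%N.

Lemma card_pairs n : #|[set xy : 'I_n * 'I_n | (xy.1 < xy.2)%N]| = 'C(n, 2).
Proof.
have /= := big_ord_pairs addn (fun x y : 'I_n => 1%N).
rewrite !sum1_card !card_ord sum_nat_const card_ord => E.
rewrite bin2 -sum1_card (eq_bigl (fun xy : 'I_n * 'I_n => (xy.1 < xy.2)%N)); last first.
  by move=> xy; rewrite inE.
move: E; rewrite big_split /=; move: (\sum_(_ | _) 1)%N => k; case: n => [|n]; nia.
Qed.

(** Counting the atoms of [Q] by block makes the number of invisible ones a difference of explicit
    expressions, which a program can evaluate. *)
Lemma card_atoms Q : (N ^ ar Q)%N =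
  (\sum_(A : gatom ar N | block A == None) (tag A == Q) +
   ((ar Q == 0) + (N * (0 < ar Q) + 'C(N, 2) * num_mixed Q)))%N.
Proof.
rewrite -sum_tag.
have catom_sum (D : {set 'I_p}) a :
    (\sum_(A in (fun Q => catom Q a) @: D) (tag A == Q) = (Q \in D))%N.
  rewrite big_imset /=; last by move=> ? ? _ _; apply: catom_inj.
  have [QD|QD] := boolP (Q \in D).
    by rewrite (bigD1 Q) //= eqxx big1 // => Q' /andP[_ /negbTE ->].
  by rewrite big1 // => Q' Q'D; case: eqP => // E; rewrite -E Q'D in QD.
rewrite (partition_big (@block) xpredT) //= !big_option /=; congr (_ + (_ + _))%N.
  rewrite -(eq_bigl _ _ (fun A => in_set (fun A => block A == Some None) A)).
  by rewrite block_null_set catom_sum inE.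
pose f x y := (\sum_(A : gatom ar N | block A == Some (Some (x, y))) (tag A == Q))%N.
rewrite (eq_bigr (fun xy => f xy.1 xy.2)); last by case.
rewrite -(pair_bigA _ f) /= big_ord_pairs; congr (_ + _)%N.
  rewrite (eq_bigr (fun=> (0 < ar Q)%N : nat)) ?sum_nat_const ?card_ord // => a _.
  rewrite /f -(eq_bigl _ _ (fun A => in_set (fun A => block A == Some (Some (a, a))) A)).
  by rewrite block_diag_set catom_sum inE.
rewrite (eq_bigr (fun=> num_mixed Q)).
  rewrite -card_pairs -sum_nat_const; apply: eq_bigl => xy; first by rewrite inE.
move=> [x y] /= xy; rewrite [f y x]big1 ?addn0.
  rewrite /f -(eq_bigl _ _ (fun A => in_set (fun A => block A == Some (Some (x, y))) A)).
  rewrite block_lt_set // big_imset //.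
  by move=> t t' _ _; apply: emb_inj; rewrite -val_eqE /= ltn_eqF.
move=> A; have := in_set (fun A => block A == Some (Some (y, x))) A.
by rewrite block_gt_set // inE => <-.
Qed.

Definition num_irrelevant (Q : 'I_p) : nat :=
  (N ^ ar Q - ((ar Q == 0) + (N * (0 < ar Q) + 'C(N, 2) * num_mixed Q)))%N.

Lemma prod_count (w : pred (gatom ar N)) (F : 'I_p -> R) :
  \prod_(A | w A) F (tag A) = \prod_Q F Q ^+ (\sum_(A | w A) (tag A == Q))%N.
Proof.
rewrite (partition_big (fun A => tag A) xpredT) //=; apply: eq_bigr => Q _.
rewrite (eq_bigr (fun=> F Q)); last by move=> A /andP[_ /eqP ->].
rewrite prod_const_card -sum1_card; congr (_ ^+ _).
rewrite [RHS](eq_bigr (fun A => if tag A == Q then 1 else 0)%N); last by move=> A _; case: eqP.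
by rewrite -big_mkcondr; apply: eq_bigl => A; rewrite inE.
Qed.

(** Stated over any commutative ring: inclusion-exclusion needs -1, whereas the program works with
    residues. The weights depend on the type assignment only through its histogram. *)
Theorem cell_formula :
  \sum_(w : world | models w Gamma) \prod_(A in w) z (tag A) =
  (\prod_Q (1 + z Q) ^+ num_irrelevant Q) *
  \sum_(nu : {set 'I_p} | nu \subset nullary) (\prod_(Q in nu) z Q) *
    \sum_(s : {ffun 'I_N -> etype})
       hist_weight (cell_weight nu) (pair_weight nu) (hist s).
Proof.
rewrite models_weight big_distrr /= [RHS]big_mkcond /=; apply: eq_bigr => nu _.
under eq_bigr do rewrite block_sum.
have -> : \prod_(A | block A == None) (1 + zeta A) = \prod_Q (1 + z Q) ^+ num_irrelevant Q.
  rewrite (prod_count _ (fun Q => 1 + z Q)); apply: eq_bigr => Q _.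
  by rewrite /num_irrelevant card_atoms addnK.
case: ifP => nuD; last first.
  by rewrite big1 // => s _; rewrite mulr0 !(mul0r, mulr0).
rewrite mulr1 2!big_distrr /=; apply: eq_bigr => s _.
rewrite mulrCA; congr (_ * _); rewrite mulrCA; congr (_ * _).
rewrite -(prod_hist _ _ (pair_weightC nu)) mulrA -big_split /=; congr (_ * _).
apply: eq_bigr => a _; rewrite /cell_weight -!mulrA; congr (_ * _).
by rewrite mulrCA -natr_andb /ok_diag andbA.
Qed.
End Weights.
End Cells.

(** * Functionality constraints *)

Section Functionality.
Variables (p : nat) (ar : 'I_p -> nat).

Definition total_form (S : 'I_p) : fo2form ar :=
  FNot (FEx false (FNot (FEx true (FAtom S (fun i => val i != 0))))).

Definition add_total (Gamma : fo2form ar) (funs : seq 'I_p) : fo2form ar :=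
  foldr (fun S f => FAnd (total_form S) f) Gamma funs.

Lemma sentence_add_total Gamma funs :
  is_sentence Gamma -> is_sentence (add_total Gamma funs).
Proof.
rewrite /is_sentence => G; elim: funs => //= S funs; rewrite /nilp /= size_cat addn_eq0 => ->.
rewrite andbT size_eq0 -filter_predI; apply/eqP; rewrite -(filter_pred0 (fv (@FAtom p ar S (fun i => val i != 0)))).
by apply: eq_filter => -[].
Qed.

Variables (n : nat) (w : world ar n).

Lemma models_total S : models w (total_form S) =
  [forall x, exists y, mkatom (pair_tup ar S x y) \in w].
Proof.
rewrite /models /= negb_exists; apply: eq_forallb => x; rewrite negbK.
apply: eq_existsb => y; apply/existsP/idP => [[t /andP[/forallP H tw]]|H].
  rewrite (_ : pair_tup ar S x y = t) //; apply/ffunP => i; rewrite ffunE.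
  by have := H i; case: (val i == 0) => /= /eqP[].
exists (pair_tup ar S x y); rewrite H andbT; apply/forallP => i; rewrite ffunE.
by case: (val i == 0).
Qed.

Lemma Ncount_pairs S : ar S = 2 ->
  Ncount w S = \sum_x #|[set y | mkatom (pair_tup ar S x y) \in w]|.
Proof.
move=> S2; rewrite /Ncount.
under eq_bigr do rewrite -sum1_card (eq_bigl _ _ (in_set _)).
rewrite pair_big_dep /= sum1_card.
have i0 : 0 < ar S by rewrite S2.
have i1 : 1 < ar S by rewrite S2.
pose f (xy : 'I_n * 'I_n) := mkatom (pair_tup ar S xy.1 xy.2).
have inj : injective f.
  move=> [x y] [x' y'] /eqP; rewrite eq_Tagged => /eqP /ffunP H.
  have := H (Ordinal i0); have := H (Ordinal i1).
  by rewrite !ffunE /= => -> ->.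
rewrite -(card_imset _ inj); apply: eq_card => A; rewrite !inE.
apply/andP/imsetP => [[Aw /eqP E]|[xy xyw ->]]; last by split; [exact: xyw | exact: eqxx].
case: A Aw E => S' t /= Aw E; subst S'.
have Et : mkatom t = f (t (Ordinal i0), t (Ordinal i1)).
  congr (mkatom _); apply/ffunP => i; rewrite ffunE; case: eqP => iv.
    by congr (t _); apply: val_inj; rewrite /= iv.
  have i2 : i < 2 by rewrite -S2 ltn_ord.
  by congr (t _); apply: val_inj => /=; move: iv => /=; lia.
by exists (t (Ordinal i0), t (Ordinal i1)) => //; rewrite unfold_in /= -/(f (_, _)) -Et.
Qed.

(** If [n] positive numbers have sum [n], each of them is 1. *)
Lemma functional_total S : ar S = 2 ->
  functional w S = models w (total_form S) && (Ncount w S == n).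
Proof.
move=> S2; rewrite models_total Ncount_pairs //.
pose c x := #|[set y | mkatom (pair_tup ar S x y) \in w]|.
have pos x : [exists y, mkatom (pair_tup ar S x y) \in w] = (0 < c x).
  apply/existsP/card_gt0P => -[y]; first by exists y; rewrite inE.
  by rewrite inE; exists y.
rewrite (eq_forallb pos) /functional -/(c _).
apply/forallP/andP => [H|[/forallP H1 /eqP H2] x].
  split; first by apply/forallP => x; rewrite /c (eqP (H x)).
  by rewrite (eq_bigr (fun=> 1)) ?sum1_card ?card_ord // => x _; apply/eqP.
have : \sum_x (c x - 1) = 0.
  rewrite sumnB; last by move=> i _; apply: H1.
  by rewrite H2 sum1_card card_ord subnn.
move=> /eqP; rewrite sum_nat_eq0 => /forallP /(_ x) /=; have := H1 x.
by rewrite -/(c x); case: (c x) => [|[|k]].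
Qed.

Lemma sat_all_total Gamma cards funs : (forall S, S \in funs -> ar S = 2) ->
  sat_all Gamma cards funs w = [&& models w (add_total Gamma funs), all (card_ok w) cards
     & all (fun S => Ncount w S == n) funs].
Proof.
move=> H2; rewrite /sat_all andbCA [RHS]andbCA; congr (_ && _).
elim: funs H2 => [|S funs IH] H2 //=.
rewrite functional_total; last by apply: H2; rewrite inE eqxx.
rewrite -andbA andbCA (andbCA (models w Gamma)) IH; last first.
  by move=> S' S'f; apply: H2; rewrite inE S'f orbT.
rewrite -/(add_total Gamma funs) [models w (FAnd _ _)]/(models w (total_form S) && models w (add_total Gamma funs)).
by rewrite -andbA; congr (_ && _); rewrite andbCA.
Qed.
End Functionality.

(** * Kronecker substitution *)

Lemma digit_sum B J (c : nat -> nat) j : (forall i, c i < B) -> j < J ->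
  (\sum_(i < J) c i * B ^ i) %/ B ^ j %% B = c j.
Proof.
move=> cB; have B0 : 0 < B by apply: leq_ltn_trans (cB 0).
elim: J c j cB => [|J IH] c [|j] cB //.
  move=> _; rewrite divn1 big_ord_recl expn0 muln1 addnC.
  rewrite (eq_bigr (fun i : 'I_J => (c i.+1 * B ^ i) * B)); last first.
    by move=> i _; rewrite expnSr mulnA.
  by rewrite -big_distrl /= modnMDl modn_small.
rewrite ltnS => jJ; rewrite big_ord_recl expn0 muln1 expnS divnMA.
rewrite (eq_bigr (fun i : 'I_J => (c i.+1 * B ^ i) * B)); last first.
  by move=> i _; rewrite expnSr mulnA.
rewrite -big_distrl /= addnC divnMDl // (divn_small (cB 0)) addn0.
exact: (IH (fun i => c i.+1)).
Qed.

Lemma digit_sum_lt B J (c : nat -> nat) : (forall i, c i < B) ->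
  \sum_(i < J) c i * B ^ i < B ^ J.
Proof.
move=> cB; elim: J => [|J IH]; first by rewrite big_ord0.
rewrite big_ord_recr /= expnS; have := cB J; have : 0 < B ^ J by rewrite expn_gt0 (leq_ltn_trans _ (cB 0)).
by move: IH; move: (\sum_(_ < _) _) (B ^ J) => S P; nia.
Qed.

Definition ord_fun K (c : 'I_K -> nat) (i : nat) : nat := if insub i is Some j then c j else 0.

Lemma ord_funE K (c : 'I_K -> nat) i : ord_fun c (val i) = c i.
Proof. by rewrite /ord_fun valK. Qed.

Lemma ord_digit K D (c : 'I_K -> nat) (k : 'I_K) : 0 < D -> (forall i, c i < D) ->
  (\sum_i c i * D ^ i) %/ D ^ k %% D = c k.
Proof.
move=> D0 cD; rewrite -[RHS]ord_funE -(@digit_sum D K (ord_fun c) k) //.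
  by congr (_ %/ _ %% _); apply: eq_bigr => i _; rewrite -[i in ord_fun _ i]/(val i) ord_funE.
by move=> i; rewrite /ord_fun; case: insub.
Qed.

Lemma ord_digit_lt K D (c : 'I_K -> nat) : 0 < D -> (forall i, c i < D) ->
  \sum_i c i * D ^ i < D ^ K.
Proof.
move=> D0 cD; apply: leq_ltn_trans (@digit_sum_lt D K (ord_fun c) _).
  by apply: leq_sum => i _; rewrite -[i in ord_fun _ i]/(val i) ord_funE.
by move=> i; rewrite /ord_fun; case: insub.
Qed.

(** The digits in base [B] are sizes of fibres, at most [#|X|], so no carry occurs. *)
Lemma kronecker (X : finType) (P : pred X) (f : X -> nat) B j : #|X| < B ->
  (\sum_(x | P x) B ^ f x) %/ B ^ j %% B = #|[set x | P x && (f x == j)]|.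
Proof.
move=> XB; pose J := (j + \sum_x f x).+1.
pose c i := #|[set x | P x && (f x == i)]|.
have fJ x : f x < J by rewrite ltnS (bigD1 x) //= addnCA leq_addr.
rewrite (_ : \sum_(x | P x) B ^ f x = \sum_(i < J) c i * B ^ i).
  rewrite (@digit_sum B J c) //; last by rewrite ltnS leq_addr.
  by move=> i; apply: leq_ltn_trans (max_card _) XB.
rewrite (partition_big (fun x => Ordinal (fJ x)) xpredT) //=; apply: eq_bigr => i _.
rewrite (eq_bigr (fun=> B ^ i)); last by move=> x /andP[_ /eqP <-].
by rewrite -sum_nat_const; apply: eq_bigl => x; rewrite inE -val_eqE.
Qed.

Lemma sum_fibers (R : nmodType) (X : finType) (P : pred X) (f : X -> nat) J (h : nat -> R) :
  (forall x, P x -> f x < J) ->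
  (\sum_(x | P x) h (f x) = \sum_(j < J) h j *+ #|[set x | P x && (f x == j)]|)%R.
Proof.
move=> fJ; case: J fJ => [|J] fJ.
  by rewrite big_ord0 big1 // => x /fJ.
rewrite (partition_big (fun x => inord (f x) : 'I_J.+1) xpredT) //=; apply: eq_bigr => j _.
rewrite -sumr_const; apply: eq_big => [x|x /andP[Px /eqP <-]]; last by rewrite inordK // fJ.
rewrite inE; case Px : (P x) => //=; rewrite -val_eqE /= inordK ?fJ //.
Qed.

Section Cast.
Variables (p : nat) (ar : 'I_p -> nat) (Gamma : fo2form ar).
Notation m := (nnode Gamma).
Variables (M : nat) (z : 'I_p -> nat).

Definition kappa_nat (b s : bool) : nat := if b then (if s then M - 1 else 1) else s.

Definition cell_nat (nu : {set 'I_p}) (t : etype Gamma) : nat :=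
  (\prod_k kappa_nat (t.1.1 k) (t.1.2 k)) * (\prod_(Q in t.2) z Q) * ok_diag nu t.

Definition pair_nat (nu : {set 'I_p}) (t t' : etype Gamma) : nat :=
  \sum_(P : {set satom ar} | P \subset mixed ar)
     (\prod_(s in P) z (tag s)) * ok_mixed nu t t' P.

Definition hist_nat (T : finType) (u : T -> nat) (r : T -> T -> nat) (c : T -> nat) : nat :=
  (\prod_t u t ^ c t) * (\prod_t r t t ^ 'C(c t, 2)) *
  \prod_(tt : T * T | enum_rank tt.1 < enum_rank tt.2) r tt.1 tt.2 ^ (c tt.1 * c tt.2).

Local Open Scope ring_scope.
Hypothesis M1 : (1 < M)%N.
Notation ZM := 'Z_M.

Lemma natr_inj_mod x y : x%:R = y%:R :> ZM -> x = y %[mod M].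
Proof. by move=> /(congr1 val); rewrite /= !val_Zp_nat. Qed.

Lemma kappa_natE b s : (kappa_nat b s)%:R = kappa ZM b s.
Proof.
rewrite /kappa_nat /kappa; case: b; case: s => //.
by rewrite natrB 1?ltnW // -[X in X - _]/(M%:R) pchar_Zp // sub0r.
Qed.

Lemma cell_natE nu t : (cell_nat nu t)%:R = cell_weight (fun Q => (z Q)%:R : ZM) nu t.
Proof.
rewrite /cell_nat !natrM !natr_prod; congr (_ * _ * _).
by apply: eq_bigr => k _; apply: kappa_natE.
Qed.

Lemma pair_natE nu t t' : (pair_nat nu t t')%:R = pair_weight (fun Q => (z Q)%:R : ZM) nu t t'.
Proof.
rewrite /pair_nat natr_sum; apply: eq_bigr => P _.
by rewrite natrM natr_prod.
Qed.

Lemma hist_natE (T : finType) (u : T -> nat) (r : T -> T -> nat) (c : T -> nat) :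
  (hist_nat u r c)%:R =
  hist_weight (fun t => (u t)%:R : ZM) (fun t t' => (r t t')%:R) c.
Proof.
rewrite /hist_nat !natrM !natr_prod; congr (_ * _ * _); apply: eq_bigr => t _; exact: natrX.
Qed.
End Cast.

Lemma eq_hist_nat (T : finType) (u : T -> nat) r (c c' : T -> nat) : c =1 c' ->
  hist_nat u r c = hist_nat u r c'.
Proof.
by move=> E; rewrite /hist_nat; congr (_ * _ * _); apply: eq_bigr => t _; rewrite ?E.
Qed.

(** Expanding the [n]-th power yields one power of [B] per type assignment, its exponent coding the
    histogram in base [n + 1]. Hence the digit at [j] is the multinomial coefficient of that
    histogram, or 0 if [j] codes none; [B] exceeds the number [#|T| ^ n] of assignments. *)
Definition hist_count (T : finType) (n j : nat) : nat :=
  let B := 2 ^ (#|T| * n).+1 in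
  (\sum_(t : T) B ^ (n.+1 ^ enum_rank t)) ^ n %/ B ^ j %% B.

Definition hist_digit (T : finType) (n j : nat) (t : T) : nat :=
  j %/ n.+1 ^ enum_rank t %% n.+1.

Lemma sum_hist (T : finType) (n : nat) (F : (T -> nat) -> nat) :
  (forall c c', c =1 c' -> F c = F c') ->
  \sum_(s : {ffun 'I_n -> T}) F (hist s) =
  \sum_(j < n.+1 ^ #|T|) hist_count T n j * F (hist_digit n j).
Proof.
move=> Fext; set B := 2 ^ (#|T| * n).+1.
pose idx (s : {ffun 'I_n -> T}) := \sum_(i < #|T|) hist s (enum_val i) * n.+1 ^ i.
have hn (s : {ffun 'I_n -> T}) t : hist s t < n.+1.
  by rewrite ltnS /hist -[n in _ <= n]card_ord max_card.
have idxT s : idx s = \sum_t hist s t * n.+1 ^ enum_rank t.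
  rewrite /idx (reindex (fun t : T => enum_rank t)); last first.
    by exists enum_val => t _; [apply: enum_rankK | apply: enum_valK].
  by apply: eq_bigr => t _; rewrite enum_rankK.
have digE s : hist_digit n (idx s) =1 hist s.
  move=> t; rewrite /hist_digit /idx (@ord_digit _ _ (fun i => hist s (enum_val i)) (enum_rank t)) //.
  by rewrite enum_rankK.
have cB : #|{: {ffun 'I_n -> T}}| < B.
  rewrite card_ffun card_ord; apply: leq_ltn_trans (_ : 2 ^ (#|T| * n) < _).
    by rewrite expnM; case: (n) => // n'; rewrite leq_exp2r // ltnW // ltn_expl.
  by rewrite ltn_exp2l.
have cntE j : hist_count T n j = #|[set s | idx s == j]|.
  rewrite -(@kronecker _ xpredT idx B j cB) /hist_count -/B; congr (_ %/ _ %% _).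
  have -> : (\sum_(t : T) B ^ (n.+1 ^ enum_rank t)) ^ n =
      \prod_(a < n) \sum_(t : T) B ^ (n.+1 ^ enum_rank t).
    by rewrite prod_nat_const card_ord.
  rewrite bigA_distr_bigA; apply: eq_bigr => s _; rewrite -expn_sum; congr (_ ^ _).
  rewrite idxT (partition_big s xpredT) //=; apply: eq_bigr => t _.
  rewrite (eq_bigr (fun=> n.+1 ^ enum_rank t)); last by move=> a /eqP ->.
  by rewrite -sum_nat_const; apply: eq_bigl => a; rewrite inE.
rewrite (eq_bigr (fun s => F (hist_digit n (idx s)))); last by move=> s _; apply: Fext => t; rewrite digE.
rewrite (@sum_fibers nat _ xpredT idx (n.+1 ^ #|T|) (fun j => F (hist_digit n j))).
  apply: eq_bigr => j _; rewrite cntE.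
  by rewrite mulnC -mulr_natr natn.
by move=> s _; apply: ord_digit_lt => // i; apply: hn.
Qed.

(** * Number of models for each vector of cardinalities *)

Section Count.
Variables (p : nat) (ar : 'I_p -> nat).

(** Exceeds [n ^ ar Q], and with it every cardinality, for all [Q] at once. *)
Definition radix (n : nat) : nat := n.+2 ^ (\sum_Q ar Q).+1.
Definition num_atoms (n : nat) : nat := \sum_Q n ^ ar Q.
Definition base (n : nat) : nat := 2 ^ (num_atoms n).+1.
(** The weighted count has fewer than [base n] terms, each at most [base n ^ (radix n ^ p)], so it
    lies below this number. *)
Definition modulus (n : nat) : nat := base n ^ (radix n ^ p).+1.
Definition zval (n : nat) (Q : 'I_p) : nat := base n ^ (radix n ^ Q).
Definition num_irr (n : nat) (Q : 'I_p) : nat :=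
  n ^ ar Q - ((ar Q == 0) + (n * (0 < ar Q) + 'C(n, 2) * num_mixed ar Q)).

Definition world_index n (w : world ar n) : nat := \sum_Q Ncount w Q * radix n ^ Q.

Lemma Ncount_sum n (w : world ar n) Q : Ncount w Q = \sum_(A in w) (tag A == Q).
Proof.
rewrite /Ncount -sum1_card big_mkcond [RHS]big_mkcond; apply: eq_bigr => A _.
by rewrite inE; case: (A \in w) => //=; case: eqP.
Qed.

Lemma leq_Ncount n (w : world ar n) Q : Ncount w Q <= n ^ ar Q.
Proof. by rewrite Ncount_sum -sum_tag big_mkcond leq_sum // => A _; case: ifP. Qed.

Lemma card_gatom n : #|{: gatom ar n}| = num_atoms n.
Proof.
rewrite -sum1_card (partition_big (fun A : gatom ar n => tag A) xpredT) //=.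
apply: eq_bigr => Q _; rewrite -sum_tag big_mkcond; apply: eq_bigr => A _.
by case: eqP.
Qed.

Lemma card_world n : #|{: world ar n}| < base n.
Proof.
rewrite /base -card_gatom -cardsT -powersetT card_powerset cardsT.
by rewrite ltn_exp2l.
Qed.

Lemma prod_zval n (w : world ar n) : \prod_Q zval n Q ^ Ncount w Q = base n ^ world_index w.
Proof. by rewrite expn_sum; apply: eq_bigr => Q _; rewrite -expnM mulnC. Qed.

Lemma prod_tag n (w : world ar n) : \prod_(A in w) zval n (tag A) = base n ^ world_index w.
Proof.
rewrite -prod_zval (partition_big (fun A : gatom ar n => tag A) xpredT) //=.
apply: eq_bigr => Q _; rewrite (eq_bigr (fun=> zval n Q)); last by move=> A /andP[_ /eqP ->].
by rewrite prod_nat_const; congr (_ ^ _); apply: eq_card => A; rewrite !inE.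
Qed.

Lemma Ncount_radix n (w : world ar n) Q : Ncount w Q < radix n.
Proof.
apply: leq_ltn_trans (leq_Ncount w Q) _; rewrite /radix.
apply: (@leq_ltn_trans (n.+2 ^ ar Q)).
  by case: (ar Q) => // k; rewrite leq_exp2r //; lia.
by rewrite ltn_exp2l // ltnS (bigD1 Q) //= leq_addr.
Qed.

Lemma radix_gt0 n : 0 < radix n. Proof. by rewrite expn_gt0. Qed.

Lemma index_lt n (w : world ar n) : world_index w < radix n ^ p.
Proof. by apply: ord_digit_lt; [apply: radix_gt0 | apply: Ncount_radix]. Qed.

Lemma base_gt1 n : 1 < base n.
Proof. by rewrite -[1](expn0 2) ltn_exp2l. Qed.

Definition Ndigit (n j : nat) (Q : 'I_p) : nat := j %/ radix n ^ Q %% radix n.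

Lemma Ndigit_index n (w : world ar n) Q : Ndigit n (world_index w) Q = Ncount w Q.
Proof. by apply: ord_digit; [apply: radix_gt0 | apply: Ncount_radix]. Qed.

Variable Gamma : fo2form ar.
Hypothesis sentence : is_sentence Gamma.
Notation T := (etype Gamma).

Definition gen_pos (n : nat) : nat :=
  (\prod_Q (1 + zval n Q) ^ num_irr n Q) *
  \sum_(nu : {set 'I_p} | nu \subset nullary ar) (\prod_(Q in nu) zval n Q) *
    \sum_(j < n.+1 ^ #|T|) hist_count T n j *
      hist_nat (cell_nat (modulus n) (zval n) nu) (pair_nat (zval n) nu)
        (hist_digit n j : T -> nat).

(** The cell formula presupposes an element, so the empty domain is separate; there the sum runs
    over a fixed finite set of worlds and is unrolled. *)
Definition gen (n : nat) : nat :=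
  if n == 0 then \sum_(w : world ar 0 | models w Gamma) \prod_Q zval n Q ^ Ncount w Q
  else gen_pos n %% modulus n.

(** Both sides lie below the modulus, so they may be compared in ['Z_M], where [M - 1] plays the
    part of -1. *)
Lemma genE n : gen n = \sum_(w : world ar n | models w Gamma) base n ^ world_index w.
Proof.
rewrite /gen; case: n => [|n].
  by apply: eq_bigr => w _; apply: prod_zval.
set N := n.+1; set M := modulus N; set S := (X in _ = X).
have M1 : 1 < M by rewrite /M /modulus -(exp1n (radix N ^ p).+1) ltn_exp2r // base_gt1.
have SM : S < M.
  apply: (@leq_ltn_trans (#|{: world ar N}| * base N ^ (radix N ^ p))).
    rewrite -sum_nat_const /S big_mkcond; apply: leq_sum => w _; case: ifP => // _.
    by rewrite leq_exp2l ?base_gt1 // ltnW // index_lt.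
  by rewrite /M /modulus expnS ltn_pmul2r ?card_world // expn_gt0 ltnW // base_gt1.
rewrite -[RHS](modn_small SM); apply: (natr_inj_mod M1).
rewrite /S natr_sum.
rewrite (eq_bigr (fun w : world ar N => \prod_(A in w) (zval N (tag A))%:R)%R); last first.
  by move=> w _; rewrite -prod_tag natr_prod.
rewrite (cell_formula (fun Q => (zval N Q)%:R)%R n sentence).
rewrite /gen_pos natrM natr_prod natr_sum; congr (_ * _)%R.
  by apply: eq_bigr => Q _; rewrite natrX natrD.
apply: eq_bigr => nu _; rewrite natrM natr_prod; congr (_ * _)%R.
rewrite -(@sum_hist T N (hist_nat (cell_nat M (zval N) nu) (pair_nat (zval N) nu))); last first.
  by move=> c c'; apply: eq_hist_nat.
rewrite natr_sum; apply: eq_bigr => s _; rewrite hist_natE.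
rewrite /hist_weight; congr (_ * _ * _)%R; apply: eq_bigr => t _.
- by rewrite cell_natE.
- by rewrite pair_natE.
- by rewrite pair_natE.
Qed.

Definition num_worlds (n j : nat) : nat := gen n %/ base n ^ j %% base n.

Lemma num_worldsE n j : num_worlds n j = #|[set w : world ar n | models w Gamma && (world_index w == j)]|.
Proof. by rewrite /num_worlds genE kronecker // card_world. Qed.

End Count.

(** * Weighted counts *)

(** By truncated subtraction one summand of [x] is 0 and the other is the absolute difference.
    Cancelling the gcd gives lowest terms, the form in which the output is encoded. *)
Lemma rat_reduced (q : rat) (P N D : nat) : 0 < D -> q = ((P%:R - N%:R) / D%:R)%R ->
  let x := (P - N) + (N - P) in
  [/\ (numq q < 0)%R = (P < N), `|numq q|%N = x %/ gcdn x D & `|denq q|%N = D %/ gcdn x D].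
Proof.
move=> D0 -> x; set g := gcdn x D.
have g0 : 0 < g by rewrite gcdn_gt0 D0 orbT.
pose y : int := ((-1) ^+ (P < N) * (x %/ g)%:Z)%R.
have D'0 : 0 < D %/ g by rewrite divn_gt0 // dvdn_leq // dvdn_gcdr.
have E : ((P%:R - N%:R) / D%:R = y%:~R / (D %/ g)%:Z%:~R :> rat)%R.
  have -> : (P%:R - N%:R = (-1) ^+ (P < N) * x%:R :> rat)%R.
    rewrite /x; case: ltnP => [lt|le]; rewrite ?expr0 ?expr1 ?mulN1r ?mul1r.
      by rewrite (eqP (ltnW lt : P - N == 0)) add0n natrB ?opprB // ltnW.
    by rewrite (eqP (le : N - P == 0)) addn0 natrB.
  have -> : (x%:R = (x %/ g)%:R * g%:R :> rat)%R by rewrite -natrM divnK ?dvdn_gcdl.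
  have -> : (D%:R = (D %/ g)%:R * g%:R :> rat)%R by rewrite -natrM divnK ?dvdn_gcdr.
  have gR : (g%:R != 0 :> rat)%R by rewrite pnatr_eq0 -lt0n.
  rewrite [X in (X / _)%R]mulrA -mulf_div divff // mulr1 /y intrM rmorphXn rmorphN1.
  by [].
have cop : coprime `|y|%N `|Posz (D %/ g)|%N.
  rewrite /y abszM abszX abszN1 exp1n mul1n !absz_nat /coprime.
  by rewrite -(eqn_pmul2r g0) muln_gcdl !divnK ?dvdn_gcdl ?dvdn_gcdr // mul1n.
rewrite E coprimeq_num // coprimeq_den //.
have -> : (Posz (D %/ g) == 0 :> int)%R = false by rewrite eqz_nat eqn0Ngt D'0.
rewrite gtr0_sg // mul1r absz_nat; split => //; last first.
  by rewrite /y abszM abszX abszN1 exp1n mul1n absz_nat.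
rewrite /y; case: ltnP => [lt|le]; rewrite ?expr0 ?expr1 ?mulN1r ?mul1r //.
rewrite oppr_lt0 ltz_nat divn_gt0 // dvdn_leq ?dvdn_gcdl //.
by rewrite /x addn_gt0 (subn_gt0 P N) lt orbT.
Qed.

Section Weighted.
Variables (p : nat) (ar : 'I_p -> nat) (Gamma : fo2form ar).
Variables (cards : seq ('I_p * cmp * nat)) (funs : seq 'I_p).
Hypothesis sentence : is_sentence Gamma.
Hypothesis funs2 : forall S, S \in funs -> ar S = 2.
Notation Gamma' := (add_total Gamma funs).

Variables (sg sgb a ab b bb : 'I_p -> nat).

Definition ok_counts (n j : nat) : bool :=
  all (fun cc => cmp_holds cc.1.2 (Ndigit ar n j cc.1.1) cc.2) cards &&
  all (fun S => Ndigit ar n j S == n) funs.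

(** Absolute value of the numerator over the common denominator [den]: a world uses [b Q] once per
    true atom and [bb Q] once per false one, and the exponents swapped here are the missing
    factors. *)
Definition magnitude (n j : nat) : nat :=
  \prod_Q (a Q ^ Ndigit ar n j Q * ab Q ^ (n ^ ar Q - Ndigit ar n j Q) *
    (b Q ^ (n ^ ar Q - Ndigit ar n j Q) * bb Q ^ Ndigit ar n j Q)).

Definition sign_exp (n j : nat) : nat :=
  \sum_Q (sg Q * Ndigit ar n j Q + sgb Q * (n ^ ar Q - Ndigit ar n j Q)).

Definition den (n : nat) : nat := \prod_Q (b Q * bb Q) ^ (n ^ ar Q).

(** The total magnitude of the worlds of one sign, grouped by cardinality vector. There are
    polynomially many vectors, and constraints and weights depend on nothing else. *)
Definition part (s : bool) (n : nat) : nat :=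
  \sum_(j < radix ar n ^ p) num_worlds Gamma' n j *
     (ok_counts n j * (magnitude n j * (odd (sign_exp n j) == s))).

Local Open Scope ring_scope.
Variables (wt wbar : 'I_p -> rat).
Hypothesis wtE : forall Q, wt Q = (-1) ^+ sg Q * (a Q)%:R / (b Q)%:R.
Hypothesis wbarE : forall Q, wbar Q = (-1) ^+ sgb Q * (ab Q)%:R / (bb Q)%:R.
Hypothesis b0 : forall Q, (0 < b Q)%N.
Hypothesis bb0 : forall Q, (0 < bb Q)%N.

Lemma den_gt0 n : (0 < den n)%N.
Proof. by rewrite prodn_gt0 // => Q; rewrite expn_gt0 muln_gt0 b0 bb0. Qed.

Lemma world_weight n (w : world ar n) :
  \prod_Q (wt Q ^+ Ncount w Q * wbar Q ^+ (n ^ ar Q - Ncount w Q)%N) =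
  (-1) ^+ sign_exp n (world_index w) * (magnitude n (world_index w))%:R / (den n)%:R.
Proof.
rewrite /sign_exp /magnitude /den -prodrXr !natr_prod -big_split -prodf_div /=.
apply: eq_bigr => Q _; rewrite Ndigit_index wtE wbarE.
have := leq_Ncount w Q; move: (Ncount w Q) (n ^ ar Q)%N => c N cN.
have [d ->] : exists d, N = (c + d)%N by exists (N - c)%N; rewrite subnKC.
have bc : ((b Q)%:R : rat) ^+ c != 0 by rewrite expf_neq0 // pnatr_eq0 -lt0n.
have bd : ((b Q)%:R : rat) ^+ d != 0 by rewrite expf_neq0 // pnatr_eq0 -lt0n.
have bbc : ((bb Q)%:R : rat) ^+ c != 0 by rewrite expf_neq0 // pnatr_eq0 -lt0n.
have bbd : ((bb Q)%:R : rat) ^+ d != 0 by rewrite expf_neq0 // pnatr_eq0 -lt0n.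
rewrite addKn expnD !expnMn !(natrM, natrX) [(-1) ^+ (_ + _)]exprD !exprM !exprMn !exprVn.
move: (_ ^+ c) bc (_ ^+ d) bd (_ ^+ c) bbc (_ ^+ d) bbd => x1 x10 x2 x20 x3 x30 x4 x40.
move: (_ ^+ c) (_ ^+ c) (_ ^+ d) (_ ^+ d) => y1 y2 y3 y4.
by field; rewrite x10 x20 x30 x40.
Qed.

Lemma WFOMC_parts n :
  WFOMC Gamma cards funs wt wbar n = ((part false n)%:R - (part true n)%:R) / (den n)%:R.
Proof.
pose h j : rat := (ok_counts n j)%:R * ((-1) ^+ sign_exp n j * (magnitude n j)%:R / (den n)%:R).
transitivity (\sum_(w : world ar n | models w Gamma') h (world_index w)).
  rewrite /WFOMC big_mkcond [RHS]big_mkcond; apply: eq_bigr => w _.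
  rewrite sat_all_total // /h -world_weight.
  have -> : ok_counts n (world_index w) = all (card_ok w) cards && all (fun S => Ncount w S == n) funs.
    rewrite /ok_counts; congr (_ && _); apply: eq_all => x; last by rewrite Ndigit_index.
    by rewrite /card_ok Ndigit_index.
  by case: models => //=; case: (_ && _); rewrite ?mul1r ?mul0r.
rewrite (sum_fibers (J := radix ar n ^ p) h) => [|w _]; last exact: index_lt.
rewrite /part !natr_sum -sumrB mulr_suml; apply: eq_bigr => j _.
rewrite -num_worldsE; last exact: sentence_add_total.
have E (c o g : nat) (e1 e2 : bool) : ((c * (o * (g * e1)))%:R - (c * (o * (g * e2)))%:R) =
    c%:R * (o%:R * (g%:R * (e1%:R - e2%:R))) :> rat by rewrite !natrM; ring.
rewrite E -[LHS]mulr_natl -[RHS]mulrA; congr (_ * _); rewrite /h -!mulrA; congr (_ * _).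
rewrite mulrCA; congr (_ * _); congr (_ * _).
by rewrite -signr_odd; case: odd; rewrite ?expr1 ?expr0 ?subr0 ?sub0r.
Qed.

End Weighted.

(** * The counting formula in polynomial time *)

(** Here the range is fixed and the sum is unrolled into the program; ranges that depend on the
    input need [PT_sum]. *)
Lemma PT_big_sum k (I : Type) (r : seq I) (P : pred I) (F : I -> seq nat -> nat) :
  (forall i, P i -> PT k (F i)) -> PT k (fun v => \sum_(i <- r | P i) F i v).
Proof.
move=> H; elim: r => [|i r IH].
  by apply: PT_ext (PT_const k 0) => v _; rewrite big_nil.
case Pi : (P i); last by apply: PT_ext IH => v _; rewrite big_cons Pi.
by apply: PT_ext (PT_add (H i Pi) IH) => v _; rewrite big_cons Pi.
Qed.

Lemma PT_big_prod k (I : Type) (r : seq I) (P : pred I) (F : I -> seq nat -> nat) :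
  (forall i, P i -> PT k (F i)) -> PT k (fun v => \prod_(i <- r | P i) F i v).
Proof.
move=> H; elim: r => [|i r IH].
  by apply: PT_ext (PT_const k 1) => v _; rewrite big_nil.
case Pi : (P i); last by apply: PT_ext IH => v _; rewrite big_cons Pi.
by apply: PT_ext (PT_mul (H i Pi) IH) => v _; rewrite big_cons Pi.
Qed.

Lemma PT_all k (I : Type) (r : seq I) (b : I -> seq nat -> bool) :
  (forall i, PT k (fun v => nat_of_bool (b i v))) ->
  PT k (fun v => nat_of_bool (all (b^~ v) r)).
Proof.
move=> H; elim: r => [|i r IH]; first exact: PT_const.
exact: PT_and.
Qed.

Definition PTS k f := PT k f /\ small k f.

Lemma PTS_const k n : PTS k (fun=> n).
Proof. by split; [apply: PT_const | apply: small_const]. Qed.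

Lemma PTS_mul k f g : PTS k f -> PTS k g -> PTS k (fun v => f v * g v).
Proof. by move=> [? ?] [? ?]; split; [apply: PT_mul | apply: small_mul]. Qed.

Lemma PTS_S k f : PTS k f -> PTS k (fun v => (f v).+1).
Proof. by move=> [? ?]; split; [apply: PT_S | apply: small_S]. Qed.

Lemma PTS_leq k f g : PT k f -> small k g -> (forall v, f v <= g v) -> PTS k f.
Proof. by move=> Hf Hg le; split => //; apply: small_leq Hg => v _. Qed.

Lemma PTS_sub k f g : PTS k f -> PT k g -> PTS k (fun v => f v - g v).
Proof.
by move=> [Pf Sf] Hg; apply: PTS_leq (PT_sub Pf Hg) Sf _ => v; apply: leq_subr.
Qed.

Lemma PTS_div k f g : PTS k f -> PT k g -> PTS k (fun v => f v %/ g v).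
Proof.
by move=> [Pf Sf] Hg; apply: PTS_leq (PT_div Pf Hg) Sf _ => v; apply: leq_div.
Qed.

Lemma PTS_mod k f g : PTS k f -> PT k g -> PTS k (fun v => f v %% g v).
Proof.
by move=> [Pf Sf] Hg; apply: PTS_leq (PT_mod Pf Hg) Sf _ => v; apply: leq_mod.
Qed.

Lemma PTS_half k f : PTS k f -> PTS k (fun v => (f v)./2).
Proof.
by move=> [Pf Sf]; apply: PTS_leq (PT_half Pf) Sf _ => v; lia.
Qed.

Lemma PTS_expc k f n : PTS k f -> PTS k (fun v => f v ^ n).
Proof.
move=> [Pf Sf]; split; last exact: small_exp.
by apply: PT_exp => //; [apply: PT_const | apply: small_const].
Qed.

Lemma PTS_big_sum k (I : Type) (r : seq I) (P : pred I) (F : I -> seq nat -> nat) :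
  (forall i, P i -> PTS k (F i)) -> PTS k (fun v => \sum_(i <- r | P i) F i v).
Proof.
move=> H; split; first by apply: PT_big_sum => i /H[].
elim: r => [|i r IH].
  by apply: small_leq (small_const k 0) => v _; rewrite big_nil.
case Pi : (P i); last by apply: small_leq IH => v _; rewrite big_cons Pi.
by apply: small_leq (small_add (H i Pi).2 IH) => v _; rewrite big_cons Pi.
Qed.

Lemma PTS_behead k f : PTS k f -> PTS k.+1 (fun w => f (behead w)).
Proof. by move=> [? ?]; split; [apply: PT_behead | apply: small_behead]. Qed.

Lemma PTS_pow k f g : PT k f -> PTS k g -> PT k (fun v => f v ^ g v).
Proof. by move=> Hf [? ?]; apply: PT_exp. Qed.

(* In the summand the index is cut off at its bound, so that it may serve as
   an exponent. *)
Lemma PT_sum_clip k (F : nat -> seq nat -> nat) g : PTS k g ->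
  (forall J, PTS k.+1 J -> PT k.+1 (fun w => F (J w) (behead w))) ->
  PT k (fun v => \sum_(j < g v) F j v).
Proof.
move=> [Pg Sg] HF; pose J w := minn (nth 0 w 0) (g (behead w)).
have HJ : PTS k.+1 J.
  split; last by apply: small_leq (small_behead Sg) => v _; apply: geq_minr.
  by apply: PT_min; [apply: PT_var | apply: (PT_behead Pg)].
apply: PT_ext (PT_sum (HF J HJ) Pg Sg) => v _.
by apply: eq_bigr => j _; rewrite /J /= (minn_idPl _) // ltnW.
Qed.

Lemma PT_hist_nat k (T : finType) u r c :
  (forall t : T, PT k (u t)) -> (forall t t', PT k (r t t')) -> (forall t, PTS k (c t)) ->
  PT k (fun v => hist_nat (fun t => u t v) (fun t t' => r t t' v) (fun t => c t v)).
Proof.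
move=> Hu Hr Hc; rewrite /hist_nat.
apply: PT_mul; first apply: PT_mul; apply: PT_big_prod => t _; apply: PTS_pow => //.
- have H := PTS_half (PTS_mul (Hc t) (PTS_sub (Hc t) (PT_const k 1))).
  by split; [apply: PT_ext H.1 | apply: small_leq H.2] => v _; rewrite bin2 subn1.
- exact: PTS_mul.
Qed.

Section Formula.
Variables (p : nat) (ar : 'I_p -> nat) (k : nat).

Lemma PTS_radix nf : PTS k nf -> PTS k (fun v => radix ar (nf v)).
Proof. by move=> H; apply: PTS_expc; do 2!apply: PTS_S. Qed.

Lemma PTS_num_atoms nf : PTS k nf -> PTS k (fun v => num_atoms ar (nf v)).
Proof. by move=> H; apply: PTS_big_sum => Q _; apply: PTS_expc. Qed.

Lemma PT_base nf : PTS k nf -> PT k (fun v => base ar (nf v)).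
Proof. by move=> H; apply: PTS_pow (PT_const k 2) (PTS_S (PTS_num_atoms H)). Qed.

Lemma PT_modulus nf : PTS k nf -> PT k (fun v => modulus ar (nf v)).
Proof.
by move=> H; apply: PTS_pow (PT_base H) (PTS_S (PTS_expc p (PTS_radix H))).
Qed.

Lemma PT_zval nf Q : PTS k nf -> PT k (fun v => zval ar (nf v) Q).
Proof. by move=> H; apply: PTS_pow (PT_base H) (PTS_expc Q (PTS_radix H)). Qed.

Lemma PTS_num_irr nf Q : PTS k nf -> PTS k (fun v => num_irr ar (nf v) Q).
Proof.
move=> H; apply: PTS_sub; first exact: PTS_expc.
have HC : PT k (fun v => 'C(nf v, 2)).
  have H1 := PTS_half (PTS_mul H (PTS_sub H (PT_const k 1))).
  by apply: PT_ext H1.1 => v _; rewrite bin2 subn1.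
apply: PT_add (PT_const k _) _; apply: PT_add.
  exact: PT_mul H.1 (PT_const k _).
exact: PT_mul HC (PT_const k _).
Qed.

Lemma PTS_Ndigit nf jf Q : PTS k nf -> PTS k jf ->
  PTS k (fun v => Ndigit ar (nf v) (jf v) Q).
Proof.
move=> Hn Hj; have Hr := PTS_radix Hn.
by apply: PTS_mod Hr.1; apply: PTS_div Hj _; apply: (PTS_expc Q Hr).1.
Qed.

Variable Gamma : fo2form ar.
Notation T := (etype Gamma).

Lemma PT_cell_nat M z nu (t : T) : PT k M -> (forall Q, PT k (z Q)) ->
  PT k (fun v => cell_nat (M v) (fun Q => z Q v) nu t).
Proof.
move=> HM Hz; apply: PT_mul (PT_const k _); apply: PT_mul; apply: PT_big_prod => i _ //.
rewrite /kappa_nat; case: (t.1.1 i); case: (t.1.2 i); try exact: PT_const.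
exact: PT_sub HM (PT_const k 1).
Qed.

Lemma PT_pair_nat z nu (t t' : T) : (forall Q, PT k (z Q)) ->
  PT k (fun v => pair_nat (fun Q => z Q v) nu t t').
Proof.
move=> Hz; apply: PT_big_sum => P _; apply: PT_mul (PT_const k _).
by apply: PT_big_prod.
Qed.

Lemma PTS_hist_digit nf jf (t : T) : PTS k nf -> PTS k jf ->
  PTS k (fun v => hist_digit (nf v) (jf v) t).
Proof.
move=> Hn Hj; have HS := PTS_S Hn.
by apply: PTS_mod HS.1; apply: PTS_div Hj _; apply: (PTS_expc _ HS).1.
Qed.

Lemma PT_hist_count nf jf : PTS k nf -> PTS k jf ->
  PT k (fun v => hist_count T (nf v) (jf v)).
Proof.
move=> Hn Hj.
have HB : PT k (fun v => 2 ^ (#|T| * nf v).+1).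
  by apply: PTS_pow (PT_const k 2) _; apply: PTS_S; apply: PTS_mul Hn; apply: PTS_const.
apply: PT_mod => //; apply: PT_div; last exact: PTS_pow.
apply: PTS_pow => //; apply: PT_big_sum => t _; apply: PTS_pow => //.
by apply: PTS_expc; apply: PTS_S.
Qed.

End Formula.

Lemma PT_gen p (ar : 'I_p -> nat) (Gamma : fo2form ar) k nf :
  PTS k nf -> PT k (fun v => gen Gamma (nf v)).
Proof.
move=> Hn; rewrite /gen.
have Hz Q : PT k (fun v => zval ar (nf v) Q) by apply: PT_zval.
apply: PT_ite; first by apply: PT_eq Hn.1 (PT_const k 0).
  by apply: PT_big_sum => w _; apply: PT_big_prod => Q _; apply: PTS_pow => //; apply: PTS_const.
apply: PT_mod; last exact: PT_modulus.
apply: PT_mul.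
  apply: PT_big_prod => Q _; apply: PTS_pow; last exact: PTS_num_irr.
  exact: PT_add (PT_const k 1) (Hz Q).
apply: PT_big_sum => nu _; apply: PT_mul; first by apply: PT_big_prod.
apply: (PT_sum_clip (F := fun j v => hist_count (etype Gamma) (nf v) j *
   hist_nat (cell_nat (modulus ar (nf v)) (zval ar (nf v)) nu) (pair_nat (zval ar (nf v)) nu)
        (hist_digit (nf v) j : etype Gamma -> nat))).
  by apply: PTS_expc; apply: PTS_S.
move=> J HJ; have Hn' := PTS_behead Hn.
apply: PT_mul; first exact: PT_hist_count.
apply: (PT_hist_nat
  (u := fun t w => cell_nat (modulus ar (nf (behead w))) (zval ar (nf (behead w))) nu t)
  (r := fun t t' w => pair_nat (zval ar (nf (behead w))) nu t t')
  (c := fun t w => hist_digit (nf (behead w)) (J w) t)).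
- move=> t; apply: (@PT_cell_nat _ _ _ _ _ (fun Q w => zval ar (nf (behead w)) Q)) => [|Q].
    exact: (PT_modulus ar Hn').
  exact: (PT_zval ar Q Hn').
- move=> t t'; apply: (@PT_pair_nat _ _ _ _ (fun Q w => zval ar (nf (behead w)) Q)) => Q.
  exact: (PT_zval ar Q Hn').
- by move=> t; apply: (@PTS_hist_digit _ _ _ _ (fun w => nf (behead w))).
Qed.

Lemma PT_num_worlds p (ar : 'I_p -> nat) (Gamma : fo2form ar) k nf jf :
  PTS k nf -> PTS k jf -> PT k (fun v => num_worlds Gamma (nf v) (jf v)).
Proof.
move=> Hn Hj; have Hb := PT_base ar Hn.
by apply: PT_mod => //; apply: PT_div; [apply: PT_gen | apply: PTS_pow].
Qed.

Lemma PT_cmp k c f n : PT k f -> PT k (fun v => nat_of_bool (cmp_holds c (f v) n)).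
Proof.
move=> Hf; have Hc := PT_const k n.
by case: c; [apply: PT_eq | apply: PT_leq | apply: PT_leq | apply: PT_ltn | apply: PT_ltn].
Qed.

Lemma PT_den p (ar : 'I_p -> nat) k b bb nf : PTS k nf ->
  (forall Q, PT k (b Q)) -> (forall Q, PT k (bb Q)) ->
  PT k (fun v => den ar (fun Q => b Q v) (fun Q => bb Q v) (nf v)).
Proof.
move=> Hn Hb Hbb; apply: PT_big_prod => Q _; apply: PTS_pow; last exact: PTS_expc.
exact: PT_mul.
Qed.

Lemma PT_part p (ar : 'I_p -> nat) (Gamma : fo2form ar) cards funs
    k sg sgb a ab b bb s nf : PTS k nf ->
  (forall Q, PTS k (sg Q)) -> (forall Q, PTS k (sgb Q)) ->
  (forall Q, PT k (a Q)) -> (forall Q, PT k (ab Q)) ->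
  (forall Q, PT k (b Q)) -> (forall Q, PT k (bb Q)) ->
  PT k (fun v => part Gamma cards funs (fun Q => sg Q v) (fun Q => sgb Q v)
    (fun Q => a Q v) (fun Q => ab Q v) (fun Q => b Q v) (fun Q => bb Q v) s (nf v)).
Proof.
move=> Hn Hsg Hsgb Ha Hab Hb Hbb.
apply: (PT_sum_clip (F := fun j v => num_worlds (add_total Gamma funs) (nf v) j *
     (ok_counts ar cards funs (nf v) j * (magnitude ar (fun Q => a Q v) (fun Q => ab Q v)
        (fun Q => b Q v) (fun Q => bb Q v) (nf v) j *
       (odd (sign_exp ar (fun Q => sg Q v) (fun Q => sgb Q v) (nf v) j) == s))))).
  by apply: PTS_expc; apply: PTS_radix.
move=> J HJ; have Hn' := PTS_behead Hn.
have HD Q := PTS_Ndigit ar Q Hn' HJ.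
have HS Q := PTS_sub (PTS_expc (ar Q) Hn') (HD Q).1.
apply: PT_mul; first exact: (PT_num_worlds _ Hn' HJ).
apply: PT_mul.
  apply: PT_and; first by apply: (@PT_all _ _ cards
      (fun cc w => cmp_holds cc.1.2 (Ndigit ar (nf (behead w)) (J w) cc.1.1) cc.2)) => cc; apply: PT_cmp (HD _).1.
  by apply: (@PT_all _ _ funs
      (fun S w => Ndigit ar (nf (behead w)) (J w) S == nf (behead w))) => S; apply: PT_eq (HD _).1 Hn'.1.
apply: PT_mul.
  apply: PT_big_prod => Q _.
  by apply: PT_mul; apply: PT_mul; apply: PTS_pow => //; apply: PT_behead.
have HG : PT k.+1 (fun w => sign_exp ar (fun Q => sg Q (behead w)) (fun Q => sgb Q (behead w))
    (nf (behead w)) (J w)).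
  apply: PT_big_sum => Q _; apply: PT_add.
    exact: PT_mul (PT_behead (Hsg Q).1) (HD Q).1.
  exact: PT_mul (PT_behead (Hsgb Q).1) (HS Q).1.
case: s.
  by apply: PT_ext (PT_odd HG (PT_const _ 0) (PT_const _ 1)) => w _; case: odd.
by apply: PT_ext (PT_odd HG (PT_const _ 1) (PT_const _ 0)) => w _; case: odd.
Qed.

(** * Input, output and the main theorem *)

Definition canon (s : seq bool) : seq bool := foldr cons_bit [::] s.

Lemma size_canon s : size (canon s) <= size s.
Proof. by elim: s => //= b s IH; apply: leq_trans (size_cons_bit _ _) _. Qed.

(** Each round copies the last stack to the front, which strips leading zeros, and deletes the
    original; [K] rounds restore the order. The tape bound at most doubles, plus one, per round, and
    [K] is constant. *)
Lemma canon_stacks K i : i <= K -> exists (F : frag unit) (f : nat -> nat), poly f /\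
  forall m1 m2 T, size m2 = i -> size (m1 ++ m2) = K -> size (enc (m1 ++ m2)) <= T ->
    runs F (stacks (m1 ++ m2)) (f T) tt (stacks (map canon m2 ++ m1)).
Proof.
elim: i => [|i IH] iK.
  exists (nop tt), (fun=> 5); split; first exact: poly_const.
  by move=> m1 [|//] T _ _ _; rewrite cats0; apply: runs_nop.
have [F [f [polyf HF]]] := IH (ltnW iK).
exists (bind (copy_stack K.-1) (fun _ => bind (drop_stack K) (fun _ => F))).
exists (fun x => (x + 10) * (100 * x + 1000) + ((x.+1 * (8 * (2 * x + 1) + 40)) + f (2 * x + 1))).
split.
  have pf : poly (fun x => f (2 * x + 1)) by apply: (poly_comp polyf); polytac.
  by polytac.
move=> m1 m2 T; case/lastP: m2 => // m2 s; rewrite size_rcons => -[sm2].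
rewrite -cats1 !catA !size_cat /= addn1 => sK leT.
have sK1 : size (m1 ++ m2) = K.-1 by rewrite -sK size_cat.
have ss : size s <= T by move: leT; rewrite !size_enc /=; lia.
have leT2 : size (enc (canon s :: (m1 ++ m2) ++ [:: s])) <= 2 * T + 1.
  by move: leT; rewrite !size_enc; have := size_canon s; lia.
have H1 := @runs_copy (m1 ++ m2) s [::] T leT; rewrite sK1 in H1.
apply: (runs_bind H1).
have H2 := @runs_drop (canon s :: m1 ++ m2) s [::] _ leT2.
rewrite /= sK1 prednK ?cats0 -?sK // in H2.
have H3 : runs (drop_stack K) (stacks (canon s :: (m1 ++ m2) ++ [:: s]))
   (T.+1 * (8 * (2 * T + 1) + 40)) tt (stacks (canon s :: m1 ++ m2)).
  rewrite -sK; apply: (runs_leq H2); rewrite leq_mul2r ltnS ss orbT //.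
apply: (runs_bind H3).
have := HF (canon s :: m1) m2 (2 * T + 1) sm2; rewrite map_cat -catA /=; apply.
  by rewrite /= size_cat -sK.
apply: leq_trans leT2; rewrite /= !size_enc /=; lia.
Qed.

Lemma canon_memory K : exists (F : frag unit) (c : nat), forall m, size m = K ->
  runs F (stacks m) ((size (enc m)).+2 ^ c) tt (nmem (map bits_val m)).
Proof.
have [F [f [[c Hc] HF]]] := canon_stacks (leqnn K).
exists F, c => m sm; have := HF [::] m _ sm sm (leqnn _).
rewrite cats0 /nmem -map_comp (eq_map bits_of_val) => H.
exact: (runs_leq H).
Qed.

Lemma tsize_vals m : tsize (map bits_val m) <= size (enc m).
Proof.
rewrite /tsize -map_comp (eq_map bits_of_val).
by elim: m => //= s m IH; rewrite !size_enc_cons; have := size_canon s; rewrite /canon; lia.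
Qed.

Definition erase_step (a : sym) : option unit * sym * dir :=
  if a is Sep then (Some tt, Blank, DL) else (None, a, DR).

(** Blanking the separator behind the second stack ends the output there. The first stack holds sign
    and numerator as one number; it is empty only for numerator 0, whose encoding is a sign bit and
    a digit 0, hence the two inserted zeros. *)
Definition finish : frag unit :=
  bind (peek 0) (fun o =>
    bind (if o is None then bind (ins 0 false tt) (fun _ => ins 0 false tt) else nop tt)
      (fun _ => bind (at_stack 1 (floop (act erase_step))) (fun _ => home tt))).

Lemma runs_erase l s w :
  runs (floop (act erase_step)) (l, map sbit s ++ Sep :: w) (size s).+1 tt
    (behead (catrev (map sbit s) l),
     consb (head Blank (catrev (map sbit s) l)) (consb Blank w)).
Proof.
elim: s l => [|b s IH] l.
  exact: (runs_loop_exit (runs_act erase_step (l, Sep :: w))).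
apply: runs_leq (_ : 1 + (size s).+1 <= _) => //; apply: runs_loop_next (IH _).
have := runs_act erase_step (l, sbit b :: map sbit s ++ Sep :: w).
by case: b.
Qed.

Lemma find_nonblank u w : all nonblank u -> (w = [::] \/ head Sep w = Blank) ->
  take (find is_blank (u ++ w)) (u ++ w) = u.
Proof.
move=> nbu Hw; have nf : has is_blank u = false.
  by apply/negbTE; rewrite -all_predC.
rewrite find_cat nf; case: Hw => [->|]; first by rewrite addn0 cats0 take_size.
by case: w => [|a w] //= ->; rewrite addn0 take_size_cat.
Qed.

Lemma runs_finish s1 s2 m T : size (enc [:: s1, s2 & m]) <= T -> exists2 tp,
  runs finish (stacks [:: s1, s2 & m]) (30 * T + 200) tt tp &
  take (find is_blank tp.2) tp.2 =
    map sbit (if nilp s1 then [:: false; false] else s1) ++ Sep :: map sbit s2.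
Proof.
move=> leT; set s1' := if nilp s1 then _ else _.
have leT' : size (enc [:: s1', s2 & m]) <= T + 2.
  by move: leT; rewrite /s1' !size_enc_cons; case: s1 {s1'} => [|? ?] /=; lia.
have H1 := @runs_peek [::] s1 (s2 :: m) T leT.
have H2 : runs (if ohead s1 is None then bind (ins 0 false tt) (fun _ => ins 0 false tt) else nop tt)
    (stacks [:: s1, s2 & m]) (8 * T + 60) tt (stacks [:: s1', s2 & m]).
  rewrite /s1'; case: (s1) leT => [|b s] leT1 /=; last by apply: (runs_leq (runs_nop _ _)); lia.
  apply: (@runs_leq _ _ _ ((4 * T + 20) + (4 * (T + 1) + 20))); last lia.
  apply: (runs_bind (@runs_ins _ tt false [::] [::] (s2 :: m) T leT1)).
  apply: (@runs_ins _ tt false [::] [:: false] (s2 :: m)).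
  by move: leT1; rewrite /= !size_enc_cons /=; lia.
pose l2 := catrev (map sbit s2) (catrev (enc [:: s1']) [::]).
have H3 := @runs_at _ _ [:: s1'] [::] _ _ _ _
  (runs_erase (catrev (enc [:: s1']) [::]) s2 (enc m)).
have nbl : all nonblank l2 by rewrite !all_catrev ?nonblank_bits ?nonblank_enc.
have sl : size l2 = size s1' + size s2 + 1.
  by rewrite !size_catrev size_map enc_cons size_cat size_map /=; lia.
pose r2 := consb (head Blank l2) (consb Blank (enc m)).
case El : l2 => [|x l3]; first by move: sl; rewrite El /=; lia.
have /andP[nbx nbl3] : nonblank x && all nonblank l3 by move: nbl; rewrite El.
have Er : r2 = x :: consb Blank (enc m) by rewrite /r2 El /= consb_nb.
have cr : canonical r2 by rewrite /canonical Er /= consb_nb.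
have nbl4 : all nonblank (behead l2) by rewrite El.
have H4 := runs_home tt nbl4 cr.
exists ([::], catrev (behead l2) r2).
  apply: (@runs_leq _ _ _ ((4 * T + 20) + ((8 * T + 60) +
     ((size (enc [:: s1']) + (size s2).+1) + (size (behead l2)).+3)))).
    apply: (runs_bind H1); apply: (runs_bind H2).
    have E12 : enc [:: s1', s2 & m] = enc [:: s1'] ++ map sbit s2 ++ Sep :: enc m.
      by rewrite !enc_cons /= -catA.
    by rewrite /stacks E12; apply: (runs_bind H3); exact: H4.
  move: leT'; rewrite size_behead sl !size_enc_cons /=; lia.
have -> : catrev (behead l2) r2 =
    (map sbit s1' ++ Sep :: map sbit s2) ++ consb Blank (enc m).
  rewrite Er El /= -[catrev l3 _]/(catrev (x :: l3) _) -El /l2 !catrevE !rev_cat !revK.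
  by rewrite cat0s cats0 cat_rcons -!catA.
apply: find_nonblank; first by rewrite all_cat /= !nonblank_bits.
by case: (enc m); [left | right].
Qed.

Definition nat_bits (m : nat) : seq bool :=
  [seq odd (m %/ 2 ^ i) | i <- iota 0 (trunc_log 2 m).+1].

Lemma enc_natE m : enc_nat m = map sbit (nat_bits m).
Proof. by rewrite /enc_nat /nat_bits -map_comp. Qed.

Lemma nat_bits_pos m : 0 < m -> nat_bits m = bits m.
Proof. by rewrite /bits lt0n => /negbTE ->. Qed.

Lemma val_nat_bits m : bits_val (nat_bits m) = m.
Proof.
by case: m => [|m]; [rewrite /nat_bits /= | rewrite nat_bits_pos // bits_valK].
Qed.

Definition rat_stacks (q : rat) : seq (seq bool) :=
  [:: (numq q < 0)%R :: nat_bits `|numq q|; nat_bits `|denq q|].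

Definition input_stacks p (n : nat) (wt wbar : 'I_p -> rat) : seq (seq bool) :=
  nseq n true :: flatten [seq rat_stacks (wt Q) ++ rat_stacks (wbar Q) | Q <- enum 'I_p].

Lemma enc_rat_stacks q : enc (rat_stacks q) = enc_rat q ++ [:: Sep].
Proof.
rewrite /rat_stacks !enc_cons /enc_rat /enc_int !enc_natE /= -catA.
by case: (_ < _)%R.
Qed.

Lemma enc_input_stacks p n (wt wbar : 'I_p -> rat) :
  enc (input_stacks n wt wbar) = enc_input n wt wbar.
Proof.
rewrite /input_stacks enc_cons map_nseq /enc_input; congr (_ ++ Sep :: _).
elim: (enum 'I_p) => // Q s IH.
rewrite -[LHS]/(enc ((rat_stacks (wt Q) ++ rat_stacks (wbar Q)) ++ flatten _)).
rewrite -[RHS]/((enc_rat (wt Q) ++ Sep :: enc_rat (wbar Q) ++ [:: Sep]) ++ flatten _).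
rewrite !enc_cat IH !enc_rat_stacks; move: (enc_rat _) (enc_rat _) (flatten _) => u1 u2 u3.
by rewrite -!catA /= -!catA.
Qed.

(** Entry 0 belongs to the domain size. Each predicate has four entries, two per weight, since no
    separator divides the sign from the numerator. *)
Definition reg p (v : seq nat) (i : nat) (Q : 'I_p) : nat := nth 0 v (4 * Q + i).+1.

Lemma nth_flatten4 (S : Type) (x0 : S) (f : nat -> seq S) n k q i :
  (forall j, size (f j) = 4) -> q < n -> i < 4 ->
  nth x0 (flatten [seq f j | j <- iota k n]) (4 * q + i) = nth x0 (f (k + q)) i.
Proof.
move=> sf; elim: n k q => // n IH k [|q] qn i4 /=; rewrite nth_cat sf.
  by rewrite muln0 add0n i4 addn0.
rewrite ltnNge (_ : 4 <= 4 * q.+1 + i) /=; last by lia.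
have -> : 4 * q.+1 + i - 4 = 4 * q + i by lia.
by rewrite IH // addSnnS.
Qed.

Lemma reg_input p n (wt wbar : 'I_p -> rat) (Q : 'I_p) :
  let v := map bits_val (input_stacks n wt wbar) in
  [/\ reg v 0 Q = (numq (wt Q) < 0)%R + (`|numq (wt Q)|%N).*2, reg v 1 Q = `|denq (wt Q)|%N,
      reg v 2 Q = (numq (wbar Q) < 0)%R + (`|numq (wbar Q)|%N).*2 & reg v 3 Q = `|denq (wbar Q)|%N].
Proof.
pose f (R : 'I_p) := map bits_val (rat_stacks (wt R) ++ rat_stacks (wbar R)).
have E i : i < 4 -> nth 0 (flatten [seq f R | R <- enum 'I_p]) (4 * Q + i) = nth 0 (f Q) i.
  move=> i4; have -> : [seq f R | R <- enum 'I_p] =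
      [seq (if insub j is Some R then f R else nseq 4 0) | j <- iota 0 p].
    rewrite -val_enum_ord -map_comp; apply: eq_map => R /=.
    by rewrite valK.
  rewrite (@nth_flatten4 _ 0 (fun j => if insub j is Some R then f R else nseq 4 0)) //.
    by rewrite add0n valK.
  by move=> j; case: insub.
have Ev : map bits_val (input_stacks n wt wbar) = bits_val (nseq n true) ::
    flatten [seq f R | R <- enum 'I_p].
  by rewrite /input_stacks map_cons map_flatten -map_comp.
rewrite /reg Ev; split; rewrite [LHS]E //; try exact: val_nat_bits.
- by rewrite -[LHS]/(_ + (bits_val (nat_bits _)).*2) val_nat_bits.
- by rewrite -[LHS]/(_ + (bits_val (nat_bits _)).*2) val_nat_bits.
Qed.

Lemma size_input p n (wt wbar : 'I_p -> rat) : size (input_stacks n wt wbar) = (4 * p).+1.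
Proof.
rewrite /input_stacks /= size_flatten /shape -map_comp (eq_map (g := fun _ => 4)) //.
have -> : forall s : seq 'I_p, sumn [seq 4 | _ <- s] = 4 * size s.
  by elim=> //= _ s ->; rewrite mulnS.
by rewrite size_enum_ord.
Qed.

(** The unary domain size is read as the binary number [2 ^ n - 1], whose bit length returns [n] and
    is bounded by the tape size. *)
Lemma nval_input p n (wt wbar : 'I_p -> rat) :
  bitlen (nth 0 (map bits_val (input_stacks n wt wbar)) 0) = n.
Proof.
rewrite /= /bitlen bits_of_val; suff -> : foldr cons_bit [::] (nseq n true) = nseq n true.
  by rewrite size_nseq.
by elim: n => //= n ->.
Qed.

Lemma rat_split (q : rat) :
  (q = (-1) ^+ (numq q < 0)%R * (`|numq q|%N)%:R / (`|denq q|%N)%:R)%R.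
Proof.
rewrite -{1}(divq_num_den q) {1}(intEsign (numq q)) -{1}(absz_denq q).
by rewrite rmorphM rmorphXn rmorphN1.
Qed.

Lemma stacks_nat_bits (s : bool) X Y : (X = 0 -> s = false) -> 0 < Y ->
  map sbit (if nilp (bits (s + X.*2)) then [:: false; false] else bits (s + X.*2)) ++
    Sep :: map sbit (bits Y) =
  ((if s then One else Zero) :: map sbit (nat_bits X)) ++ Sep :: map sbit (nat_bits Y).
Proof.
move=> s0 Y0; rewrite (nat_bits_pos Y0); congr (_ ++ _); rewrite bits_cons.
have [X0|X0] := posnP X; first by rewrite X0 s0.
by rewrite nat_bits_pos // bits_half // /cons_bit andbF.
Qed.

Lemma enc_rat_bits (q : rat) (P N D : nat) : 0 < D -> q = ((P%:R - N%:R) / D%:R)%R ->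
  let x := (P - N) + (N - P) in let o := (P < N) + (x %/ gcdn x D).*2 in
  map sbit (if nilp (bits o) then [:: false; false] else bits o) ++
    Sep :: map sbit (bits (D %/ gcdn x D)) = enc_rat q.
Proof.
move=> D0 E x o; have [s1 s2 s3] := rat_reduced D0 E.
rewrite /enc_rat /enc_int !enc_natE s1 s2 s3 -/x.
have g0 : 0 < gcdn x D by rewrite gcdn_gt0 D0 orbT.
apply: stacks_nat_bits; last by rewrite divn_gt0 // dvdn_leq // dvdn_gcdr.
move=> x0; apply/negbTE; rewrite -leqNgt -subn_eq0.
have : x == 0 by rewrite -(divnK (dvdn_gcdl x D)) x0.
by rewrite addn_eq0 => /andP[].
Qed.

Lemma reg_index p (Q : 'I_p) i : i < 4 -> (4 * Q + i).+1 < (4 * p).+1.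
Proof. by have := ltn_ord Q; lia. Qed.

Theorem theorem1 (p : nat) (ar : 'I_p -> nat) (Gamma : fo2form ar)
  (cards : seq ('I_p * cmp * nat)) (funs : seq 'I_p) :
  is_sentence Gamma ->
  (forall S, S \in funs -> ar S = 2) ->
  exists M : TM, exists c : nat,
    forall (n : nat) (wt wbar : 'I_p -> rat),
      exists t : nat,
        t <= (size (enc_input n wt wbar)).+2 ^ c /\
        halts_with M t (enc_input n wt wbar)
                   (enc_rat (WFOMC Gamma cards funs wt wbar n)).
Proof.
move=> sentence funs2; pose K := (4 * p).+1.
pose sg v (Q : 'I_p) : nat := odd (reg v 0 Q).
pose sgb v (Q : 'I_p) : nat := odd (reg v 2 Q).
pose a v (Q : 'I_p) := (reg v 0 Q)./2.
pose ab v (Q : 'I_p) := (reg v 2 Q)./2.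
pose b v (Q : 'I_p) := reg v 1 Q.
pose bb v (Q : 'I_p) := reg v 3 Q.
pose nf v := bitlen (nth 0 v 0).
pose P s v := part Gamma cards funs (sg v) (sgb v) (a v) (ab v) (b v) (bb v) s (nf v).
pose D v := den ar (b v) (bb v) (nf v).
pose x v := (P false v - P true v) + (P true v - P false v).
pose g v := gcdn (x v) (D v).
(* Sign and numerator again share one number, the sign being the lowest bit, as the encoding
   demands. *)
pose onum v := (P false v < P true v) + (x v %/ g v).*2.
pose oden v := D v %/ g v.
have Hreg i (Q : 'I_p) : i < 4 -> PT K (fun v => reg v i Q).
  by move=> i4; apply: (@PT_var K (4 * Q + i).+1); apply: reg_index.
have Hodd i (Q : 'I_p) : i < 4 -> PTS K (fun v => nat_of_bool (odd (reg v i Q))).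
  move=> i4; split.
    by apply: PT_ext (PT_odd (Hreg i Q i4) (PT_const _ 0) (PT_const _ 1)) => v _; case: odd.
  by apply: small_leq (small_const K 1) => v _; case: odd.
have Hn : PTS K nf.
  have HV : PT K (fun v => nth 0 v 0) by apply: PT_var.
  by split; [apply: PT_bitlen | apply: small_bitlen].
have HP s : PT K (P s).
  by apply: (@PT_part p ar Gamma cards funs K (fun Q v => sg v Q) (fun Q v => sgb v Q)
    (fun Q v => a v Q) (fun Q v => ab v Q) (fun Q v => b v Q) (fun Q v => bb v Q)) => // Q;
    [apply: Hodd | apply: Hodd | apply: PT_half; apply: Hreg | apply: PT_half; apply: Hreg
    | apply: Hreg | apply: Hreg].
have HD : PT K D.
  by apply: (@PT_den p ar K (fun Q v => b v Q) (fun Q v => bb v Q)) => // Q; apply: Hreg.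
have Hx : PT K x by apply: PT_add; apply: PT_sub.
have Hg : PT K g by apply: PT_gcd.
have Hon : PT K onum.
  apply: PT_add; first exact: PT_ltn.
  by apply: (PT_push false); apply: PT_div.
have Hod : PT K oden by apply: PT_div.
have Hout : PTV K (fun v => [:: onum v; oden v] ++ v).
  by apply: (@PTV_args K [:: onum; oden]).
have [F1 [c1 H1]] := canon_memory K.
have [c3 Hsize] := PTV_size Hout.
have [F2 [c2 H2]] := Hout.
pose F := bind F1 (fun _ => bind F2 (fun _ => finish)).
have [c Hc] : poly (fun y => y.+2 ^ c1 + (y.+2 ^ c2 + (30 * y.+2 ^ c3 + 200))) by polytac.
exists (tm_of F), c => n wt wbar.
set inp := enc_input n wt wbar; pose m := input_stacks n wt wbar.
have Einp : inp = enc m by rewrite /m enc_input_stacks.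
have sm : size m = K by apply: size_input.
pose v := map bits_val m; have sv : size v = K by rewrite size_map.
have tv : tsize v <= size inp by rewrite Einp; apply: tsize_vals.
have h1 := H1 m sm; rewrite -Einp in h1.
have h2 := H2 v [::] sv; rewrite !cats0 in h2.
have [tp h3 outE] := @runs_finish (bits (onum v)) (bits (oden v)) (map bits v) _ (Hsize v sv).
have [t lt ht] : exists2 t, t <= (size inp).+2 ^ c & halts_with (tm_of F) t inp
    (take (find is_blank tp.2) tp.2).
  have [|t lt ht] := @runs_halts F inp ((size inp).+2 ^ c) tp; last by exists t.
  apply: runs_leq (Hc _); rewrite [inp in X in runs _ X]Einp.
  apply: (runs_bind h1); apply: (runs_bind (t := (size inp).+2 ^ c2)).
    by apply: (runs_leq h2); apply: leq_tsize_exp.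
  apply: (runs_leq h3); rewrite leq_add2r leq_mul2l; apply/orP; right.
  exact: leq_tsize_exp.
exists t; split => //; rewrite outE in ht.
suff <- : map sbit (if nilp (bits (onum v)) then [:: false; false] else bits (onum v)) ++
    Sep :: map sbit (bits (oden v)) = enc_rat (WFOMC Gamma cards funs wt wbar n) by [].
have b0 Q : 0 < b v Q by rewrite /b; have [_ -> _ _] := reg_input n wt wbar Q; rewrite absz_gt0 denq_neq0.
have bb0 Q : 0 < bb v Q by rewrite /bb; have [_ _ _ ->] := reg_input n wt wbar Q; rewrite absz_gt0 denq_neq0.
have half_bit (s : bool) y : odd (s + y.*2) = s /\ (s + y.*2)./2 = y.
  by rewrite oddD odd_double addbF oddb half_bit_double.
have wtE Q : (wt Q = (-1) ^+ sg v Q * (a v Q)%:R / (b v Q)%:R)%R.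
  rewrite [LHS]rat_split /sg /a /b; have [-> -> _ _] := reg_input n wt wbar Q.
  by have [-> ->] := half_bit (numq (wt Q) < 0)%R `|numq (wt Q)|%N.
have wbarE Q : (wbar Q = (-1) ^+ sgb v Q * (ab v Q)%:R / (bb v Q)%:R)%R.
  rewrite [LHS]rat_split /sgb /ab /bb; have [_ _ -> ->] := reg_input n wt wbar Q.
  by have [-> ->] := half_bit (numq (wbar Q) < 0)%R `|numq (wbar Q)|%N.
have E := WFOMC_parts cards sentence funs2 wtE wbarE b0 bb0 n.
have nE : nf v = n by apply: nval_input.
have D0 : 0 < D v by apply: den_gt0.
have E' : (WFOMC Gamma cards funs wt wbar n =
    ((P false v)%:R - (P true v)%:R) / (D v)%:R)%R by rewrite /P /D nE.
exact: (enc_rat_bits D0 E').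
Qed.
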